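(* Let $(U,\{e_i\}_{i\in I})$ and $(T,\{f_j\}_{j\in J})$ be basic $\mathbb{K}$-algebras with enough idempotents, and let $M$ be a $U$-$T$-bimodule on which $\mathbb{K}$ acts centrally, such that $e_iMf_j$ is a $\mathbb{K}$-module of finite length for all $(i,j)\in I\times J$ and $\mathrm{pd}(Mf_j)<\infty$ for all $j\in J$. Let $\Lambda:=\begin{bmatrix}T&0\\ M&U\end{bmatrix}$ with its idempotents $\{g_r\}_{r\in I\vee J}$, and suppose that $(\Lambda,\{g_r\}_{r\in I\vee J})$ is support finite. Let $\tilde{\mathcal{A}}=\{\tilde{\mathcal{A}}_i\}_{i<\alpha}$ be a partition of $I$, $\tilde{\mathcal{B}}=\{\tilde{\mathcal{B}}_j\}_{j<\beta}$ a partition of $J$, and $\tilde{\mathcal{C}}:=\tilde{\mathcal{A}}\vee\tilde{\mathcal{B}}$ the joint partition of $I\vee J$. Then the following statements are equivalent. (a) $\mathcal{F}_f({}_{\tilde{\mathcal{C}}}\Delta)=\mathcal{P}^{<\infty}_\Lambda$. (b) $\mathcal{F}_f({}_{\tilde{\mathcal{A}}}\Delta)=\mathcal{P}^{<\infty}_U$ and $\mathcal{F}_f({}_{\tilde{\mathcal{B}}}\Delta)=\mathcal{P}^{<\infty}_T$. Moreover, if one of these equivalent conditions holds, then $\Lambda$, $U$ and $T$ are locally bounded, $(\Lambda,\tilde{\mathcal{C}})$, $(U,\tilde{\mathcal{A}})$ and $(T,\tilde{\mathcal{B}})$ are left standardly stratified $\mathbb{K}$-algebras, and $\mathrm{fin.dim.}(\Lambda)=\mathrm{pd}({}_{\tilde{\mathcal{C}}}\Delta)$,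 $\mathrm{fin.dim.}(T)=\mathrm{pd}({}_{\tilde{\mathcal{B}}}\Delta)$ and $\mathrm{fin.dim.}(U)=\mathrm{pd}({}_{\tilde{\mathcal{A}}}\Delta)$.
   Context: $\mathbb{K}$ is a fixed commutative ring with unity. Rings and algebras are associative but need not have a unity. A $\mathbb{K}$-algebra with enough idempotents (w.e.i. $\mathbb{K}$-algebra) is a pair $(R,\{e_i\}_{i\in I})$ with $R$ a $\mathbb{K}$-algebra and $\{e_i\}_{i\in I}$ a family of orthogonal idempotents of $R$ such that $R=\bigoplus_{i\in I}e_iR=\bigoplus_{i\in I}Re_i$. $\mathrm{Mod}(R)$ is the category of unitary left $R$-modules ($N$ with $RN=N$) and $\mathrm{mod}(R)$ its full subcategory of finitely generated modules. The algebra is basic if every $e_jRe_i$ is a $\mathbb{K}$-module of finite length, each $e_i$ is primitive, and $Re_i\not\simeq Re_j$ for $e_i\neq e_j$. Bimodules are unitary: $UM=M=MT$. The index sets $I,J$ are nonempty. Triangular algebra: $\Lambda$ consists of the matrices $\begin{bmatrix}t&0\\ m&u\end{bmatrix}$ ($t\in T$, $m\in M$, $u\in U$) with entrywise sum and product $\begin{bmatrix}t&0\\ m&u\end{bmatrix}\begin{bmatrix}t'&0\\ m'&u'\end{bmatrix}=\begin{bmatrix}tt'&0\\ mt'+um'&uu'\end{bmatrix}$. With $I\vee J=(I\times\{1\})\cup(J\times\{2\})$, set $g_{(i,1)}=\begin{bmatrix}0&0\\0&e_i\end{bmatrix}$ and $g_{(j,2)}=\begin{bmatrix}f_j&0\\0&0\end{bmatrix}$.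 Under the stated hypotheses $(\Lambda,\{g_r\}_{r\in I\vee J})$ is a basic w.e.i. $\mathbb{K}$-algebra. Partitions: partitions are indexed by ordinals. The joint partition $\tilde{\mathcal{A}}\vee\tilde{\mathcal{B}}$ of $I\vee J$ is indexed by the well-ordered set $[0,\alpha)\vee[0,\beta)$, in which every element of $[0,\alpha)\times\{1\}$ precedes every element of $[0,\beta)\times\{2\}$ (order type $\alpha+\beta$), and $(\tilde{\mathcal{A}}\vee\tilde{\mathcal{B}})_{(i,1)}=\tilde{\mathcal{A}}_i\times\{1\}$, $(\tilde{\mathcal{A}}\vee\tilde{\mathcal{B}})_{(j,2)}=\tilde{\mathcal{B}}_j\times\{2\}$. Standard modules: for a basic w.e.i. $\mathbb{K}$-algebra $(R,\{e_i\}_{i\in I})$ and a partition $\tilde{\mathcal{A}}=\{\tilde{\mathcal{A}}_i\}_{i<\alpha}$ of $I$, for $t\in\tilde{\mathcal{A}}_i$ put $P_t(i):=Re_t$, $\overline{P}(j):=\bigoplus_{r\in\tilde{\mathcal{A}}_j}P_r(j)$, and ${}_{\tilde{\mathcal{A}}}\Delta_t(i):=P_t(i)/\mathrm{Tr}_{\bigoplus_{j<i}\overline{P}(j)}(P_t(i))$, where $\mathrm{Tr}_X(N)$ is the sum of the images of all morphisms $X\to N$. Put $\Delta(i)=\{{}_{\tilde{\mathcal{A}}}\Delta_t(i)\}_{t\in\tilde{\mathcal{A}}_i}$ and ${}_{\tilde{\mathcal{A}}}\Delta=\bigcup_{i<\alpha}\Delta(i)$. For a class $\Theta$ of modules, $\mathcal{F}_f(\Theta)$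 is the class of $N\in\mathrm{Mod}(R)$ having a finite chain of submodules $0=N_0\subseteq\dots\subseteq N_n=N$ with each $N_k/N_{k-1}$ isomorphic to an object of $\Theta$. $(R,\tilde{\mathcal{A}})$ is a left standardly stratified $\mathbb{K}$-algebra if $\mathrm{Tr}_{\bigoplus_{j<i}\overline{P}(j)}(P_t(i))\in\mathcal{F}_f(\bigcup_{j<i}\Delta(j))$ for all $i<\alpha$, $t\in\tilde{\mathcal{A}}_i$. Support finite: $(R,\{e_i\}_{i\in I})$ (each $e_i$ primitive) is support finite if for each $i$ both $\{k: e_kRe_i\neq0\}$ and $\{k: e_iRe_k\neq0\}$ are finite. Locally bounded: each $e_i$ is primitive, $R$ is support finite, and $R$ is locally endofinite, i.e. all left modules $Re_i$ and all right modules $e_iR$ are endofinite, where a module $N$ is endofinite if each $e_kN$ (resp. $Ne_k$ for right modules) has finite length as a module over the endomorphism ring of $N$. Dimensions: $\mathrm{pd}$ is projective dimension in $\mathrm{Mod}$; $\mathcal{P}^{<\infty}_R$ is the class of $N\in\mathrm{mod}(R)$ with $\mathrm{pd}(N)<\infty$; for a class $\mathcal{X}$, $\mathrm{pd}(\mathcal{X})=\sup\{\mathrm{pd}(N):N\in\mathcal{X}\}$; $\mathrm{fin.dim.}(R):=\mathrm{pd}(\mathcal{P}^{<\infty}_R)$. The zero module has finite projective dimension, taken to be $0$. *)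

(* Defs.v *)
From HB Require Import structures.
From mathcomp Require Import all_boot all_order all_algebra.
From mathcomp Require Import ring_quotient.
From mathcomp Require Import boolp classical_sets functions cardinality fsbigop.
From mathcomp Require Import wochoice.

Set Implicit Arguments.
Unset Strict Implicit.
Unset Printing Implicit Defensive.

Import GRing.Theory.
Local Open Scope classical_set_scope.
Local Open Scope ring_scope.

(* Associative K-algebras, not necessarily with a unity: the rings of the
   MathComp hierarchy are all unital. *)
Record nualg (K : comPzRingType) := NuAlg {
  na_sort :> lmodType K;
  na_mul : na_sort -> na_sort -> na_sort;
  na_mulA : forall x y z, na_mul x (na_mul y z) = na_mul (na_mul x y) z;
  na_mulDl : forall x y z, na_mul (x + y) z = na_mul x z + na_mul y z;
  na_mulDr : forall x y z, na_mul x (y + z) = na_mul x y + na_mul x z;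
  na_mulZl : forall (a : K) x y, na_mul (a *: x) y = a *: na_mul x y;
  na_mulZr : forall (a : K) x y, na_mul x (a *: y) = a *: na_mul x y
}.

Arguments na_mul {K n}.
Declare Scope nualg_scope.
Delimit Scope nualg_scope with NA.
Local Open Scope nualg_scope.
Notation "x ** y" := (na_mul x y) (at level 40, left associativity) : nualg_scope.

Lemma na_mulNl (K : comPzRingType) (R : nualg K) (x y : R) :
  (- x) ** y = - (x ** y).
Proof. by rewrite -(scaleN1r x) na_mulZl scaleN1r. Qed.

Lemma na_mul0l (K : comPzRingType) (R : nualg K) (x : R) : (0 : R) ** x = 0.
Proof. by apply: (addrI ((0 : R) ** x)); rewrite -na_mulDl !addr0. Qed.

Section Opposite.
Variables (K : comPzRingType) (R : nualg K).

Definition nuopp : nualg K.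
Proof.
by refine (@NuAlg K R (fun x y => y ** x) _ _ _ _ _) => *;
  rewrite ?na_mulA ?na_mulDl ?na_mulDr ?na_mulZl ?na_mulZr.
Defined.

End Opposite.

(* Left R-modules, not necessarily unitary.  No action of K is recorded: when R
   has enough idempotents a unitary R-module N carries exactly one compatible
   K-action, a (r n) = (a r) n, and R-morphisms preserve it. *)
Record numod (K : comPzRingType) (R : nualg K) := NuMod {
  nm_sort :> zmodType;
  nm_act : R -> nm_sort -> nm_sort;
  nm_actA : forall r s x, nm_act r (nm_act s x) = nm_act (r ** s) x;
  nm_actDl : forall r s x, nm_act (r + s) x = nm_act r x + nm_act s x;
  nm_actDr : forall r x y, nm_act r (x + y) = nm_act r x + nm_act r y
}.

Arguments nm_act {K R n}.
Notation "r |> x" := (nm_act r x) (at level 40, left associativity) : nualg_scope.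

Section Modules.
Variables (K : comPzRingType) (R : nualg K).
Implicit Types (N X Y : numod R).

Lemma nm_actr0 N (r : R) : r |> (0 : N) = 0.
Proof. by apply: (addrI (r |> (0 : N))); rewrite -nm_actDr !addr0. Qed.

Lemma nm_actN N (r : R) (x : N) : r |> (- x) = - (r |> x).
Proof. by apply: (addrI (r |> x)); rewrite -nm_actDr !subrr nm_actr0. Qed.

Lemma nm_actB N (r : R) (x y : N) : r |> (x - y) = r |> x - r |> y.
Proof. by rewrite nm_actDr nm_actN. Qed.

Definition unitary N : Prop :=
  forall x : N, exists s : seq (R * N), x = \sum_(p <- s) p.1 |> p.2.

Record nhom X Y := NHom {
  nhom_fun :> {additive X -> Y};
  nhom_act : forall (r : R) (x : X), nhom_fun (r |> x) = r |> nhom_fun x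
}.

Definition isom X Y : Prop := exists f : nhom X Y, bijective f.

Record submod N := SubMod {
  sm_set :> N -> Prop;
  sm_0 : sm_set 0;
  sm_B : forall x y, sm_set x -> sm_set y -> sm_set (x - y);
  sm_act : forall (r : R) x, sm_set x -> sm_set (r |> x)
}.

Definition sm_pred N (S : submod N) : {pred N} := fun x => `[< S x >].

Lemma sm_predP N (S : submod N) x : reflect (S x) (x \in sm_pred S).
Proof. exact: asboolP. Qed.

Lemma sm_pred_closed N (S : submod N) : zmod_closed (sm_pred S).
Proof.
by split=> [|x y /sm_predP Sx /sm_predP Sy]; apply/sm_predP;
  [exact: sm_0|exact: sm_B].
Qed.

HB.instance Definition _ N (S : submod N) :=
  GRing.isZmodClosed.Build N (sm_pred S) (sm_pred_closed S).

Definition sm_type N (S : submod N) : Type := {x : N | x \in sm_pred S}.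

HB.instance Definition _ N (S : submod N) := SubChoice.on (sm_type S).
HB.instance Definition _ N (S : submod N) :=
  [SubChoice_isSubZmodule of sm_type S by <:].

Lemma sm_act_subproof N (S : submod N) (r : R) (x : sm_type S) :
  r |> val x \in sm_pred S.
Proof. by apply/sm_predP/sm_act/sm_predP/(valP x). Qed.

Definition smod N (S : submod N) : numod R.
Proof.
refine (@NuMod K R (sm_type S)
  (fun r x => (Sub (r |> val x) (sm_act_subproof r x) : sm_type S)) _ _ _).
- by move=> r s x; apply: val_inj; rewrite !SubK nm_actA.
- by move=> r s x; apply: val_inj; rewrite raddfD !SubK nm_actDl.
- by move=> r x y; apply: val_inj; rewrite [RHS]raddfD !SubK; exact: nm_actDr.
Defined.

(* Preimage of S in the submodule S', that is S' :&: S *)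
Definition sm_restr N (S S' : submod N) : submod (smod S').
Proof.
refine (@SubMod (smod S') (fun x : sm_type S' => S (val x)) _ _ _).
- exact: sm_0.
- by move=> x y Sx Sy; apply: sm_B.
- by move=> r x Sx; apply: (sm_act r Sx).
Defined.

Local Open Scope quotient_scope.

Definition qtype N (S : submod N) : zmodType := Quotient.quot (sm_pred S).

Definition qpi N (S : submod N) (x : N) : qtype S := \pi_(qtype S) x.

Definition qact N (S : submod N) (r : R) (q : qtype S) : qtype S :=
  qpi S (r |> repr q).

Lemma qpi_surj N (S : submod N) (q : qtype S) : exists x, q = qpi S x.
Proof. by exists (repr q); rewrite /qpi reprK. Qed.

Lemma qpiD N (S : submod N) (x y : N) : qpi S (x + y) = qpi S x + qpi S y.
Proof. exact: raddfD. Qed.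

Lemma qact_pi N (S : submod N) (r : R) (x : N) :
  qact r (qpi S x) = qpi S (r |> x).
Proof.
apply/eqP; rewrite -Quotient.idealrBE -nm_actB.
by apply/sm_predP/sm_act/sm_predP; rewrite Quotient.idealrBE reprK.
Qed.

Definition qmod N (S : submod N) : numod R.
Proof.
refine (@NuMod K R (qtype S) (@qact N S) _ _ _).
- by move=> r s q; have [x ->] := qpi_surj q; rewrite !qact_pi nm_actA.
- by move=> r s q; have [x ->] := qpi_surj q; rewrite !qact_pi nm_actDl qpiD.
- move=> r p q; have [x ->] := qpi_surj p; have [y ->] := qpi_surj q.
  by rewrite -qpiD !qact_pi nm_actDr qpiD.
Defined.

End Modules.

Section DirectSum.
Variables (K : comPzRingType) (R : nualg K) (I : Type) (N : I -> numod R).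

Definition dfam : Type := forall k, N k.

HB.instance Definition _ := gen_eqMixin dfam.
HB.instance Definition _ := gen_choiceMixin dfam.

Fact dfam_addA : associative (fun f g : dfam => (fun k => f k + g k) : dfam).
Proof. by move=> f g h; apply: functional_extensionality_dep => k; rewrite addrA. Qed.
Fact dfam_addC : commutative (fun f g : dfam => (fun k => f k + g k) : dfam).
Proof. by move=> f g; apply: functional_extensionality_dep => k; rewrite addrC. Qed.
Fact dfam_add0 :
  left_id ((fun k => 0) : dfam) (fun f g : dfam => (fun k => f k + g k) : dfam).
Proof. by move=> f; apply: functional_extensionality_dep => k; rewrite add0r. Qed.
Fact dfam_addN :
  left_inverse ((fun k => 0) : dfam) (fun f : dfam => (fun k => - f k) : dfam)
    (fun f g : dfam => (fun k => f k + g k) : dfam).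
Proof. by move=> f; apply: functional_extensionality_dep => k; rewrite addNr. Qed.

HB.instance Definition _ :=
  GRing.isZmodule.Build dfam dfam_addA dfam_addC dfam_add0 dfam_addN.

Definition dprod : numod R.
Proof.
refine (@NuMod K R dfam (fun r f => (fun k => r |> f k) : dfam) _ _ _) => *;
  apply: functional_extensionality_dep => k;
  [exact: nm_actA|exact: nm_actDl|exact: nm_actDr].
Defined.

Definition dsum_sub : submod dprod.
Proof.
refine (@SubMod K R dprod (fun f : dfam => finite_set [set k | f k <> 0]) _ _ _).
- by rewrite (_ : [set k | _] = set0) // -subset0 => k /=.
- move=> f g ff fg.
  have : finite_set ([set k | f k <> 0] `|` [set k | g k <> 0]).
    by rewrite finite_setU.
  apply: sub_finite_set => k /= fgk.
  have [fk0|] := pselect (f k = 0); last by left.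
  by right => gk0; apply: fgk; rewrite -[LHS]/(f k - g k) fk0 gk0 subrr.
- move=> r f; apply: sub_finite_set => k /= rfk fk0.
  by apply: rfk; rewrite fk0 nm_actr0.
Defined.

Definition dsum : numod R := smod dsum_sub.

End DirectSum.

Section Trace.
Variables (K : comPzRingType) (R : nualg K) (X N : numod R).

(* The sum of the images of all morphisms X -> N *)
Definition trace : submod N.
Proof.
refine (@SubMod K R N (fun y => exists s : seq (nhom X N * X),
                                  y = \sum_(p <- s) p.1 p.2) _ _ _).
- by exists [::]; rewrite big_nil.
- move=> _ _ [s ->] [t ->]; exists (s ++ [seq (p.1, - p.2) | p <- t]).
  rewrite big_cat big_map -sumrN; congr (_ + _).
  by apply: eq_bigr => p _; rewrite raddfN.
- move=> r _ [s ->]; exists [seq (p.1, r |> p.2) | p <- s]; rewrite big_map.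
  elim: s => [|p s IHs]; first by rewrite !big_nil nm_actr0.
  by rewrite !big_cons nm_actDr IHs nhom_act.
Defined.

End Trace.

(* Extended natural numbers, None being infinity *)
Definition enat := option nat.

Definition enat_le (x y : enat) : Prop :=
  match x, y with
  | _, None => True
  | Some m, Some n => (m <= n)%N
  | None, Some _ => False
  end.

Definition enat_sup (S : set enat) : enat :=
  xget None [set b | (forall x, S x -> enat_le x b) /\
                     forall c, (forall x, S x -> enat_le x c) -> enat_le b c].

Definition enat_inf (S : set enat) : enat :=
  xget None [set b | (forall x, S x -> enat_le b x) /\
                     forall c, (forall x, S x -> enat_le c x) -> enat_le c b].

(* Classes of modules; [set (numod R)] is excluded by universe constraints. *)
Definition modclass (K : comPzRingType) (R : nualg K) := numod R -> Prop.

Definition modclass_eq (K : comPzRingType) (R : nualg K)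
  (Theta Theta' : modclass R) : Prop := forall N, Theta N <-> Theta' N.

Section Homological.
Variables (K : comPzRingType) (R : nualg K).
Implicit Types (N P X Y : numod R) (Theta : modclass R).

Definition projective P : Prop :=
  unitary P /\
  forall X Y, unitary X -> unitary Y ->
    forall (p : nhom X Y) (f : nhom P Y), (forall y, exists x, p x = y) ->
    exists h : nhom P X, forall x, p (h x) = f x.

(* N has a projective resolution  0 -> P_n -> ... -> P_0 -> N -> 0 *)
Definition has_proj_res N (n : nat) : Prop :=
  exists (P : nat -> numod R) (d : forall k, nhom (P k.+1) (P k))
         (eps : nhom (P 0%N) N),
    [/\ forall k, projective (P k),
        forall y, exists x, eps x = y,
        forall x, eps x = 0 <-> exists z, d 0%N z = x,
        forall k x, d k x = 0 <-> exists z, d k.+1 z = x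
      & forall k, (n < k)%N -> forall x : P k, x = 0].

Definition pd N : enat :=
  enat_inf [set m | exists2 n, has_proj_res N n & m = Some n].

Definition pd_class Theta : enat := enat_sup [set m | exists2 N, Theta N & pd N = m].

Definition fin_gen N : Prop :=
  exists s : seq N, forall S : submod N, (forall x, x \in s -> S x) ->
    forall x, S x.

Definition Pfin : modclass R :=
  fun N => [/\ unitary N, fin_gen N & pd N <> None].

Definition fin_dim : enat := pd_class Pfin.

(* Modules with a finite filtration whose factors are in Theta, up to iso *)
Definition Ff Theta : modclass R := fun N =>
  unitary N /\
    exists (n : nat) (C : nat -> submod N),
      [/\ forall x, C 0%N x <-> x = 0, forall x, C n x
        & forall k, (k < n)%N -> (forall x, C k x -> C k.+1 x) /\
            exists2 X, Theta X & isom (qmod (sm_restr (C k) (C k.+1))) X].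

End Homological.

(* A has a composition series 0 = C_0 < ... < C_n = A, where L is the set of
   subobjects. *)
Definition finite_length (V : zmodType) (L : set (set V)) (A : set V) : Prop :=
  exists (n : nat) (C : nat -> set V),
    [/\ C 0%N = [set 0], C n = A, forall k, (k <= n)%N -> L (C k)
      & forall k, (k < n)%N -> C k `<` C k.+1 /\
          forall B, L B -> C k `<=` B -> B `<=` C k.+1 ->
            B = C k \/ B = C k.+1].

Definition Ksubmod (K : pzRingType) (V : lmodType K) : set (set V) :=
  [set B | B 0 /\ forall (a : K) x y, B x -> B y -> B (a *: x + y)].

(* Additive subgroups of N stable under the endomorphisms of N; among them, those
   contained in e N are the End(N)-submodules of e N. *)
Definition Endsubmod (K : comPzRingType) (R : nualg K) (N : numod R) :
    set (set N) :=
  [set B | [/\ B 0, forall x y, B x -> B y -> B (x - y)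
             & forall (f : nhom N N) x, B x -> B (f x)]].

Definition internal_dsum (V : zmodType) (I : choiceType) (S : I -> set V) : Prop :=
  forall x : V, exists! f : I -> V,
    [/\ forall i, S i (f i), finite_set [set i | f i <> 0]
      & x = \sum_(i \in [set: I]) f i].

Section Wei.
Variables (K : comPzRingType) (R : nualg K).

Definition regmod : numod R :=
  @NuMod K R R na_mul (@na_mulA K R) (@na_mulDl K R) (@na_mulDr K R).

Definition lideal (x : R) : submod regmod.
Proof.
refine (@SubMod K R regmod (fun y => exists r : R, y = r ** x) _ _ _).
- by exists (0 : R); rewrite na_mul0l.
- move=> _ _ [r ->] [s ->]; exists (r - s).
  by rewrite na_mulDl na_mulNl.
- by move=> r _ [s ->]; exists (r ** s); exact: na_mulA.
Defined.

Definition Rmul (x : R) : numod R := smod (lideal x).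

Variables (I : choiceType) (e : I -> R).

Definition wei : Prop :=
  [/\ forall i, e i ** e i = e i,
      forall i j, i <> j -> e i ** e j = 0,
      internal_dsum (fun i => [set x : R | exists r, x = e i ** r])
    & internal_dsum (fun i => [set x : R | exists r, x = r ** e i])].

Definition primitive (x : R) : Prop :=
  [/\ x ** x = x, x <> 0
    & forall y z, y ** y = y -> z ** z = z -> y ** z = 0 -> z ** y = 0 ->
        x = y + z -> y = 0 \/ z = 0].

Definition basic_wei : Prop :=
  [/\ wei,
      forall i j, finite_length (@Ksubmod K R)
                    [set x : R | exists r, x = e j ** r ** e i],
      forall i, primitive (e i)
    & forall i j, e i <> e j -> ~ isom (Rmul (e i)) (Rmul (e j))].

Definition support_finite : Prop :=
  [/\ forall i, primitive (e i),
      forall i, finite_set [set k | exists r, e k ** r ** e i <> 0]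
    & forall i, finite_set [set k | exists r, e i ** r ** e k <> 0]].

Definition endofinite (N : numod R) : Prop :=
  forall k, finite_length (@Endsubmod K R N) [set y : N | exists x, y = e k |> x].

End Wei.

(* Right R-modules are left modules over the opposite algebra, where e_i R
   becomes R^op e_i, and N e_k becomes e_k N. *)
Definition locally_endofinite (K : comPzRingType) (R : nualg K) (I : choiceType)
    (e : I -> R) : Prop :=
  (forall i, endofinite e (Rmul (e i))) /\
  (forall i, @endofinite K (nuopp R) I e (@Rmul K (nuopp R) (e i))).

Definition locally_bounded (K : comPzRingType) (R : nualg K) (I : choiceType)
    (e : I -> R) : Prop :=
  [/\ forall i, primitive (e i), support_finite e & locally_endofinite e].

(* An ordinal is represented by a well-ordered type W; le is the non-strict
   order, so that j < i reads ~~ le i j. *)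
Definition wo_partition (I W : Type) (le : rel W) (A : W -> set I) : Prop :=
  well_order le /\ partition [set: W] A [set: I].

Section Standard.
Variables (K : comPzRingType) (R : nualg K) (I : choiceType) (e : I -> R).
Variables (W : Type) (le : rel W) (A : W -> set I).

(* \overline{P}(j) *)
Definition Pbar (j : W) : numod R := dsum (fun r : {r : I | A j r} => Rmul (e (sval r))).

Definition Pbelow (i : W) : numod R := dsum (fun j : {j : W | ~~ le i j} => Pbar (sval j)).

Definition std_trace (i : W) (t : I) : submod (Rmul (e t)) :=
  trace (Pbelow i) (Rmul (e t)).

(* Delta_t(i), meant for t in A i *)
Definition Delta (i : W) (t : I) : numod R := qmod (std_trace i t).

Definition Delta_at (i : W) : modclass R :=
  fun N => exists2 t, A i t & N = Delta i t.

Definition Delta_below (i : W) : modclass R :=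
  fun N => exists2 j, ~~ le i j & Delta_at j N.

Definition Delta_all : modclass R := fun N => exists i, Delta_at i N.

Definition left_std_stratified : Prop :=
  [/\ basic_wei e, wo_partition le A
    & forall i t, A i t ->
        Ff (Delta_below i) (smod (std_trace i t))].

End Standard.

(* U-T-bimodules on which K acts centrally *)
Record bimod (K : comPzRingType) (U T : nualg K) := BiMod {
  bm_sort :> lmodType K;
  bm_l : U -> bm_sort -> bm_sort;
  bm_r : bm_sort -> T -> bm_sort;
  bm_lA : forall u v m, bm_l u (bm_l v m) = bm_l (u ** v) m;
  bm_lDl : forall u v m, bm_l (u + v) m = bm_l u m + bm_l v m;
  bm_lDr : forall u m n, bm_l u (m + n) = bm_l u m + bm_l u n;
  bm_rA : forall m s t, bm_r (bm_r m s) t = bm_r m (s ** t);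
  bm_rDl : forall m n t, bm_r (m + n) t = bm_r m t + bm_r n t;
  bm_rDr : forall m s t, bm_r m (s + t) = bm_r m s + bm_r m t;
  bm_lrA : forall u m t, bm_r (bm_l u m) t = bm_l u (bm_r m t);
  bm_Zl : forall (a : K) u m, bm_l (a *: u) m = a *: bm_l u m;
  bm_lZ : forall (a : K) u m, bm_l u (a *: m) = a *: bm_l u m;
  bm_rZ : forall (a : K) m t, bm_r m (a *: t) = a *: bm_r m t;
  bm_Zr : forall (a : K) m t, bm_r (a *: m) t = a *: bm_r m t
}.

Arguments bm_l {K U T b}.
Arguments bm_r {K U T b}.

Section Triangular.
Variables (K : comPzRingType) (U T : nualg K) (M : bimod U T).

Definition bm_left : numod U :=
  @NuMod K U M bm_l (@bm_lA _ _ _ M) (@bm_lDl _ _ _ M) (@bm_lDr _ _ _ M).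

Definition bi_unitary : Prop :=
  (forall m : M, exists s : seq (U * M), m = \sum_(p <- s) bm_l p.1 p.2) /\
  (forall m : M, exists s : seq (M * T), m = \sum_(p <- s) bm_r p.1 p.2).

Definition bm_Mf_sub (f : T) : submod bm_left.
Proof.
refine (@SubMod K U bm_left (fun m => exists n : M, m = bm_r n f) _ _ _).
- by exists (0 : M); apply/esym/(addrI (bm_r (0 : M) f)); rewrite -bm_rDl !addr0.
- move=> _ _ [m ->] [n ->]; exists (m - n).
  by rewrite bm_rDl -(scaleN1r n) bm_Zr scaleN1r.
- by move=> u _ [m ->]; exists (bm_l u m); rewrite bm_lrA.
Defined.

Definition bm_Mf (f : T) : numod U := smod (bm_Mf_sub f).

(* (t, m, u) stands for the matrix [t 0; m u] *)
Definition tri_mul (x y : (T * M * U)%type) : (T * M * U)%type :=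
  let: (t, m, u) := x in let: (t', m', u') := y in
  (t ** t', bm_r m t' + bm_l u m', u ** u').

Definition triangular : nualg K.
Proof.
refine (@NuAlg K (T * M * U)%type tri_mul _ _ _ _ _).
- move=> [[t m] u] [[t' m'] u'] [[t2 m2] u2] /=.
  by rewrite !na_mulA bm_lDr bm_rDl bm_rA bm_lA bm_lrA addrA.
- move=> [[t m] u] [[t' m'] u'] [[t2 m2] u2]; congr (_, _, _) => /=;
    rewrite ?na_mulDl // bm_rDl bm_lDl; exact: addrACA.
- move=> [[t m] u] [[t' m'] u'] [[t2 m2] u2]; congr (_, _, _) => /=;
    rewrite ?na_mulDr // bm_rDr bm_lDr; exact: addrACA.
- move=> a [[t m] u] [[t' m'] u']; congr (_, _, _) => /=;
    by rewrite ?na_mulZl // bm_Zr bm_Zl scalerDr.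
- move=> a [[t m] u] [[t' m'] u']; congr (_, _, _) => /=;
    by rewrite ?na_mulZr // bm_rZ bm_lZ scalerDr.
Defined.

Variables (I J : choiceType) (e : I -> U) (f : J -> T).

Definition tri_idem (r : I + J) : triangular :=
  match r with
  | inl i => (0, 0, e i)
  | inr j => (f j, 0, 0)
  end.

End Triangular.

Section Joint.
Variables (I J V W : Type) (leV : rel V) (leW : rel W).

Definition joint_le : rel (V + W) := fun x y =>
  match x, y with
  | inl i, inl j => leV i j
  | inr i, inr j => leW i j
  | inl _, inr _ => true
  | inr _, inl _ => false
  end.

Definition joint_part (A : V -> set I) (B : W -> set J) (x : V + W) : set (I + J) :=
  match x with
  | inl i => inl @` A i
  | inr j => inr @` B j
  end.

End Joint.

(* Main.v *)
(* A module N over the triangular algebra L is an extension of (N_T, 0) by (0, N_U),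
   where N_U is the part of N on which T acts by zero.  Both N |-> N_U and N |-> N_T
   are exact and the standard modules of L are the (0, Delta_A) and the (Delta_B, 0),
   so N is filtered by standard modules if and only if N_U and N_T are.
   On the homological side, pd (0, Y) = pd Y, and N |-> N_T preserves projectives, so
   pd X <= pd (X, 0).  Conversely, L g_j is a projective module over (T f_j, 0)
   with kernel (0, M f_j), which has finite projective dimension; as finitely generated
   modules are noetherian, (X, 0) has finite projective dimension whenever X is
   finitely generated of finite projective dimension.  Hence N has finite projective
   dimension if and only if N_U and N_T have, and (a) <-> (b) follows.
   If F_f(Delta) is the class of finitely generated modules of finite projective
   dimension, it contains every R e_t, and the trace of the projectives of index
   below i in a filtered module is filtered by the factors of index below i. *)
Require Import Defs.
From HB Require Import structures.
From mathcomp Require Import all_boot all_order all_algebra ring_quotient.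
From mathcomp Require Import boolp classical_sets functions cardinality fsbigop wochoice.

Set Implicit Arguments.
Unset Strict Implicit.
Unset Printing Implicit Defensive.

Import GRing.Theory.
Local Open Scope classical_set_scope.
Local Open Scope ring_scope.
Local Open Scope nualg_scope.

(** * Homomorphisms and short exact sequences *)

(** Without a unit, multiplication by $1$ is replaced throughout by multiplication by a finite sum
    of the given idempotents fixing the element at hand. The dimensions $\mathrm{pd}(Mf_j)$ are
    finite one by one but may be unbounded in $j$, so $\mathrm{pd}(X,0)$ need not be bounded in
    terms of $\mathrm{pd}(X)$: the bound depends on finite free covers of $X$ and of its syzygies.
    These syzygies stay finitely generated because $Re_i$ is noetherian: only finitely many
    $e_kRe_i$ are nonzero, and each has finite length over $\mathbb{K}$. The same fact makes $N_U$
    finitely generated when $N$ is. The functor $N\mapsto N_U$ does not preserve projectives, as it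
    sends $\Lambda g_j$ to $Mf_j$; the dimension of $N_U$ is therefore deduced from those of $N$ and
    $(N_T,0)$. Since all indices of $U$ precede those of $T$, the trace in $\Lambda g_j$ contains
    all of $(0,Mf_j)$; hence no standard module mixes both components. A trace is handled as the
    submodule generated by the $e_tN$ with $t$ below $i$. This is not exact in $N$; exactness holds
    in front of a standard module of smaller index, by lifting its generator. *)

Section Homs.
Variables (K : comPzRingType) (R : nualg K).
Implicit Types (N X Y Z : numod R).

Lemma nm_act0r N (x : N) : (0 : R) |> x = 0.
Proof. by apply: (addrI ((0 : R) |> x)); rewrite -nm_actDl !addr0. Qed.

Lemma nm_act_sumr N (r : R) (I : Type) (s : seq I) (P : pred I) (F : I -> N) :
  r |> (\sum_(i <- s | P i) F i) = \sum_(i <- s | P i) r |> F i.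
Proof.
elim: s => [|i s IHs]; first by rewrite !big_nil nm_actr0.
by rewrite !big_cons; case: (P i); rewrite ?nm_actDr IHs.
Qed.

Lemma nm_act_suml N (x : N) (I : Type) (s : seq I) (P : pred I) (F : I -> R) :
  (\sum_(i <- s | P i) F i) |> x = \sum_(i <- s | P i) F i |> x.
Proof.
elim: s => [|i s IHs]; first by rewrite !big_nil nm_act0r.
by rewrite !big_cons; case: (P i); rewrite ?nm_actDl IHs.
Qed.

Lemma sm_opp N (S : submod N) x : S x -> S (- x).
Proof. by move=> Sx; rewrite -sub0r; apply: sm_B => //; apply: sm_0. Qed.

Lemma sm_D N (S : submod N) x y : S x -> S y -> S (x + y).
Proof. by move=> Sx Sy; rewrite -[y]opprK; apply: sm_B => //; apply: sm_opp. Qed.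

Lemma sm_sum N (S : submod N) (I : eqType) (s : seq I) (F : I -> N) :
  (forall i, i \in s -> S (F i)) -> S (\sum_(i <- s) F i).
Proof.
elim: s => [|i s IHs] SF; first by rewrite big_nil; exact: sm_0.
rewrite big_cons; apply: sm_D; first by apply: SF; rewrite mem_head.
by apply: IHs => j js; apply: SF; rewrite inE js orbT.
Qed.

Definition mkhom X Y (h : X -> Y) (hB : zmod_morphism h)
  (hZ : forall (r : R) x, h (r |> x) = r |> h x) : nhom X Y :=
  @NHom K R X Y (HB.pack h (GRing.isZmodMorphism.Build X Y h hB)) hZ.

Definition hid X : nhom X X := @mkhom X X id (fun x y => erefl) (fun r x => erefl).

Definition hcomp X Y Z (g : nhom Y Z) (h : nhom X Y) : nhom X Z.
Proof.
refine (@mkhom X Z (fun x => g (h x)) _ _) => [x y|r x]; first by rewrite !raddfB.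
by rewrite !nhom_act.
Defined.

Lemma hcompE X Y Z (g : nhom Y Z) (h : nhom X Y) x : hcomp g h x = g (h x).
Proof. by []. Qed.

Definition hzero X Y : nhom X Y.
Proof. by refine (@mkhom X Y (fun=> 0) _ _) => [x y|r x]; rewrite ?subr0 ?nm_actr0. Defined.

Definition hadd X Y (g h : nhom X Y) : nhom X Y.
Proof.
refine (@mkhom X Y (fun x => g x + h x) _ _) => [x y|r x].
  by rewrite !raddfB opprD addrACA.
by rewrite !nhom_act nm_actDr.
Defined.

Definition hopp X Y (h : nhom X Y) : nhom X Y.
Proof.
refine (@mkhom X Y (fun x => - h x) _ _) => [x y|r x]; first by rewrite !raddfB.
by rewrite nhom_act nm_actN.
Defined.

Definition kernel X Y (h : nhom X Y) : submod X.
Proof.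
refine (@SubMod K R X (fun x => h x = 0) _ _ _).
- exact: raddf0.
- by move=> x y hx hy; rewrite raddfB hx hy subrr.
- by move=> r x hx; rewrite nhom_act hx nm_actr0.
Defined.

Definition preimg X Y (h : nhom X Y) (S : submod Y) : submod X.
Proof.
refine (@SubMod K R X (fun x => S (h x)) _ _ _).
- by rewrite raddf0; exact: sm_0.
- by move=> x y hx hy; rewrite raddfB; exact: sm_B.
- by move=> r x hx; rewrite nhom_act; exact: sm_act.
Defined.

Definition img X Y (h : nhom X Y) (S : submod X) : submod Y.
Proof.
refine (@SubMod K R Y (fun y => exists2 x, S x & h x = y) _ _ _).
- by exists 0; [exact: sm_0|exact: raddf0].
- move=> _ _ [x Sx <-] [y Sy <-]; exists (x - y); last exact: raddfB.
  exact: sm_B.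
- by move=> r _ [x Sx <-]; exists (r |> x); [exact: sm_act|exact: nhom_act].
Defined.

Definition sm_bot N : submod N.
Proof.
refine (@SubMod K R N (fun x => x = 0) _ _ _) => //.
  by move=> _ _ -> ->; rewrite subrr.
by move=> r _ ->; rewrite nm_actr0.
Defined.

Definition nzero : numod R := smod (sm_bot (regmod R)).

Lemma nzero0 (x : nzero) : x = 0.
Proof. by apply: val_inj; move/sm_predP: (valP x). Qed.

Definition sm_elt N (S : submod N) x (Sx : S x) : smod S :=
  (Sub x (introT (sm_predP S x) Sx) : sm_type S).

Lemma sm_eltK N (S : submod N) x (Sx : S x) : val (sm_elt Sx : sm_type S) = x.
Proof. exact: SubK. Qed.

Definition incl N (S : submod N) : nhom (smod S) N :=
  @mkhom (smod S) N (fun x : sm_type S => val x) (fun x y => erefl) (fun r x => erefl).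

Lemma inclP N (S : submod N) (x : smod S) : S (incl S x).
Proof. by apply/sm_predP/(valP x). Qed.

Lemma incl_inj N (S : submod N) : injective (incl S).
Proof. exact: val_inj. Qed.

Lemma incl_surj N (S : submod N) x : S x -> exists y, incl S y = x.
Proof. by move=> Sx; exists (sm_elt Sx); exact: sm_eltK. Qed.

Definition corestr X N (S : submod N) (h : nhom X N) (hS : forall x, S (h x)) :
  nhom X (smod S).
Proof.
refine (@mkhom X (smod S) (fun x => sm_elt (hS x)) _ _) => [x y|r x];
  apply: (@incl_inj _ S).
  by rewrite [RHS]raddfB; exact: (raddfB h).
by rewrite [RHS]nhom_act; exact: (nhom_act h).
Defined.

Lemma corestrE X N (S : submod N) (h : nhom X N) (hS : forall x, S (h x)) x :
  incl S (corestr hS x) = h x.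
Proof. exact: sm_eltK. Qed.

Definition proj N (S : submod N) : nhom N (qmod S).
Proof.
refine (@mkhom N (qmod S) (qpi S) _ _) => [x y|r x]; first exact: raddfB.
by rewrite /= -qact_pi.
Defined.

Lemma proj_surj N (S : submod N) (q : qmod S) : exists x, proj S x = q.
Proof. by have [x ->] := qpi_surj q; exists x. Qed.

Lemma proj_eq0 N (S : submod N) x : proj S x = 0 <-> S x.
Proof.
have -> : (0 : qmod S) = proj S 0 by rewrite raddf0.
split.
  by move/eqP; rewrite -Quotient.idealrBE subr0 => /sm_predP.
by move=> Sx; apply/eqP; rewrite -Quotient.idealrBE subr0; apply/sm_predP.
Qed.

Lemma repr_proj N (S : submod N) x : S (repr (proj S x : qtype S) - x).
Proof. by apply/proj_eq0; rewrite raddfB /= /qpi reprK subrr. Qed.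

Lemma qlift_repr N Y (S : submod N) (h : nhom N Y) (hS : forall x, S x -> h x = 0) x :
  h (repr (proj S x : qtype S)) = h x.
Proof. by apply: subr0_eq; rewrite -raddfB hS //; apply: repr_proj. Qed.

Definition qlift N Y (S : submod N) (h : nhom N Y) (hS : forall x, S x -> h x = 0) :
  nhom (qmod S) Y.
Proof.
refine (@mkhom (qmod S) Y (fun q : qtype S => h (repr q)) _ _).
  move=> p q; have [x <-] := proj_surj p; have [y <-] := proj_surj q.
  by rewrite -raddfB !(qlift_repr hS) raddfB.
by move=> r q; have [x <-] := proj_surj q; rewrite -nhom_act !(qlift_repr hS) nhom_act.
Defined.

Lemma qliftE N Y (S : submod N) (h : nhom N Y) (hS : forall x, S x -> h x = 0) x :
  qlift hS (proj S x) = h x.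
Proof. exact: qlift_repr hS x. Qed.

Definition mono X Y (h : nhom X Y) := forall x, h x = 0 -> x = 0.
Definition epi X Y (h : nhom X Y) := forall y, exists x, h x = y.

Lemma nmono_inj X Y (h : nhom X Y) : mono h -> injective h.
Proof.
by move=> hm x y hxy; apply/subr0_eq/hm; rewrite raddfB hxy subrr.
Qed.

Definition ses X Y Z (i : nhom X Y) (p : nhom Y Z) : Prop :=
  [/\ mono i, epi p & forall y, p y = 0 <-> exists x, i x = y].

Lemma ses_kernel Y Z (p : nhom Y Z) : epi p -> ses (incl (kernel p)) p.
Proof.
move=> pe; split=> // [x x0|y]; first by apply: incl_inj; rewrite raddf0.
split=> [py|[x <-]]; last exact: inclP x.
exact: (@incl_surj _ (kernel p)).
Qed.

Lemma ses_comp0 X Y Z (i : nhom X Y) (p : nhom Y Z) x : ses i p -> p (i x) = 0.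
Proof. by case=> _ _ E; apply/E; exists x. Qed.

(** Preimages under a monomorphism are unique, so any choice of them is automatically a morphism.
    Inverses, retractions and maps between syzygies are all obtained this way. *)
Lemma mono_factor W X Y (i : nhom X Y) (h : nhom W Y) :
  mono i -> (forall w, exists x, i x = h w) -> exists k : nhom W X, forall w, i (k w) = h w.
Proof.
move=> im ih; have [k kE] := choice ih.
have kB : zmod_morphism k.
  by move=> x y; apply: (nmono_inj im); rewrite raddfB !kE raddfB.
have kZ r x : k (r |> x) = r |> k x.
  by apply: (nmono_inj im); rewrite nhom_act !kE nhom_act.
by exists (mkhom kB kZ).
Qed.

(** The chosen section [s] of [p] is not additive, but [h \o s] is, because [h] kills the kernel of
    [p]. *)
Lemma epi_factor X Y Z (p : nhom X Y) (h : nhom X Z) :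
  epi p -> (forall x, p x = 0 -> h x = 0) -> exists k : nhom Y Z, forall x, k (p x) = h x.
Proof.
move=> pe ph; have [s sE] := choice pe.
have hs x : h (s (p x)) = h x.
  by apply/subr0_eq; rewrite -raddfB ph // raddfB sE subrr.
have kB : zmod_morphism (fun y => h (s y)).
  move=> x y; have [x' <-] := pe x; have [y' <-] := pe y.
  by rewrite -raddfB !hs raddfB.
have kZ r x : h (s (r |> x)) = r |> h (s x).
  by have [x' <-] := pe x; rewrite -nhom_act !hs nhom_act.
by exists (mkhom kB kZ).
Qed.

Lemma isom_of X Y (h : nhom X Y) : mono h -> epi h -> isom X Y.
Proof.
move=> hm he; exists h.
have [s sE] := choice he; exists s => // x.
by apply: (nmono_inj hm); rewrite sE.
Qed.

Lemma isomP X Y : isom X Y -> exists h : nhom X Y, mono h /\ epi h.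
Proof.
move=> [h [k hk kh]]; exists h; split=> [x hx|y]; last by exists (k y).
by apply: (can_inj hk); rewrite hx raddf0.
Qed.

Lemma isom_sym X Y : isom X Y -> isom Y X.
Proof.
move=> /isomP[h [hm he]].
have [//|k kE] := @mono_factor Y X Y h (hid Y) hm.
apply: (@isom_of _ _ k) => [y ky|x]; first by rewrite -(kE y : _ = y) ky raddf0.
by exists (h x); apply: (nmono_inj hm); rewrite kE.
Qed.

Lemma isom_trans Y X Z : isom X Y -> isom Y Z -> isom X Z.
Proof.
move=> /isomP[h [hm he]] /isomP[k [km ke]].
apply: (@isom_of _ _ (hcomp k h)) => [x /km /hm //|z].
by have [y <-] := ke z; have [x <-] := he y; exists x.
Qed.

Lemma isom_quo Y Z (p : nhom Y Z) (S : submod Y) :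
  epi p -> (forall y, p y = 0 <-> S y) -> isom (qmod S) Z.
Proof.
move=> pe pS; have pS0 x : S x -> p x = 0 by move/pS.
apply: (@isom_of _ _ (qlift pS0)) => [q|z].
  by have [x <-] := proj_surj q; rewrite qliftE => /pS /proj_eq0.
by have [y <-] := pe z; exists (proj S y); rewrite qliftE.
Qed.

Lemma unitary_epi X Y (p : nhom X Y) : epi p -> unitary X -> unitary Y.
Proof.
move=> pe uX y; have [x <-] := pe y; have [s {1}->] := uX x.
exists [seq (q.1, p q.2) | q <- s]; rewrite big_map raddf_sum.
by apply: eq_bigr => q _; rewrite nhom_act.
Qed.

Lemma unitary_ses X Y Z (i : nhom X Y) (p : nhom Y Z) :
  ses i p -> unitary X -> unitary Z -> unitary Y.
Proof.
move=> [im pe E] uX uZ y; have [s sE] := uZ (p y).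
have [t tE] := choice pe; pose y' := \sum_(q <- s) q.1 |> t q.2.
have [x xE] : exists x, i x = y - y'.
  apply/E; rewrite raddfB sE raddf_sum; apply/eqP; rewrite subr_eq0; apply/eqP.
  by apply: eq_bigr => q _; rewrite nhom_act tE.
have [v vE] := uX x.
exists ([seq (q.1, i q.2) | q <- v] ++ [seq (q.1, t q.2) | q <- s]).
rewrite big_cat !big_map /= -/y' -[LHS](subrK y') -xE [in LHS]vE raddf_sum.
by congr (_ + _); apply: eq_bigr => q _; rewrite nhom_act.
Qed.

Definition nprod X Y : numod R.
Proof.
refine (@NuMod K R (X * Y)%type (fun r u => (r |> u.1, r |> u.2)) _ _ _).
- by move=> r s [x y] /=; rewrite !nm_actA.
- by move=> r s [x y] /=; rewrite !nm_actDl.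
- by move=> r [x y] [x' y'] /=; rewrite !nm_actDr.
Defined.

Definition nfst X Y : nhom (nprod X Y) X :=
  @mkhom (nprod X Y) X fst (fun u v => erefl) (fun r u => erefl).
Definition nsnd X Y : nhom (nprod X Y) Y :=
  @mkhom (nprod X Y) Y snd (fun u v => erefl) (fun r u => erefl).
Definition npair W X Y (h : nhom W X) (k : nhom W Y) : nhom W (nprod X Y).
Proof.
refine (@mkhom W (nprod X Y) (fun w => (h w, k w)) _ _) => [x y|r x].
  by rewrite !raddfB.
by rewrite !nhom_act.
Defined.

Lemma ses_prod X Y : ses (npair (hid X) (hzero X Y)) (nsnd X Y).
Proof.
split=> [x [->] //|y|[x y]]; first by exists (0, y).
by split=> [/= ->|[x' [_ <-]] //]; exists x.
Qed.

End Homs.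

(** * Direct sums, projective modules and idempotents *)

Section DirectSums.
Variables (K : comPzRingType) (R : nualg K).
Implicit Types (X Y P Q : numod R).

(** This is $RX$; having it as a submodule lets generation arguments such as [dsum_ind] prove that a
    module is unitary. *)
Definition unitary_part X : submod X.
Proof.
refine (@SubMod K R X (fun x => exists s : seq (R * X), x = \sum_(p <- s) p.1 |> p.2) _ _ _).
- by exists [::]; rewrite big_nil.
- move=> _ _ [s ->] [t ->]; exists (s ++ [seq (p.1, - p.2) | p <- t]).
  rewrite big_cat big_map -sumrN; congr (_ + _).
  by apply: eq_bigr => p _; rewrite nm_actN.
- move=> r _ [s ->]; exists [seq (r ** p.1, p.2) | p <- s]; rewrite big_map.
  by rewrite nm_act_sumr; apply: eq_bigr => p _; rewrite nm_actA.
Defined.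

Lemma unitary_part_hom X Y (h : nhom X Y) x : unitary_part X x -> unitary_part Y (h x).
Proof.
case=> s ->; exists [seq (p.1, h p.2) | p <- s].
by rewrite big_map raddf_sum; apply: eq_bigr => p _; rewrite nhom_act.
Qed.

Section Family.
Variables (I : Type) (N : I -> numod R).

Definition dprj k : nhom (dsum N) (N k) :=
  @mkhom _ _ (dsum N) (N k) (fun z => incl (dsum_sub N) z k)
    (fun x y => erefl) (fun r x => erefl).

Lemma dsum_eqP (x y : dsum N) : (forall k, dprj k x = dprj k y) -> x = y.
Proof. by move=> xy; apply: val_inj; apply: functional_extensionality_dep. Qed.

Lemma dsum_supp (z : dsum N) : finite_set [set k | dprj k z <> 0].
Proof. exact: (@inclP _ _ (dprod N) (dsum_sub N)). Qed.

(** The index type is arbitrary, so equality of indices is decided classically and [x] is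
    transported along it; proof irrelevance removes the transport on the diagonal. *)
Definition dinj_fun k (x : N k) : dfam N := fun k' =>
  match pselect (k = k') with
  | left kk' => eq_rect k (fun k => N k) x k' kk'
  | right _ => 0
  end.

Lemma dinj_funE k (x : N k) : dinj_fun x k = x.
Proof. by rewrite /dinj_fun; case: pselect => // kk; rewrite (Prop_irrelevance kk erefl). Qed.

Lemma dinj_fun0 k (x : N k) k' : k <> k' -> dinj_fun x k' = 0.
Proof. by rewrite /dinj_fun; case: pselect. Qed.

Fact dinj_fun_finite k (x : N k) : dsum_sub N (dinj_fun x : dprod N).
Proof.
apply: (@sub_finite_set _ _ [set k]); last exact: finite_set1.
by move=> k' /=; have [//|/nesym/dinj_fun0->] := pselect (k' = k).
Qed.

Definition dinj k : nhom (N k) (dsum N).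
Proof.
refine (@mkhom _ _ (N k) (dsum N) (fun x => sm_elt (dinj_fun_finite x)) _ _).
  move=> x y; apply: dsum_eqP => k'; rewrite raddfB.
  change (dinj_fun (x - y) k' = dinj_fun x k' - dinj_fun y k').
  have [<-|nk] := pselect (k = k'); first by rewrite !dinj_funE.
  by rewrite !dinj_fun0 // subrr.
move=> r x; apply: dsum_eqP => k'; rewrite nhom_act.
change (dinj_fun (r |> x) k' = r |> dinj_fun x k').
have [<-|nk] := pselect (k = k'); first by rewrite !dinj_funE.
by rewrite !dinj_fun0 // nm_actr0.
Defined.

Lemma dprj_inj k (x : N k) : dprj k (dinj k x) = x.
Proof. exact: dinj_funE. Qed.

Lemma dprj_inj0 k k' (x : N k) : k <> k' -> dprj k' (dinj k x) = 0.
Proof. exact: dinj_fun0. Qed.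

(** A family of finite support is the sum of its components: the induction runs over a list
    containing the support and subtracts one component at a time. *)
Lemma dsum_ind (S : submod (dsum N)) :
  (forall k x, S (dinj k x)) -> forall z, S z.
Proof.
move=> Sinj z.
have [s sE] := (@finite_seqP {classic I} _).1 (dsum_supp z).
have {sE} : forall k : {classic I}, dprj k z <> 0 -> k \in s.
  by move=> k zk; have : [set` s] k by rewrite -sE.
elim: s z => [|k s IHs] z zs.
  rewrite (_ : z = 0); first exact: sm_0.
  by apply: dsum_eqP => k; rewrite raddf0; apply: contrapT => /zs.
rewrite -[z](subrK (dinj k (dprj k z))); apply: sm_D => //; apply: IHs => k'.
rewrite raddfB; have [<-|kk'] := pselect (k = k'); first by rewrite dprj_inj subrr.
rewrite dprj_inj0 // subr0 => /zs; rewrite inE => /orP[/eqP k'k|//].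
by case: kk'.
Qed.

Lemma unitary_dsum : (forall k, unitary (N k)) -> unitary (dsum N).
Proof.
by move=> uN; apply: (@dsum_ind (unitary_part _)) => k x; exact/unitary_part_hom/uN.
Qed.

End Family.

Lemma fsumE (V : zmodType) (I : choiceType) (F : I -> V) (s : seq I) :
  uniq s -> (forall i, i \notin s -> F i = 0) ->
  \sum_(i \in [set: I]) F i = \sum_(i <- s) F i.
Proof.
move=> us F0; rewrite (fsbigE s) // => [|i _]; last exact: F0.
by apply: eq_bigl => i; rewrite in_setT.
Qed.

Section Copairing.
Variables (I : choiceType) (N : I -> numod R) (Y : numod R) (h : forall k, nhom (N k) Y).

Lemma finite_common_supp (z : dsum N) : exists2 s : seq I, uniq s &
  forall k, k \notin s -> dprj N k z = 0.
Proof.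
have [s sE] := (finite_seqP _).1 (dsum_supp z).
exists (undup s); first exact: undup_uniq.
move=> k; rewrite mem_undup; apply: contraNP => zk.
have : [set` s] k by rewrite -sE.
by [].
Qed.

Definition dcopair : nhom (dsum N) Y.
Proof.
refine (@mkhom _ _ (dsum N) Y
  (fun z => \sum_(k \in [set: I]) h k (dprj N k z)) _ _) => [x y|r x].
  have [s us sx] := finite_common_supp x; have [t ut ty] := finite_common_supp y.
  have st k : k \notin undup (s ++ t) -> dprj N k x = 0 /\ dprj N k y = 0.
    by rewrite mem_undup mem_cat negb_or => /andP[/sx ? /ty].
  rewrite !(@fsumE _ _ _ (undup (s ++ t))) ?undup_uniq //.
  - by rewrite -sumrB; apply: eq_bigr => k _; rewrite (raddfB (dprj N k)) raddfB.
  - by move=> k /st[_ ->]; rewrite raddf0.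
  - by move=> k /st[-> _]; rewrite raddf0.
  - by move=> k /st[xk yk]; rewrite (raddfB (dprj N k)) xk yk subrr raddf0.
have [s us sx] := finite_common_supp x.
rewrite (@fsumE _ _ (fun k => h k (dprj N k (r |> x))) s) //; last first.
  by move=> k /sx xk; rewrite (nhom_act (dprj N k)) xk nm_actr0 raddf0.
rewrite (@fsumE _ _ _ s) // => [|k /sx->]; last exact: raddf0.
by rewrite nm_act_sumr; apply: eq_bigr => k _; rewrite (nhom_act (dprj N k)) nhom_act.
Defined.

Lemma dcopairE k x : dcopair (dinj N k x) = h k x.
Proof.
rewrite [LHS](@fsumE _ _ (fun j => h j (dprj N j (dinj N k x))) [:: k]) // => [|i].
  by rewrite big_seq1 dprj_inj.
by rewrite inE => /eqP/nesym ik; rewrite dprj_inj0 // raddf0.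
Qed.

End Copairing.

Lemma projective_dsum (I : choiceType) (N : I -> numod R) :
  (forall k, projective (N k)) -> projective (dsum N).
Proof.
move=> pN; split; first by apply: unitary_dsum => k; case: (pN k).
move=> X Y uX uY p f pe.
have H k := (pN k).2 _ _ uX uY p (hcomp f (dinj N k)) pe.
pose h k := sval (cid (H k)).
exists (dcopair h) => z; apply: subr0_eq.
(* The submodule on which the two morphisms agree contains every summand. *)
apply: (@dsum_ind _ _ (kernel (hadd (hcomp p (dcopair h)) (hopp f))) _ z) => k x.
change (p (dcopair h (dinj N k x)) - f (dinj N k x) = 0).
by rewrite dcopairE /h; case: cid => g /= ->; rewrite subrr.
Qed.

Lemma projective_retract P Q (i : nhom P Q) (r : nhom Q P) :
  (forall x, r (i x) = x) -> projective Q -> projective P.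
Proof.
move=> ri [uQ pQ]; split; first by apply: (@unitary_epi _ _ _ _ r) uQ => x; exists (i x).
move=> X Y uX uY p f pe; have [h hE] := pQ X Y uX uY p (hcomp f r) pe.
by exists (hcomp h i) => x; rewrite hE /= ri.
Qed.

Lemma projective_isom P Q : isom P Q -> projective Q -> projective P.
Proof.
move=> /isomP[h [hm he]] pQ.
have [k kE] := @mono_factor _ _ Q P Q h (hid Q) hm he.
by apply: (@projective_retract _ _ h k) pQ => x; apply: (nmono_inj hm); rewrite kE.
Qed.

Lemma unitary_retract P Q (i : nhom P Q) (r : nhom Q P) :
  (forall x, r (i x) = x) -> unitary Q -> unitary P.
Proof. by move=> ri; apply: (@unitary_epi _ _ _ _ r) => x; exists (i x). Qed.

Lemma projective_prod P Q : projective P -> projective Q -> projective (nprod P Q).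
Proof.
move=> [uP pP] [uQ pQ]; split; first exact: (unitary_ses (ses_prod P Q) uP uQ).
move=> X Y uX uY p f pe.
have [h hE] := pP X Y uX uY p (hcomp f (npair (hid P) (hzero P Q))) pe.
have [k kE] := pQ X Y uX uY p (hcomp f (npair (hzero Q P) (hid Q))) pe.
exists (hadd (hcomp h (nfst P Q)) (hcomp k (nsnd P Q))) => -[x y].
change (p (h x + k y) = f (x, y)); rewrite raddfD hE kE.
rewrite -[LHS](raddfD f (x, 0) (0, y)); congr (f _).
by congr (_, _); rewrite ?addr0 ?add0r.
Qed.

Lemma projective_zero P : (forall x : P, x = 0) -> projective P.
Proof.
move=> P0; split=> [x|X Y _ _ p f _]; first by exists [::]; rewrite big_nil (P0 x).
by exists (hzero P X) => x; rewrite (P0 x) !raddf0.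
Qed.

End DirectSums.

Section Idempotents.
Variables (K : comPzRingType) (R : nualg K) (I : choiceType) (e : I -> R).

Lemma na_mul0r (x : R) : x ** 0 = 0.
Proof. exact: (@nm_actr0 _ _ (regmod R)). Qed.

Lemma na_mul_suml (x : R) (J : Type) (s : seq J) (F : J -> R) :
  (\sum_(i <- s) F i) ** x = \sum_(i <- s) F i ** x.
Proof. exact: (@nm_act_suml _ _ (regmod R)). Qed.

Lemma na_mul_sumr (x : R) (J : Type) (s : seq J) (F : J -> R) :
  x ** (\sum_(i <- s) F i) = \sum_(i <- s) x ** F i.
Proof. exact: (@nm_act_sumr _ _ (regmod R)). Qed.

Definition isum (s : seq I) : R := \sum_(i <- s) e i.

Hypothesis orth : forall i j, i <> j -> e i ** e j = 0.
Hypothesis idem : forall i, e i ** e i = e i.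

Lemma isum_mull s i : uniq s -> i \in s -> isum s ** e i = e i.
Proof.
move=> us si; rewrite na_mul_suml (bigD1_seq i) //= idem big1 ?addr0 // => j /eqP ji.
exact: orth.
Qed.

Lemma isum_mulS s t : uniq s -> uniq t -> {subset s <= t} -> isum t ** isum s = isum s.
Proof.
move=> us ut st; rewrite {2}/isum na_mul_sumr; apply: eq_big_seq => i /st.
exact: isum_mull.
Qed.

(** The sum of the $e_i$ over the support of $x$ fixes $x$; conversely the components of $x$ can
    only be the $e_ix$, by orthogonality. Local units are the form in which the decomposition is
    used from here on. *)
Lemma internal_dsum_lunit :
  internal_dsum (fun i => [set x : R | exists r, x = e i ** r]) <->
  forall x : R, exists2 s, uniq s & isum s ** x = x.
Proof.
have supp (G : I -> R) : finite_set [set i | G i <> 0] ->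
    exists2 t : seq I, uniq t & forall j, j \notin t -> G j = 0.
  move=> /finite_seqP[t tE]; exists (undup t); first exact: undup_uniq.
  move=> j; rewrite mem_undup; apply: contraNP => Gj.
  by have : [set` t] j by rewrite -tE.
split=> [dR x|lunit x].
  have [F [[Fe Ff xE] _]] := dR x; have [t ut F0] := supp _ Ff.
  exists t => //; rewrite xE (fsumE ut F0).
  rewrite na_mul_sumr; apply: eq_big_seq => i it.
  by have [r ->] := Fe i; rewrite na_mulA isum_mull.
have [s us sx] := lunit x.
pose F i := if i \in s then e i ** x else 0.
have F0 i : i \notin s -> F i = 0 by move=> /negPf si; rewrite /F si.
exists F; split.
  split=> [i||].
  - rewrite /F /=; case: ifP => _; first by exists x.
    by exists 0; rewrite na_mul0r.
  - apply: (@sub_finite_set _ _ [set` s]); last exact: finite_seq.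
    by move=> i /=; apply: contra_notT => /F0.
  - rewrite (fsumE us F0) -[LHS]sx na_mul_suml.
    by apply: eq_big_seq => i si; rewrite /F si.
move=> G [Ge Gf xE]; apply: funext => i; have [t ut G0] := supp _ Gf.
have eG j : e i ** G j = if j == i then G i else 0.
  have [r rE] := Ge j; rewrite rE na_mulA; case: eqP => [<-|ij].
    by rewrite idem -rE.
  by rewrite orth ?na_mul0l // => /esym.
have ex : e i ** x = G i.
  rewrite xE (fsumE ut G0) na_mul_sumr.
  under eq_bigr do rewrite eG.
  have [it|it] := boolP (i \in t).
    by rewrite (bigD1_seq i) //= eqxx big1 ?addr0 // => j /negPf->.
  by rewrite (G0 i it) big1 // => j _; case: ifP.
rewrite /F ex; case: ifP => // /negbT si; rewrite -ex -sx na_mulA.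
rewrite na_mul_sumr big_seq big1 ?na_mul0l // => j sj; apply: orth => ij.
by rewrite ij sj in si.
Qed.

End Idempotents.

(** * Modules over an algebra with enough idempotents *)

Section Wei.
Variables (K : comPzRingType) (R : nualg K) (I : choiceType) (e : I -> R).

Definition lunits := forall x : R, exists2 s, uniq s & isum e s ** x = x.
Definition runits := forall x : R, exists2 s, uniq s & x ** isum e s = x.

Lemma weiP : wei e <->
  [/\ forall i, e i ** e i = e i, forall i j, i <> j -> e i ** e j = 0, lunits & runits].
Proof.
(* The right-hand decomposition is the left-hand one over the opposite algebra. *)
have H (orth : forall i j, i <> j -> e i ** e j = 0) (idem : forall i, e i ** e i = e i) :
    internal_dsum (fun i => [set x : R | exists r, x = r ** e i]) <-> runits.
  apply: (@internal_dsum_lunit K (nuopp R) I e) => // i j ij.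
  by apply: orth => /esym.
by split=> -[idem orth l r]; split=> //;
  try apply/(internal_dsum_lunit orth idem); try apply/(H orth idem).
Qed.

Hypothesis eW : wei e.

Lemma wei_idem i : e i ** e i = e i. Proof. by case: eW. Qed.
Lemma wei_orth i j : i <> j -> e i ** e j = 0. Proof. by case: eW => _ /(_ i j). Qed.
Lemma wei_lunit : lunits. Proof. by have/weiP[] := eW. Qed.
Lemma wei_runit : runits. Proof. by have/weiP[] := eW. Qed.

Implicit Types N X Y : numod R.

Lemma act_lunit N (s : seq I) (x : N) : isum e s |> x = \sum_(i <- s) e i |> x.
Proof. exact: nm_act_suml. Qed.

(** Finitely many ring elements have a common local unit, indexed by the union of their lists. In
    this form unitarity is checked on single elements, so it passes to submodules. *)
Lemma unitaryP N : unitary N <-> forall x : N, exists2 s, uniq s & isum e s |> x = x.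
Proof.
split=> [uN x|uN x]; last first.
  by have [s _ sx] := uN x; exists [:: (isum e s, x)]; rewrite big_seq1.
have [v ->] := uN x.
suff [s us sv] : exists2 s, uniq s & forall p : R * N, p \in v -> isum e s ** p.1 = p.1.
  exists s => //; rewrite nm_act_sumr; apply: eq_big_seq => p pv.
  by rewrite nm_actA sv.
elim: v => [|p v [s us sv]]; first by exists [::].
have [t ut tp] := wei_lunit p.1.
have uts := undup_uniq (t ++ s).
have sub1 : {subset t <= undup (t ++ s)} by move=> i; rewrite mem_undup mem_cat => ->.
have sub2 : {subset s <= undup (t ++ s)}.
  by move=> i; rewrite mem_undup mem_cat orbC => ->.
exists (undup (t ++ s)) => // q; rewrite inE => /predU1P[->|/sv <-].
  by rewrite -tp na_mulA (isum_mulS wei_orth wei_idem ut uts sub1).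
by rewrite na_mulA (isum_mulS wei_orth wei_idem us uts sub2).
Qed.

Lemma unitary_mono X Y (i : nhom X Y) : mono i -> unitary Y -> unitary X.
Proof.
move=> im /unitaryP uY; apply/unitaryP => x; have [s us sx] := uY (i x).
by exists s => //; apply: (nmono_inj im); rewrite nhom_act.
Qed.

Lemma unitary_smod N (S : submod N) : unitary N -> unitary (smod S).
Proof. by apply: (unitary_mono (i := incl S)) => x x0; apply: incl_inj; rewrite raddf0. Qed.

Lemma unitary_qmod N (S : submod N) : unitary N -> unitary (qmod S).
Proof. exact: (unitary_epi (proj_surj (S := S))). Qed.

Lemma rgen_proof i : lideal (e i) (e i : regmod R).
Proof. by exists (e i); rewrite wei_idem. Qed.

Definition rgen i : Rmul (e i) := sm_elt (rgen_proof i).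

Definition rval i (x : Rmul (e i)) : R := incl (lideal (e i)) x.

Lemma rval_act i r (x : Rmul (e i)) : rval (r |> x) = r ** rval x.
Proof. by []. Qed.

Lemma rvalB i (x y : Rmul (e i)) : rval (x - y) = rval x - rval y.
Proof. exact: (raddfB (incl (lideal (e i)))). Qed.

Lemma rval0 i : rval (0 : Rmul (e i)) = 0.
Proof. exact: (raddf0 (incl (lideal (e i)))). Qed.

Lemma rvalD i (x y : Rmul (e i)) : rval (x + y) = rval x + rval y.
Proof. exact: (raddfD (incl (lideal (e i)))). Qed.

Lemma rvalE i (x : Rmul (e i)) : rval x ** e i = rval x.
Proof. by have [r rx] := inclP x; rewrite /rval rx -na_mulA wei_idem. Qed.

Lemma rval_inj i : injective (@rval i).
Proof. exact: (@incl_inj _ _ (regmod R)). Qed.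

Lemma rval_gen i : rval (rgen i) = e i. Proof. by []. Qed.

Lemma act_rgen i (x : Rmul (e i)) : rval x |> rgen i = x.
Proof. by apply: rval_inj; rewrite rval_act rval_gen rvalE. Qed.

Lemma e_rgen i : e i |> rgen i = rgen i.
Proof. by apply: rval_inj; rewrite rval_act rval_gen wei_idem. Qed.

(** The element [x] need not lie in $e_iN$: the generator is sent to $e_ix$. By [rhom_gen] every
    morphism out of $Re_i$ has this form. *)
Definition rhom i N (x : N) : nhom (Rmul (e i)) N.
Proof.
refine (@mkhom _ _ (Rmul (e i)) N (fun y => rval y |> x) _ _) => [y z|r y].
  by rewrite /rval raddfB nm_actDl; congr (_ + _); apply: (addrI (rval z |> x));
    rewrite -nm_actDl !subrr nm_act0r.
by rewrite rval_act nm_actA.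
Defined.

Lemma rhomE i N (x : N) y : rhom i x y = rval y |> x. Proof. by []. Qed.

Lemma rhom_gen i N (h : nhom (Rmul (e i)) N) : h =1 rhom i (h (rgen i)).
Proof. by move=> y; rewrite rhomE -nhom_act act_rgen. Qed.

Lemma projective_Rmul i : projective (Rmul (e i)).
Proof.
split.
  apply/unitaryP => x; have [s us sx] := wei_lunit (rval x).
  by exists s => //; apply: rval_inj; rewrite rval_act.
move=> X Y uX uY p f pe; have [x xE] := pe (f (rgen i)).
exists (rhom i x) => y.
by rewrite rhomE nhom_act xE -nhom_act act_rgen.
Qed.

(** The summand of index $(i,x)$ sends its generator to $e_ix$, and each $x$ is a finite sum of such
    elements by a local unit. *)
Lemma enough_projectives N : unitary N ->
  exists (P : numod R) (p : nhom P N), projective P /\ epi p.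
Proof.
move=> /unitaryP uN.
exists (dsum (fun k : I * N => Rmul (e k.1))).
exists (dcopair (fun k : I * N => rhom k.1 k.2)); split.
  by apply: projective_dsum => k; exact: projective_Rmul.
move=> x; have [s us sx] := uN x.
pose F (i : I) := dinj (fun k : I * N => Rmul (e k.1)) (i, x) (rgen i).
exists (\sum_(i <- s) F i); rewrite raddf_sum -[RHS]sx act_lunit.
by apply: eq_bigr => i _; exact: (dcopairE (fun k : I * N => rhom k.1 k.2)).
Qed.

End Wei.

(** * Projective resolutions *)

Section Resolutions.
Variables (K : comPzRingType) (R : nualg K).
Implicit Types (N P Q X Y Z W : numod R).

(** This is $\mathrm{pd}(N)\le n$, unfolded one syzygy at a time so that dimension shifting becomes
    induction on [n]; [pd_leP] makes the link with [pd]. *)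
Fixpoint pdle (n : nat) N : Prop :=
  if n is n'.+1 then
    exists (L P : numod R) (i : nhom L P) (p : nhom P N),
      [/\ projective P, ses i p & pdle n' L]
  else projective N.

(** The same bound demanded of every presentation. Unitarity is required explicitly, since a module
    that is not unitary has no presentation and would satisfy the rest vacuously. *)
Fixpoint pdle_all (n : nat) N : Prop :=
  if n is n'.+1 then
    unitary N /\ forall (L P : numod R) (i : nhom L P) (p : nhom P N),
      projective P -> ses i p -> pdle_all n' L
  else projective N.

Lemma pdle_unitary n N : pdle n N -> unitary N.
Proof.
case: n => [[]//|n] [L [P [i [p [[uP _] [_ pe _] _]]]]].
exact: unitary_epi pe uP.
Qed.

Lemma pdle_all_unitary n N : pdle_all n N -> unitary N.
Proof. by case: n => [|n] []. Qed.

Lemma ses_split X Y Z (i : nhom X Y) (p : nhom Y Z) (s : nhom Z Y) :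
  ses i p -> (forall z, p (s z) = z) -> exists r : nhom Y X,
    (forall x, r (i x) = x) /\ forall y, i (r y) = y - s (p y).
Proof.
move=> [im pe E] ps.
have [|r rE] := @mono_factor _ _ _ _ _ i (hadd (hid Y) (hopp (hcomp s p))) im.
  by move=> y; apply/E; rewrite raddfB /= ps subrr.
exists r; split=> [x|y]; last exact: rE.
apply: (nmono_inj im); rewrite rE /=.
have -> : p (i x) = 0 by apply/E; exists x.
by rewrite raddf0 subr0.
Qed.

Lemma projective_split P Y (p : nhom Y P) : projective P -> unitary Y -> epi p ->
  exists s : nhom P Y, forall z, p (s z) = z.
Proof. by move=> [uP pP] uY pe; exact: (pP _ _ uY uP p (hid P)). Qed.

Lemma projective_ses X Y Z (i : nhom X Y) (p : nhom Y Z) :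
  ses i p -> projective X -> projective Z -> projective Y.
Proof.
move=> E pX pZ; have uY := unitary_ses E pX.1 pZ.1.
have [_ pe _] := E; have [s ps] := projective_split pZ uY pe.
have [r [ri ir]] := ses_split E ps.
apply: (@projective_retract _ _ _ (nprod X Z) (npair r p)
  (hadd (hcomp i (nfst X Z)) (hcomp s (nsnd X Z)))); last exact: projective_prod.
by move=> y; rewrite /= ir subrK.
Qed.

Lemma ses_zero_l Y : ses (hzero (nzero R) Y) (hid Y).
Proof.
split=> [x _|y|y]; [exact: nzero0|by exists y|].
by split=> [/= ->|[x <-] //]; exists 0.
Qed.

Section EnoughProjectives.
Variables (I : choiceType) (e : I -> R).
Hypothesis eW : wei e.

Lemma ses_enough N : unitary N -> exists (L P : numod R) (i : nhom L P) (p : nhom P N),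
  [/\ projective P, unitary L & ses i p].
Proof.
move=> /(enough_projectives eW)[P [p [pP pe]]].
exists (smod (kernel p)), P, (incl _), p; split=> //; last exact: ses_kernel.
exact/(unitary_smod eW)/pP.1.
Qed.

Lemma pdle_all_pdle n N : pdle_all n N -> pdle n N.
Proof.
elim: n N => [//|n IHn] N [uN aN].
have [L [P [i [p [pP uL E]]]]] := ses_enough uN.
by exists L, P, i, p; split=> //; apply/IHn/(aN _ _ _ _ pP E).
Qed.

(** A presentation $P\to X$ with kernel $L$ extends to a presentation $P\oplus Q\to Y$, where $Q$
    covers the kernel of [r]. Then $L$ is a retract of the new kernel, and induction applies. *)
Lemma pdle_all_retract n X Y (i : nhom X Y) (r : nhom Y X) :
  (forall x, r (i x) = x) -> pdle_all n Y -> pdle_all n X.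
Proof.
elim: n X Y i r => [|n IHn] X Y i r ri; first exact: projective_retract ri.
move=> [uY aY]; split=> [|L P j p pP [jm pe E]]; first exact: unitary_retract ri uY.
have [Q [q [pQ qe]]] := enough_projectives eW (unitary_smod eW (S := kernel r) uY).
pose t := hadd (hcomp (hcomp i p) (nfst P Q)) (hcomp (hcomp (incl _) q) (nsnd P Q)).
have rq x : r (incl (kernel r) (q x)) = 0 by exact: (inclP (S := kernel r)).
have te : epi t.
  move=> y; have [x xE] := pe (r y).
  have kE : kernel r (y - i (r y)) by rewrite /= raddfB ri subrr.
  have [w wE] := incl_surj kE; have [z zE] := qe w.
  exists (x, z); change (i (p x) + incl _ (q z) = y).
  by rewrite zE wE xE addrC subrK.
have tk l : kernel t (npair j (hzero L Q) l).
  change (i (p (j l)) + incl _ (q 0) = 0).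
  by rewrite (E (j l)).2 ?raddf0 ?addr0 //; exists l.
(* Applying [r] to $i(p(u_1))+q(u_2)=0$ gives $p(u_1)=0$, so the first coordinate of a kernel
   element lies in $L$. *)
have [|s sE] := @mono_factor _ _ _ _ _ j (hcomp (nfst P Q) (incl (kernel t))) jm.
  move=> w; apply/E; have : t (incl _ w) = 0 := inclP w.
  have tE u : t u = i (p u.1) + incl (kernel r) (q u.2) by [].
  by rewrite tE => /(congr1 r); rewrite raddfD ri rq addr0 raddf0.
apply: (IHn L _ (corestr tk) s); last first.
  exact: (aY _ _ _ _ (projective_prod pP pQ) (ses_kernel te)).
by move=> l; apply: (nmono_inj jm); rewrite sE.
Qed.

Lemma pdle_all_proj n P : projective P -> pdle_all n P.
Proof.
elim: n P => [//|n IHn] P pP; split=> [|L Q i p pQ E]; first exact: pP.1.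
apply: IHn; have [_ pe _] := E; have [s ps] := projective_split pP pQ.1 pe.
have [r [ri _]] := ses_split E ps.
exact: projective_retract ri pQ.
Qed.

(* Adding a projective summand only changes the projective in a presentation. *)
Lemma pdle_all_add n X Y Q (i : nhom X Y) (p : nhom Y Q) :
  ses i p -> projective Q -> pdle_all n X -> pdle_all n Y.
Proof.
case: n => [|n] E pQ; first by move=> pX; exact: projective_ses E pX pQ.
move=> [uX aX]; split=> [|L P j q pP [jm qe Ej]]; first exact: unitary_ses E uX pQ.1.
have [im pe Ei] := E.
have pqe : epi (hcomp p q).
  by move=> z; have [y <-] := pe z; have [x <-] := qe y; exists x.
have [s ps] := projective_split pQ pP.1 pqe.
have [r [ri _]] := ses_split (ses_kernel pqe) ps.
have pP' := projective_retract ri pP.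
have [|q' q'E] := @mono_factor _ _ _ _ _ i (hcomp q (incl (kernel (hcomp p q)))) im.
  by move=> w; apply/Ei; exact: (inclP w).
have jk l : kernel (hcomp p q) (j l).
  by rewrite /= (Ej (j l)).2 ?raddf0 //; exists l.
apply: (aX L _ (corestr jk) q' pP'); split.
- move=> l /(congr1 (incl _)); rewrite corestrE raddf0; exact: jm.
- move=> x; have [y yE] := qe (i x).
  have ky : kernel (hcomp p q) y by rewrite /= yE (ses_comp0 _ E).
  have [w wE] := incl_surj ky; exists w.
  by apply: (nmono_inj im); rewrite q'E hcompE wE.
move=> w; split=> [qw|[l <-]].
  have /Ej[l lE] : q (incl _ w) = 0 by rewrite -[LHS]q'E qw raddf0.
  by exists l; apply: incl_inj; rewrite corestrE.
apply: im; rewrite q'E hcompE corestrE; apply/Ej; by exists l.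
Qed.

Definition pullback X Y Z (p : nhom X Z) (q : nhom Y Z) : submod (nprod X Y) :=
  kernel (hadd (hcomp p (nfst X Y)) (hopp (hcomp q (nsnd X Y)))).

Lemma pullbackP X Y Z (p : nhom X Z) (q : nhom Y Z) (w : smod (pullback p q)) :
  p (incl (pullback p q) w).1 = q (incl (pullback p q) w).2.
Proof. exact: subr0_eq (inclP w). Qed.

(** Base change of an epimorphism keeps its kernel. Together with the mirror image [ses_pullback'],
    it exhibits one pullback as an extension in two ways, which is the core of Schanuel's argument
    and of [pdle_sub]. *)
Lemma ses_pullback L X Y Z (i : nhom L X) (p : nhom X Z) (q : nhom Y Z) : ses i p ->
  exists (j : nhom L (smod (pullback p q))),
    ses j (hcomp (nsnd X Y) (incl (pullback p q))).
Proof.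
move=> sE; have [im pe E] := sE.
have jk l : pullback p q (npair i (hzero L Y) l).
  by change (p (i l) - q 0 = 0); rewrite (ses_comp0 _ sE) raddf0 subrr.
exists (corestr jk); split.
- move=> l /(congr1 (incl _)); rewrite corestrE raddf0 => -[]; exact: im.
- move=> y; have [x xE] := pe (q y).
  have k : pullback p q (x, y) by change (p x - q y = 0); rewrite xE subrr.
  by have [w wE] := incl_surj k; exists w; rewrite hcompE wE.
move=> w; split=> [w0|[l <-]]; last by rewrite hcompE corestrE.
have /E[l lE] : p (incl (pullback p q) w).1 = 0.
  by rewrite pullbackP -[X in q X]/(hcomp (nsnd X Y) _ w) w0 raddf0.
exists l; apply: incl_inj; rewrite corestrE [RHS]surjective_pairing -lE.
by congr (_, _); exact: esym w0.
Qed.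

Lemma ses_pullback' L X Y Z (i : nhom L Y) (p : nhom X Z) (q : nhom Y Z) : ses i q ->
  exists (j : nhom L (smod (pullback p q))),
    ses j (hcomp (nfst X Y) (incl (pullback p q))).
Proof.
move=> sE; have [im qe E] := sE.
have jk l : pullback p q (npair (hzero L X) i l).
  by change (p 0 - q (i l) = 0); rewrite (ses_comp0 _ sE) raddf0 subrr.
exists (corestr jk); split.
- move=> l /(congr1 (incl _)); rewrite corestrE raddf0 => -[]; exact: im.
- move=> x; have [y yE] := qe (p x).
  have k : pullback p q (x, y) by change (p x - q y = 0); rewrite yE subrr.
  by have [w wE] := incl_surj k; exists w; rewrite hcompE wE.
move=> w; split=> [w0|[l <-]]; last by rewrite hcompE corestrE.
have /E[l lE] : q (incl (pullback p q) w).2 = 0.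
  by rewrite -pullbackP -[X in p X]/(hcomp (nfst X Y) _ w) w0 raddf0.
exists l; apply: incl_inj; rewrite corestrE [RHS]surjective_pairing -lE.
by congr (_, _); exact: esym w0.
Qed.

Lemma ses_proj_retract X Y P (i : nhom X Y) (p : nhom Y P) :
  ses i p -> unitary Y -> projective P -> exists r : nhom Y X, forall x, r (i x) = x.
Proof.
move=> E uY pP; have [_ pe _] := E; have [s ps] := projective_split pP uY pe.
by have [r [ri _]] := ses_split E ps; exists r.
Qed.

(* Schanuel: the pullback of two presentations of N is an extension of either
   projective by the syzygy of the other presentation. *)
Lemma pdle_pdle_all n N : pdle n N -> pdle_all n N.
Proof.
elim: n N => [//|n IHn] N pN; split; first exact: pdle_unitary pN.
move: pN => [L [P [i [p [pP E pL]]]]] L' P' i' p' pP' E'.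
have [j Ej] := ses_pullback p' E; have [j' Ej'] := ses_pullback' p E'.
have aW := pdle_all_add Ej pP' (IHn _ pL).
have [r rj] := ses_proj_retract Ej' (pdle_all_unitary aW) pP.
exact: pdle_all_retract rj aW.
Qed.

Lemma pdle_syzygy n L P N (i : nhom L P) (p : nhom P N) :
  ses i p -> projective P -> pdle n.+1 N -> pdle n L.
Proof.
by move=> E pP /pdle_pdle_all[_ aN]; apply/pdle_all_pdle/(aN _ _ _ _ pP E).
Qed.

Lemma pdle_retract n X Y (i : nhom X Y) (r : nhom Y X) :
  (forall x, r (i x) = x) -> pdle n Y -> pdle n X.
Proof. by move=> ri /pdle_pdle_all /(pdle_all_retract ri)/pdle_all_pdle. Qed.

Lemma pdle_proj n P : projective P -> pdle n P.
Proof. by move=> /pdle_all_proj H; apply: pdle_all_pdle. Qed.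

Lemma pdleS n N : pdle n N -> pdle n.+1 N.
Proof.
elim: n N => [|n IHn] N; first exact: pdle_proj.
by move=> [L [P [i [p [pP E pL]]]]]; exists L, P, i, p; split=> //; apply: IHn.
Qed.

Lemma pdle_leq m n N : (m <= n)%N -> pdle m N -> pdle n N.
Proof.
move=> /subnKC<-; elim: (n - m)%N => [|k IHk]; rewrite ?addn0 // addnS => pN.
exact/pdleS/IHk.
Qed.

Lemma pdle_isom n X Y : isom X Y -> pdle n Y -> pdle n X.
Proof.
move=> /isomP[h [hm he]]; have [k kE] := @mono_factor _ _ Y X Y h (hid Y) hm he.
by apply: (@pdle_retract _ _ _ h k) => x; apply: (nmono_inj hm); rewrite kE.
Qed.

(* Horseshoe: the sum of the projectives over X and Z presents Y, with a kernel
   that is an extension of the two syzygies. *)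
Lemma pdle_ses n X Y Z (i : nhom X Y) (p : nhom Y Z) :
  ses i p -> pdle n X -> pdle n Z -> pdle n Y.
Proof.
elim: n X Y Z i p => [|n IHn] X Y Z i p E; first exact: projective_ses E.
move=> pX pZ; have uY := unitary_ses E (pdle_unitary pX) (pdle_unitary pZ).
have [LX [PX [iX [qX [pPX EX pLX]]]]] := pX.
have [LZ [PZ [iZ [qZ [pPZ EZ pLZ]]]]] := pZ.
have [im pe Ei] := E; have [iXm qXe EiX] := EX; have [iZm qZe EiZ] := EZ.
have [h hE] := pPZ.2 _ _ uY (pdle_unitary pZ) p qZ pe.
pose q := hadd (hcomp (hcomp i qX) (nfst PX PZ)) (hcomp h (nsnd PX PZ)).
have qE x z : q (x, z) = i (qX x) + h z by [].
have qe : epi q.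
  move=> y; have [z zE] := qZe (p y).
  have /Ei[x xE] : p (y - h z) = 0 by rewrite raddfB hE zE subrr.
  by have [w wE] := qXe x; exists (w, z); rewrite qE wE xE subrK.
exists (smod (kernel q)), (nprod PX PZ), (incl _), q; split.
- exact: projective_prod.
- exact: ses_kernel.
have jk l : kernel q (npair iX (hzero LX PZ) l).
  by change (q (iX l, 0) = 0); rewrite qE (ses_comp0 _ EX) !raddf0 addr0.
have [|t tE] := @mono_factor _ _ _ _ _ iZ (hcomp (nsnd PX PZ) (incl (kernel q))) iZm.
  move=> w; apply/EiZ; have : q (incl (kernel q) w) = 0 := inclP w.
  rewrite hcompE; case: (incl _ w) => x z; rewrite qE => /(congr1 p).
  by rewrite raddfD hE (ses_comp0 _ E) add0r raddf0.
apply: (IHn LX _ LZ (corestr jk) t) => //; split.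
- move=> l /(congr1 (incl _)); rewrite corestrE raddf0 => -[]; exact: iXm.
- move=> l; have /Ei[x xE] : p (h (iZ l)) = 0 by rewrite hE (ses_comp0 _ EZ).
  have [w wE] := qXe x.
  have k : kernel q (- w, iZ l) by change (q (- w, iZ l) = 0); rewrite qE !raddfN wE xE addNr.
  by have [v vE] := incl_surj k; exists v; apply: (nmono_inj iZm); rewrite tE hcompE vE.
move=> w; split=> [tw|[l <-]]; last first.
  by apply: iZm; rewrite tE hcompE corestrE.
have w2 : (incl (kernel q) w).2 = 0 by rewrite -[LHS]tE tw raddf0.
have : q (incl (kernel q) w) = 0 := inclP w.
rewrite [incl (kernel q) w]surjective_pairing w2 qE raddf0 addr0 => /im/EiX[l lE].
by exists l; apply: incl_inj; rewrite corestrE [RHS]surjective_pairing w2 -lE.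
Qed.

(** Composing a presentation of $Y$ with [p] presents $Z$, and the new kernel is an extension of $X$
    by the syzygy of $Y$. *)
Lemma pdle_quo n X Y Z (i : nhom X Y) (p : nhom Y Z) :
  ses i p -> pdle n X -> pdle n.+1 Y -> pdle n.+1 Z.
Proof.
move=> E pX [L [P [j [q [pP Eq pL]]]]].
have [im pe Ei] := E; have [jm qe Ej] := Eq.
have pqe : epi (hcomp p q).
  by move=> z; have [y <-] := pe z; have [x <-] := qe y; exists x.
exists (smod (kernel (hcomp p q))), P, (incl _), (hcomp p q).
split=> //; first exact: ses_kernel.
have [|t tE] := @mono_factor _ _ _ _ _ i (hcomp q (incl (kernel (hcomp p q)))) im.
  by move=> w; apply/Ei; exact: (inclP w).
have jk l : kernel (hcomp p q) (j l) by rewrite /= (ses_comp0 _ Eq) raddf0.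
apply: (@pdle_ses _ L _ X (corestr jk) t) => //; split.
- move=> l /(congr1 (incl _)); rewrite corestrE raddf0; exact: jm.
- move=> x; have [y yE] := qe (i x).
  have k : kernel (hcomp p q) y by rewrite /= yE (ses_comp0 _ E).
  by have [w wE] := incl_surj k; exists w; apply: (nmono_inj im); rewrite tE !hcompE wE.
move=> w; split=> [tw|[l <-]].
  have /Ej[l lE] : q (incl _ w) = 0 by rewrite -[LHS]tE tw raddf0.
  by exists l; apply: incl_inj; rewrite corestrE.
by apply: im; rewrite tE hcompE corestrE (ses_comp0 _ Eq).
Qed.

(** The pullback of $Y$ and a projective cover term $P$ of $Z$ is an extension of $Y$ by the syzygy
    of $Z$, which bounds its dimension; it is also an extension of $P$ by $X$, which splits, so $X$
    is a retract of it. *)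
Lemma pdle_sub n X Y Z (i : nhom X Y) (p : nhom Y Z) :
  ses i p -> pdle n Y -> pdle n.+1 Z -> pdle n X.
Proof.
move=> E pY [L [P [j [q [pP Eq pL]]]]].
have [k Ek] := ses_pullback' p Eq; have [l El] := ses_pullback q E.
have pW := pdle_ses Ek pL pY.
have [r rl] := ses_proj_retract El (pdle_unitary pW) pP.
exact: pdle_retract rl pW.
Qed.

End EnoughProjectives.
End Resolutions.

(** * Projective dimension and filtrations *)

Section ProjectiveDimension.
Variables (K : comPzRingType) (R : nualg K).
Implicit Types (N P X Y Z : numod R).

Lemma has_proj_res_pdle N n : has_proj_res N n -> pdle n N.
Proof.
elim: n N => [|n IHn] N [P [d [eps [pP epsE kE dE P0]]]].
  (* For [n = 0] the term [P 1] vanishes, so [eps] is injective. *)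
  apply: (@projective_isom _ _ _ (P 0%N)) => //; apply/isom_sym.
  apply: (@isom_of _ _ _ _ eps) => // x /kE[z <-].
  by rewrite (P0 1%N _ z) // raddf0.
have dk z : kernel eps (d 0%N z) by apply/kE; exists z.
exists (smod (kernel eps)), (P 0%N), (incl _), eps; split=> //; first exact: ses_kernel.
apply: IHn; exists (fun k => P k.+1), (fun k => d k.+1), (corestr dk).
split=> // [y|x|k kn]; last exact: P0.
  have /kE[z zE] : eps (incl (kernel eps) y) = 0 := inclP y.
  by exists z; apply: incl_inj; rewrite corestrE.
rewrite -dE; split=> [/(congr1 (incl _))|dx]; first by rewrite corestrE raddf0.
by apply: incl_inj; rewrite corestrE dx raddf0.
Qed.

Lemma pdle_has_proj_res N n : pdle n N -> has_proj_res N n.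
Proof.
elim: n N => [|n IHn] N.
  move=> pN; pose P k := if k is 0%N then N else nzero R.
  pose d (k : nat) : nhom (P k.+1) (P k) := hzero (P k.+1) (P k).
  have P0 k (x : P k.+1) : x = 0 by exact: nzero0.
  exists P, d, (hid N); split=> //=.
  - by case=> [|k]; [exact: pN|apply: projective_zero; exact: nzero0].
  - by move=> y; exists y.
  - by move=> x; split=> [->|[z <-]] //; exists 0.
  - by move=> k x; rewrite (P0 k x); split=> // _; exists 0; rewrite raddf0.
  - by case=> // k _ x; exact: nzero0.
move=> [L [Q [i [p [pQ [im pe E] /IHn[P [d [eps [pP epsE kE dE P0]]]]]]]]].
pose P' k := if k is k'.+1 then P k' else Q.
pose d' (k : nat) : nhom (P' k.+1) (P' k) :=
  if k is k'.+1 then d k' else hcomp i eps.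
exists P', d', p; split=> //.
- by case.
- move=> x; rewrite E; split=> [[l <-]|[z <-]]; last by exists (eps z).
  by have [z <-] := epsE l; exists z.
- case=> [|k] x /=; last exact: dE.
  by rewrite -kE; split=> [/im|->] //; rewrite raddf0.
- by case=> // k kn; exact: P0.
Qed.

Definition enat_is_inf (S : set enat) b :=
  (forall x, S x -> enat_le b x) /\
  forall c, (forall x, S x -> enat_le c x) -> enat_le c b.

Lemma enat_le_anti x y : enat_le x y -> enat_le y x -> x = y.
Proof.
by case: x y => [m|] [n|] //= mn nm; congr Some; apply/eqP; rewrite eqn_leq mn.
Qed.

Lemma enat_inf_eq S b : enat_is_inf S b -> enat_inf S = b.
Proof.
move=> Sb; rewrite /enat_inf; case: xgetP => [c _ [c1 c2]|/(_ b) //].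
case: Sb => b1 b2; apply: enat_le_anti; [exact: b2|exact: c2].
Qed.

Section EnoughProjectives.
Variables (I : choiceType) (e : I -> R).
Hypothesis eW : wei e.

Lemma pd_leP N n : enat_le (pd N) (Some n) <-> pdle n N.
Proof.
pose S := [set m : enat | exists2 n, has_proj_res N n & m = Some n].
have [[m Nm]|noN] := pselect (exists m, pdle m N); last first.
  (* No resolution of finite length exists, and the infimum of the empty set is [None]. *)
  have -> : pd N = None.
    apply: enat_inf_eq; split=> [_ [m Nm ->]|[]//].
    by case: noN; exists m; exact: has_proj_res_pdle.
  by split=> // Nn; case: noN; exists n.
have exN : exists m, `[< pdle m N >] by exists m; apply/asboolP.
case: (ex_minnP exN) => k /asboolP Nk kmin.
have -> : pd N = Some k.
  apply: enat_inf_eq; split=> [_ [l Nl ->]|c cS].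
    by apply/kmin/asboolP/has_proj_res_pdle.
  by apply: cS; exists k => //; exact: pdle_has_proj_res.
split=> [kn|Nn]; first exact: (pdle_leq eW kn).
by apply/kmin/asboolP.
Qed.

Lemma pd_finP N : pd N <> None <-> exists n, pdle n N.
Proof.
split=> [|[n /pd_leP]]; last by case: (pd N).
by case E: (pd N) => [n|//] _; exists n; apply/pd_leP; rewrite E /=.
Qed.

(** A supremum depends only on the set of upper bounds: [None] always belongs to it, and [Some n]
    belongs to it exactly when [pdle n] holds on the class. *)
Lemma pd_class_eq (Theta Theta' : modclass R) :
  (forall n, (forall N, Theta N -> pdle n N) <-> (forall N, Theta' N -> pdle n N)) ->
  pd_class Theta = pd_class Theta'.
Proof.
move=> H; rewrite /pd_class /enat_sup; congr xget.
have ub (Th : modclass R) b :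
    (forall x, [set m | exists2 N, Th N & pd N = m] x -> enat_le x b) <->
    forall N, Th N -> enat_le (pd N) b.
  by split=> [Hb N ThN|Hb _ [N ThN <-]]; [apply: Hb; exists N|exact: Hb].
have E b : (forall x, [set m | exists2 N, Theta N & pd N = m] x -> enat_le x b) <->
           (forall x, [set m | exists2 N, Theta' N & pd N = m] x -> enat_le x b).
  rewrite !ub; case: b => [n|]; last by split=> _ N _; case: (pd N).
  by split=> Hb N ThN; apply/pd_leP; move: N ThN; apply/H => N ThN; apply/pd_leP/Hb.
by rewrite predeqE => b; split=> -[b1 b2]; split; try exact/E; move=> c /E; exact: b2.
Qed.

End EnoughProjectives.
End ProjectiveDimension.

(** * Finite filtrations and extensions *)

Section Filtrations.
Variables (K : comPzRingType) (R : nualg K).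
Implicit Types (N P X Y Z : numod R) (Theta : modclass R).

(** Filtrations built by adding one factor on top through a short exact sequence. This replaces
    chains of submodules of a fixed module, so that closure properties are proved by structural
    induction; [FfP] relates the two. *)
Inductive filt Theta : numod R -> Prop :=
| filt_zero N : (forall x : N, x = 0) -> filt Theta N
| filt_ext X Y Z (i : nhom X Y) (p : nhom Y Z) :
    ses i p -> filt Theta X -> Theta Z -> filt Theta Y.

Lemma filt_isom Theta X Y : isom X Y -> filt Theta X -> filt Theta Y.
Proof.
move=> /isomP[h [hm he]] fX; case: X / fX h hm he => [N N0|X' X Z i p E fX' ThZ] h hm he.
  by apply: filt_zero => y; have [x <-] := he y; rewrite (N0 x) raddf0.
have [|k kE] := @epi_factor _ _ _ _ _ h p he.
  by move=> x /hm->; rewrite raddf0.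
have [im pe Ei] := E.
apply: (@filt_ext _ X' Y Z (hcomp h i) k) => //; split.
- by move=> x /hm/im.
- by move=> z; have [x <-] := pe z; exists (h x).
- move=> y; have [x <-] := he y; rewrite kE Ei.
  by split=> -[x' x'E]; exists x'; rewrite -?x'E //; exact: nmono_inj hm _ _ _.
Qed.

(** If $W$ is the top factor of $Z$ and $Z'$ the kernel of $Z\to W$, the preimage of $Z'$ in $Y$ is
    an extension of $Z'$ by $X$, filtered by induction, and $Y$ adds $W$ on top of it. *)
Lemma filt_ses Theta X Y Z (i : nhom X Y) (p : nhom Y Z) :
  ses i p -> filt Theta X -> filt Theta Z -> filt Theta Y.
Proof.
move=> E fX fZ; elim: fZ X Y i p E fX => {Z} [Z Z0|Z' Z W j q Eq _ IHZ ThW] X Y i p E fX.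
  have [im pe Ei] := E; apply: filt_isom fX.
  by apply: (isom_of im) => y; apply/Ei; rewrite (Z0 (p y)).
have [im pe Ei] := E; have [jm qe Ej] := Eq.
have pqe : epi (hcomp q p).
  by move=> w; have [z <-] := qe w; have [y <-] := pe z; exists y.
apply: (filt_ext (ses_kernel pqe)) => //.
have ik x : kernel (hcomp q p) (i x) by rewrite /= (ses_comp0 _ E) raddf0.
have [|t tE] := @mono_factor _ _ _ _ _ j (hcomp p (incl (kernel (hcomp q p)))) jm.
  by move=> w; apply/Ej; exact: inclP w.
apply: (IHZ X _ (corestr ik) t) => //; split.
- by move=> x /(congr1 (incl _)); rewrite corestrE raddf0; exact: im.
- move=> z'; have [y yE] := pe (j z').
  have k : kernel (hcomp q p) y by rewrite /= yE (ses_comp0 _ Eq).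
  by have [w wE] := incl_surj k; exists w; apply: (nmono_inj jm); rewrite tE hcompE wE.
- move=> w; split=> [tw|[x <-]]; last first.
    by apply: jm; rewrite tE hcompE corestrE (ses_comp0 _ E).
  have /Ei[x xE] : p (incl _ w) = 0 by rewrite -[LHS]tE tw raddf0.
  by exists x; apply: incl_inj; rewrite corestrE.
Qed.

Lemma filt_gen Theta Z : Theta Z -> filt Theta Z.
Proof.
by move=> ThZ; apply: (filt_ext (ses_zero_l Z)) => //; apply: filt_zero; exact: nzero0.
Qed.

Definition sm_top N : submod N := @SubMod K R N (fun=> True) I (fun _ _ _ _ => I) (fun _ _ _ => I).

(** The condition $D/C\simeq X$, stated through a map out of $D$ so that no quotient module has to
    be manipulated. *)
Definition factor_at N (C D : submod N) X : Prop :=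
  exists2 g : nhom (smod D) X, epi g & forall y, g y = 0 <-> C (incl D y).

Lemma factor_atP N (C D : submod N) X :
  isom (qmod (sm_restr C D)) X <-> factor_at C D X.
Proof.
split=> [/isomP[h [hm he]]|[g ge gE]]; last exact: (isom_quo (S := sm_restr C D) ge gE).
exists (hcomp h (proj _)) => [x|y].
  by have [q <-] := he x; have [y <-] := proj_surj q; exists y.
have -> : C (incl D y) <-> sm_restr C D y by [].
by rewrite -proj_eq0 hcompE; split=> [/hm|->] //; rewrite raddf0.
Qed.

Lemma FfP Theta N : Ff Theta N <-> unitary N /\ filt Theta N.
Proof.
split=> -[uN]; move=> H; split=> //.
  move: H => [n [C [C0 Cn CS]]].
  have fC k : (k <= n)%N -> filt Theta (smod (C k)).
    elim: k => [_|k IHk kn].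
      by apply: filt_zero => x; apply: incl_inj; rewrite raddf0; apply/C0/inclP.
    have [CkS [X ThX /factor_atP[g ge gE]]] := CS k kn.
    have Ci (x : smod (C k)) : C k.+1 (incl _ x) by apply/CkS/inclP.
    apply: (@filt_ext _ _ _ X (corestr Ci) g) => //; last exact/IHk/ltnW.
    split=> // [x|y].
      by move=> /(congr1 (incl _)); rewrite corestrE raddf0 => x0; apply: incl_inj; rewrite raddf0.
    rewrite gE; split=> [Cy|[x <-]]; last by rewrite corestrE; exact: inclP.
    by have [x xE] := incl_surj Cy; exists x; apply: incl_inj; rewrite corestrE.
  apply: (@filt_isom _ (smod (C n))) (fC n (leqnn n)).
  apply: (@isom_of _ _ _ _ (incl _)) => [x x0|x]; first by apply: incl_inj; rewrite raddf0.
  exact/incl_surj.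
elim: H {uN} => {N} [N N0|X Y Z i p E _ [n [C [C0 Cn CS]]] ThZ].
  by exists 0%N, (fun=> sm_bot N); split.
have [im pe Ei] := E.
(* The chain of $X$ is pushed into $Y$, and $Y$ itself is added at index [n.+1]. *)
pose D k := if (k <= n)%N then img i (C k) else sm_top Y.
exists n.+1, D; split=> [y|y|k].
- rewrite /D leq0n; split=> [[x /C0-> <-]|->]; first exact: raddf0.
  by exists 0; [exact: sm_0|exact: raddf0].
- by rewrite /D ltnn.
rewrite ltnS leq_eqVlt => /predU1P[->|kn].
  rewrite /D leqnn ltnn; split=> //; exists Z => //; apply/factor_atP.
  exists (hcomp p (incl _)) => [z|y].
    have [y <-] := pe z; have [|w wE] := @incl_surj _ _ _ (sm_top Y) y; first by [].
    by exists w; rewrite hcompE wE.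
  rewrite hcompE Ei; split=> [[x <-]|[x _ <-]]; last by exists x.
  by exists x => //; exact: Cn.
rewrite /D (ltnW kn) kn; have [CkS [W ThW /factor_atP[g ge gE]]] := CS k kn.
split=> [_ [x Cx <-]|]; first by exists x => //; exact: CkS.
exists W => //; apply/factor_atP.
have ji (x : smod (C k.+1)) : img i (C k.+1) (hcomp i (incl _) x).
  by exists (incl _ x) => //; exact: inclP.
have je : epi (corestr ji).
  move=> y; have [x Cx xE] := inclP y; have [w wE] := incl_surj Cx.
  by exists w; apply: incl_inj; rewrite corestrE hcompE wE.
have jm : mono (corestr ji).
  move=> x /(congr1 (incl _)); rewrite corestrE raddf0 => /im x0.
  by apply: incl_inj; rewrite raddf0.
have [|h hE] := @epi_factor _ _ _ _ _ _ g je.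
  by move=> x /jm->; rewrite raddf0.
exists h => [w|y]; first by have [x <-] := ge w; exists (corestr ji x); rewrite hE.
have [x <-] := je y; rewrite hE gE corestrE hcompE; split=> [Cx|[x' Cx' /(nmono_inj im)<-//]].
by exists (incl _ x).
Qed.

Lemma filt_unitary Theta N : (forall X, Theta X -> unitary X) -> filt Theta N -> unitary N.
Proof.
move=> uTh; elim=> [{}N N0|X Y Z i p E _ uX /uTh uZ]; last exact: unitary_ses E uX uZ.
by move=> x; exists [::]; rewrite big_nil.
Qed.

Lemma filt_pdle (I : choiceType) (e : I -> R) Theta N n : wei e ->
  (forall X, Theta X -> pdle n X) -> filt Theta N -> pdle n N.
Proof.
move=> eW pTh; elim=> [{}N N0|X Y Z i p E _ pX /pTh pZ]; last exact: pdle_ses E pX pZ.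
by apply/(pdle_proj eW)/projective_zero.
Qed.

(** A bound valid on $\Theta$ passes to extensions by the horseshoe lemma, and each member of
    $\Theta$ is itself filtered; hence both classes have the same upper bounds. *)
Lemma fin_dim_filt (I : choiceType) (e : I -> R) Theta : wei e ->
  (forall X, Theta X -> unitary X) -> modclass_eq (Ff Theta) (@Pfin K R) ->
  fin_dim R = pd_class Theta.
Proof.
move=> eW uTh E; apply: (pd_class_eq eW) => n; split=> H N.
  by move=> ThN; apply/H/E/FfP; split; [exact: uTh|exact: filt_gen].
by move=> /E/FfP[_ fN]; exact: (filt_pdle eW H).
Qed.

End Filtrations.

(** * Finite length and noetherian modules *)

Section FiniteLength.
Variables (K : comPzRingType).

Lemma Ksubmod_add (V : lmodType K) (B : set V) x y : Ksubmod B -> B x -> B y -> B (x + y).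
Proof. by move=> [_ Bl] Bx By; rewrite -[x]scale1r; exact: Bl. Qed.

Lemma Ksubmod_scale (V : lmodType K) (B : set V) a x : Ksubmod B -> B x -> B (a *: x).
Proof. by move=> [B0 Bl] Bx; rewrite -[_ *: _]addr0; exact: Bl. Qed.

Lemma Ksubmod_opp (V : lmodType K) (B : set V) x : Ksubmod B -> B x -> B (- x).
Proof. by rewrite -scaleN1r; exact: Ksubmod_scale. Qed.

Section Chain.
Variables (V : lmodType K) (n : nat) (C : nat -> set V).
Hypothesis C0 : C 0%N = [set 0].
Hypothesis CL : forall k, (k <= n)%N -> Ksubmod (C k).
Hypothesis CS : forall k, (k < n)%N -> C k `<` C k.+1 /\
  forall B, Ksubmod B -> C k `<=` B -> B `<=` C k.+1 -> B = C k \/ B = C k.+1.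

(** The submodule $C_k+\mathbb{K}b$ lies between $C_k$ and $C_{k+1}$ and contains $b\notin C_k$, so
    simplicity of the factor makes it all of $C_{k+1}$. *)
Lemma chain_step k b x : (k < n)%N -> C k.+1 b -> ~ C k b -> C k.+1 x ->
  exists c a, C k c /\ x = c + a *: b.
Proof.
move=> kn Cb nCb Cx; have [[sub _] simple] := CS kn.
have Kk := CL (ltnW kn); have Kk1 := CL kn.
pose B := [set x | exists c a, C k c /\ x = c + a *: b].
have KB : Ksubmod B.
  split; first by exists 0, 0; split; [exact: Kk.1|rewrite scale0r addr0].
  move=> a _ _ [c [a1 [Cc ->]]] [d [a2 [Cd ->]]].
  exists (a *: c + d), (a * a1 + a2); split; first exact: Kk.2.
  by rewrite scalerDr scalerA scalerDl addrACA.
have CB : C k `<=` B by move=> c Cc; exists c, 0; rewrite scale0r addr0.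
have BC : B `<=` C k.+1.
  move=> _ [c [a [Cc ->]]]; apply: Ksubmod_add => //; first exact: sub.
  exact: Ksubmod_scale.
have [BE|BE] := simple B KB CB BC; last by have : B x by rewrite BE.
case: nCb; rewrite -BE; exists 0, 1; split; first exact: Kk.1.
by rewrite scale1r add0r.
Qed.

(* The composition factors of the chain that B meets; they determine B among the
   submodules comparable with it. *)
Definition jumps (B : set V) : {set 'I_n} :=
  [set k : 'I_n | `[< exists2 b, B b & C k.+1 b /\ ~ C k b >]].

(** If both had the same jumps, climbing the chain would give $B'\subseteq B$: an element of $B'$ in
    $C_{k+1}$ differs from a multiple of an element of $B$ by an element of $B'\cap C_k$. *)
Lemma jumps_proper (B B' : set V) : Ksubmod B -> Ksubmod B' ->
  B `<` B' -> B' `<=` C n -> (#|jumps B| < #|jumps B'|)%N.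
Proof.
move=> KB KB' [BB' nB'B] B'C; apply: proper_card; rewrite finset.properEneq; apply/andP; split.
  apply/eqP => E; apply: nB'B; suff H k x : (k <= n)%N -> C k x -> B' x -> B x.
    by move=> x B'x; apply: (H n) => //; exact: B'C.
  elim: k x => [|k IHk] x kn; first by rewrite C0 => -> _; exact: KB.1.
  move=> Cx B'x; have [Ckx|nCkx] := pselect (C k x); first exact: IHk (ltnW kn) _ _.
  have : Ordinal kn \in jumps B by rewrite E /jumps finset.in_set; apply/asboolP; exists x.
  rewrite /jumps finset.in_set => /asboolP[b Bb [Cb nCb]].
  have [c [a [Cc xE]]] := chain_step kn Cb nCb Cx; rewrite xE.
  apply: Ksubmod_add => //; last exact: Ksubmod_scale.
  apply: IHk (ltnW kn) Cc _; rewrite -[c](addrK (a *: b)) -xE.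
  by apply: Ksubmod_add => //; apply: Ksubmod_opp => //; apply: Ksubmod_scale => //; exact: BB'.
apply/fintype.subsetP => k; rewrite /jumps finset.in_set => /asboolP[b Bb Cb].
by rewrite finset.in_set; apply/asboolP; exists b => //; exact: BB'.
Qed.

(** One generator is taken for each factor of the chain that $B$ meets; an element of $B$ is reduced
    down the chain by subtracting multiples of these. *)
Lemma Ksubmod_gen (B : set V) : Ksubmod B -> B `<=` C n ->
  exists s : seq V, (forall x, x \in s -> B x) /\
    forall B', Ksubmod B' -> (forall x, x \in s -> B' x) -> B `<=` B'.
Proof.
move=> KB BC; suff H k : (k <= n)%N -> exists s : seq V, (forall x, x \in s -> B x) /\
    forall B', Ksubmod B' -> (forall x, x \in s -> B' x) ->
    forall x, B x -> C k x -> B' x.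
  have [s [sB sH]] := H n (leqnn n); exists s; split=> // B' KB' sB' x Bx.
  by apply: sH => //; exact: BC.
elim: k => [_|k IHk kn].
  by exists [::]; split=> // B' KB' _ x _; rewrite C0 => ->; exact: KB'.1.
have [s [sB sH]] := IHk (ltnW kn).
have [[b Bb [Cb nCb]]|noB] := pselect (exists2 b, B b & C k.+1 b /\ ~ C k b).
  exists (b :: s); split=> [x|B' KB' sB' x Bx Cx].
    by rewrite inE => /predU1P[->|/sB].
  have B'b : B' b by apply: sB'; rewrite mem_head.
  have [c [a [Cc xE]]] := chain_step kn Cb nCb Cx; rewrite xE.
  apply: Ksubmod_add => //; last exact: Ksubmod_scale.
  apply: sH => //; first by move=> y ys; apply: sB'; rewrite inE ys orbT.
  rewrite -[c](addrK (a *: b)) -xE.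
  by apply: Ksubmod_add => //; apply: Ksubmod_opp => //; exact: Ksubmod_scale.
exists s; split=> // B' KB' sB' x Bx Cx; apply: sH => //.
by apply: contrapT => nCx; apply: noB; exists x.
Qed.

End Chain.

(** A strictly monotone measure with natural values suffices for a composition series: below a
    nonzero $B$, a proper member of largest measure admits nothing strictly between it and $B$, and
    induction applies to that member. *)
Lemma finite_length_measure (V : zmodType) (L : set (set V)) (A : set V) (l : set V -> nat) :
  L [set 0] -> L A -> (forall B, L B -> B 0) ->
  (forall B B', L B -> L B' -> B `<` B' -> B' `<=` A -> (l B < l B')%N) ->
  finite_length L A.
Proof.
move=> L0 LA B0 lP; suff H m B : (l B < m)%N -> L B -> B `<=` A -> finite_length L B.
  exact: (H _ A (ltnSn _)).
elim: m B => [//|m IHm] B lBm LB BA.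
have [->|Bn0] := pselect (B = [set 0]); first by exists 0%N, (fun=> [set 0]); split.
(* The values of [l] on proper members of [L] below [B]; they are bounded by [l B], and [[set 0]]
   provides one. *)
pose Q k := `[< exists B', [/\ L B', B' `<` B & l B' = k] >].
have exQ : exists k, Q k.
  exists (l [set 0]); apply/asboolP; exists [set 0]; split=> //; split=> [_ ->|B1].
    exact: B0.
  by apply: Bn0; apply/seteqP; split=> // _ ->; exact: B0.
have ubQ k : Q k -> (k <= l B)%N.
  by move=> /asboolP[B' [LB' B'B <-]]; apply/ltnW/lP.
case: (ex_maxnP exQ ubQ) => k /asboolP[B' [LB' B'B kE]] kmax.
have lB' : (l B' < l B)%N by exact: lP.
have [|//||n [C [C0 Cn CL CS]]] := IHm B'.
- by rewrite (leq_trans lB').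
- exact: subset_trans (properW B'B) BA.
exists n.+1, (fun i => if (i <= n)%N then C i else B); split.
- by [].
- by rewrite ltnn.
- by move=> i _; case: ifP => // /CL.
move=> i; rewrite ltnS {1}leq_eqVlt => /predU1P[->|i_n]; last first.
  by rewrite (ltnW i_n) i_n; exact: CS.
rewrite leqnn ltnn Cn; split=> // D LD B'D DB.
have [BD|nBD] := pselect (B `<=` D); first by right; apply/seteqP.
left; apply/seteqP; split=> //; apply: contrapT => nDB'.
have : (l D <= k)%N by apply: kmax; apply/asboolP; exists D.
by rewrite -kE leqNgt lP //; exact: subset_trans DB BA.
Qed.

Lemma finite_length_image (V W : lmodType K) (h : {linear V -> W}) (A : set V) :
  injective h -> finite_length (@Ksubmod K V) A -> finite_length (@Ksubmod K W) (h @` A).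
Proof.
move=> hI [n [C [C0 Cn CL CS]]]; exists n, (fun k => h @` C k); split.
- by rewrite C0 image_set1 raddf0.
- by rewrite Cn.
- move=> k /CL[Ck0 CkL]; split; first by exists 0; rewrite ?raddf0.
  by move=> a _ _ [x Cx <-] [y Cy <-]; exists (a *: x + y); [exact: CkL|rewrite linearP].
move=> k /CS[[CC nCC] simple]; split.
  split; first exact: image_subset.
  by move=> sub; apply: nCC => x Cx; have [|y Cy /hI <-//] := sub (h x); exists x.
move=> B KB CB BC.
have imB : h @` (h @^-1` B) = B.
  apply/seteqP; split=> [_ [x Bx <-] //|y By].
  by have [x _ xE] := BC y By; exists x => //=; rewrite xE.
have [||x /= /BC[y Cy /hI<-]//|E|E] := simple (h @^-1` B).
- split=> /= [|a x y Bx By]; first by rewrite raddf0; exact: KB.1.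
  by rewrite linearP; exact: KB.2.
- by move=> x Cx; apply: CB; exists x.
- by left; rewrite -imB E.
- by right; rewrite -imB E.
Qed.

Lemma finite_length0 (V : lmodType K) : finite_length (@Ksubmod K V) [set 0].
Proof.
exists 0%N, (fun=> [set 0]); split=> // k _; split=> // a _ _ -> ->.
by rewrite scaler0 addr0.
Qed.

End FiniteLength.

(** * Noetherian and endofinite modules *)

Section Noetherian.
Variables (K : comPzRingType) (R : nualg K).
Implicit Types (N X Y Z : numod R).

Definition fg_sub N (S : submod N) : Prop :=
  exists s : seq N, (forall x, x \in s -> S x) /\
    forall S' : submod N, (forall x, x \in s -> S' x) -> forall x, S x -> S' x.

Definition noeth N : Prop := forall S : submod N, fg_sub S.

Lemma noeth_fin_gen N (S : submod N) : noeth N -> fin_gen (smod S).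
Proof.
move=> nN; have [s [sS sH]] := nN S.
have [t tE] : exists t : seq (smod S), s = map (incl S) t.
  elim: s sS {sH} => [|x s IHs] sS; first by exists [::].
  have [|t ->] := IHs; first by move=> y ys; apply: sS; rewrite inE ys orbT.
  have [|y <-] := @incl_surj _ _ _ S x; first by apply: sS; rewrite mem_head.
  by exists (y :: t).
exists t => S' tS' x; have [|x' S'x' /incl_inj<- //] := sH (img (incl S) S') _ _ (inclP x).
by move=> y; rewrite tE => /mapP[y' /tS' y'S' ->]; exists y'.
Qed.

Lemma noeth_epi Y Z (p : nhom Y Z) : epi p -> noeth Y -> noeth Z.
Proof.
move=> pe nY S; have [s [sS sH]] := nY (preimg p S).
exists (map p s); split=> [_ /mapP[y /sS yS ->] //|S' sS' z Sz].
have [y yE] := pe z; rewrite -yE; apply: (sH (preimg p S')) => [x xs|/=].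
  by apply: sS'; exact: map_f.
by rewrite yE.
Qed.

Definition sm_cap N (S S' : submod N) : submod N.
Proof.
refine (@SubMod K R N (fun x => S x /\ S' x) _ _ _).
- by split; exact: sm_0.
- by move=> x y [Sx S'x] [Sy S'y]; split; exact: sm_B.
- by move=> r x [Sx S'x]; split; exact: sm_act.
Defined.

Lemma noeth_ses X Y Z (i : nhom X Y) (p : nhom Y Z) : ses i p ->
  noeth X -> noeth Z -> noeth Y.
Proof.
move=> [im pe E] nX nZ S.
have [s [sS sH]] := nX (preimg i S); have [t [tS tH]] := nZ (img p S).
have [u [uS tE]] : exists u : seq Y, (forall y, y \in u -> S y) /\ t = map p u.
  elim: t tS {tH} => [|z t IHt] tS; first by exists [::].
  have [|u [uS ->]] := IHt; first by move=> y yt; apply: tS; rewrite inE yt orbT.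
  have [|y Sy <-] := tS z; first exact: mem_head.
  by exists (y :: u); split=> // y'; rewrite inE => /predU1P[->|/uS].
exists (u ++ map i s); split=> [y|S' uS' y Sy].
  by rewrite mem_cat => /orP[/uS //|/mapP[x /sS xS ->]].
(* Taking the image of [sm_cap S S'] rather than of [S'] puts the lift [y'] in [S] as well, so that
   [y - y'] lies in [S] and comes from [preimg i S]. *)
have [||y' [Sy' S'y'] py'] := tH (img p (sm_cap S S')) _ (p y).
- move=> z; rewrite tE => /mapP[y' y'u ->]; exists y' => //; split; first exact: uS.
  by apply: uS'; rewrite mem_cat y'u.
- by exists y.
have /E[x xE] : p (y - y') = 0 by rewrite raddfB py' subrr.
rewrite -[y](subrK y'); apply: sm_D => //; rewrite -xE.
apply: (sH (preimg i S')); last by rewrite /= xE; exact: sm_B.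
by move=> x' x's; apply: uS'; rewrite mem_cat map_f ?orbT.
Qed.

Lemma noeth_zero N : (forall x : N, x = 0) -> noeth N.
Proof. by move=> N0 S; exists [::]; split=> // S' _ x _; rewrite (N0 x); exact: sm_0. Qed.

Lemma fin_gen_epi Y Z (p : nhom Y Z) : epi p -> fin_gen Y -> fin_gen Z.
Proof.
move=> pe [s sH]; exists (map p s) => S sS z; have [y <-] := pe z.
by apply: (sH (preimg p S)) => x xs; apply: sS; exact: map_f.
Qed.

Lemma fin_gen_ses X Y Z (i : nhom X Y) (p : nhom Y Z) : ses i p ->
  fin_gen X -> fin_gen Z -> fin_gen Y.
Proof.
move=> [im pe E] [s sH] [t tH].
have [c cE] := choice pe.
exists (map i s ++ map c t) => S stS y.
have [y' Sy' py'] : img p S (p y).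
  apply: tH => z zt; exists (c z) => //; apply: stS.
  by rewrite mem_cat map_f ?orbT.
have /E[x xE] : p (y - y') = 0 by rewrite raddfB py' subrr.
rewrite -[y](subrK y'); apply: sm_D => //; rewrite -xE.
by apply: (sH (preimg i S)) => x' x's; apply: stS; rewrite mem_cat map_f.
Qed.

Section LocallyFinite.
Variables (I : choiceType) (e : I -> R).
Hypothesis eW : wei e.
Hypothesis eL : forall i j, finite_length (@Ksubmod K R)
  [set x : R | exists r, x = e j ** r ** e i].

(** Scalars of $\mathbb{K}$ act on $Re_i$ by endomorphisms, so endomorphism-stable subgroups are
    $\mathbb{K}$-submodules. The number of factors they meet in a $\mathbb{K}$-composition series of
    $e_kRe_i$ is then a strictly monotone measure. *)
Lemma endofinite_Rmul i : endofinite e (Rmul (e i)).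
Proof.
move=> k; have [n [C [C0 Cn CL CS]]] := eL i k.
have KB B : Endsubmod B -> Ksubmod (@rval _ _ _ e i @` B).
  move=> [B0 BB Bend]; split; first by exists 0.
  move=> a _ _ [x Bx <-] [y By <-].
  have ax (z : Rmul (e i)) : lideal (e i) (a *: rval z : regmod R).
    by have [r rE] := inclP z; exists (a *: r); rewrite /rval rE na_mulZl.
  have hB : zmod_morphism (fun z : Rmul (e i) => sm_elt (ax z) : Rmul (e i)).
    move=> z t; apply: (@rval_inj _ _ _ e i); rewrite [RHS]rvalB.
    change (a *: rval (z - t) = a *: rval z - a *: rval t).
    by rewrite rvalB scalerBr.
  have hZ (r : R) (z : Rmul (e i)) :
      (sm_elt (ax (r |> z)) : Rmul (e i)) = r |> (sm_elt (ax z) : Rmul (e i)).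
    apply: (@rval_inj _ _ _ e i).
    by change (a *: (r ** rval z) = r ** (a *: rval z)); rewrite na_mulZr.
  pose h := mkhom hB hZ.
  (* [Endsubmod] provides closure under differences only, whence this form of $ax+y$. *)
  exists (h x - (0 - y)); first by apply: (BB); [exact: Bend|exact: BB].
  by rewrite sub0r opprK rvalD.
apply: (finite_length_measure (l := fun B => #|jumps n C (@rval _ _ _ e i @` B)|)).
- split=> // [_ _ -> ->|f _ ->]; [exact: subrr|exact: raddf0].
- split=> [|_ _ [x ->] [y ->]|f _ [x ->]].
  + by exists 0; rewrite nm_actr0.
  + by exists (x - y); rewrite nm_actB.
  + by exists (f x); rewrite nhom_act.
- by move=> B [].
move=> B B' LB LB' [BB' nBB'] B'A; apply: jumps_proper => //; try exact: KB.
  split; first exact: image_subset.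
  move=> sub; apply: nBB' => x B'x; have [|y By /(@rval_inj _ _ _ e i)<- //] := sub (rval x).
  by exists x.
rewrite Cn => _ [y /B'A[x ->] <-] /=; have [r rE] := inclP x.
by exists r; rewrite rval_act -na_mulA -rE.
Qed.

Hypothesis eS : forall i, finite_set [set k | exists r, e k ** r ** e i <> 0].

(** A submodule $S$ is the sum of the $e_kS$. Each lies in $e_kRe_i$, of finite length, hence is
    finitely generated over $\mathbb{K}$, and by [eS] only finitely many of them are nonzero. *)
Lemma noeth_Rmul i : noeth (Rmul (e i)).
Proof.
move=> S; pose part (S : submod (Rmul (e i))) k : set R :=
  @rval _ _ _ e i @` [set y | S y /\ e k |> y = y].
have Kpart S' k : Ksubmod (part S' k).
  split; first by exists 0 => //; split; [exact: sm_0|rewrite nm_actr0].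
  move=> a _ _ [x [Sx xE] <-] [y [Sy yE] <-].
  (* Modules carry no action of $\mathbb{K}$, so $ax$ is realised as $(ae_k)x$, using $e_kx=x$. *)
  exists ((a *: e k) |> x + y).
    split; first by apply: sm_D => //; exact: sm_act.
    by rewrite nm_actDr yE nm_actA na_mulZr (wei_idem eW).
  by rewrite /rval raddfD nhom_act /= na_mulZl -[e k ** _]/(rval (e k |> x)) xE.
have [ks ksE] := (finite_seqP _).1 (eS i).
(* It suffices to capture the pieces $e_kx$ for $k$ in the support: a local unit writes $x$ as the
   sum of its $e_kx$, and the other pieces vanish. *)
suff [s [sS sH]] : exists s : seq (Rmul (e i)), (forall x, x \in s -> S x) /\
    forall S' : submod _, (forall x, x \in s -> S' x) ->
    forall k, k \in ks -> forall x, S x -> S' (e k |> x).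
  exists s; split=> // S' sS' x Sx.
  have [t ut tx] := wei_lunit eW (rval x).
  have -> : x = \sum_(k <- t) e k |> x by rewrite -act_lunit; apply: rval_inj; rewrite rval_act.
  apply: sm_sum => k _.
  have [kks|/negP kks] := boolP (k \in ks); first exact: sH.
  suff -> : e k |> x = 0 by exact: sm_0.
  apply: rval_inj; rewrite rval_act; have [r rE] := inclP x; rewrite rval0 /rval rE na_mulA.
  apply: contrapT => H; apply: kks.
  have : [set k | exists r, e k ** r ** e i <> 0] k by exists r.
  by rewrite ksE.
elim: {ksE} ks => [|k ks [s [sS sH]]]; first by exists [::].
have [n [C [C0 Cn CL CS]]] := eL i k.
have [|t [tB tH]] := Ksubmod_gen C0 CL CS (Kpart S k).
  rewrite Cn => _ [x [_ <-] <-] /=; have [r rE] := inclP x.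
  by exists r; rewrite rval_act -na_mulA -rE.
have [u [uS tE]] : exists u : seq (Rmul (e i)), (forall y, y \in u -> S y /\ e k |> y = y) /\
    t = map (@rval _ _ _ e i) u.
  elim: t tB {tH} => [|z t IHt] tB; first by exists [::].
  have [|u [uS ->]] := IHt; first by move=> y yt; apply: tB; rewrite inE yt orbT.
  have [|y Sy <-] := tB z; first exact: mem_head.
  by exists (y :: u); split=> // y'; rewrite inE => /predU1P[->|/uS].
exists (u ++ s); split=> [x|S' usS' k'].
  by rewrite mem_cat => /orP[/uS[]|/sS].
rewrite inE => /predU1P[->|k'ks] x Sx; last first.
  by apply: sH => // y ys; apply: usS'; rewrite mem_cat ys orbT.
have [||y [S'y _] /(@rval_inj _ _ _ e i)<- //] := tH (part S' k) (Kpart S' k) _ (rval (e k |> x)).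
  move=> z; rewrite tE => /mapP[y yu ->]; exists y => //; split; last by case: (uS y yu).
  by apply: usS'; rewrite mem_cat yu.
exists (e k |> x) => //; split; first exact: sm_act.
by rewrite nm_actA (wei_idem eW).
Qed.

End LocallyFinite.

(** * Covers of finitely generated modules by finite sums of the $Re_i$ *)

Section FiniteFree.
Variables (I : choiceType) (e : I -> R).
Hypothesis eW : wei e.

(** An iterated binary product instead of [dsum], so that projectivity, noetherianity and dimension
    bounds follow by induction on the list. *)
Fixpoint ffree (v : seq I) : numod R :=
  if v is i :: v' then nprod (Rmul (e i)) (ffree v') else nzero R.

Lemma projective_ffree v : projective (ffree v).
Proof.
elim: v => [|i v IHv] /=; first by apply: projective_zero; exact: nzero0.
by apply: projective_prod => //; exact: projective_Rmul.
Qed.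

Lemma noeth_ffree v : (forall i, noeth (Rmul (e i))) -> noeth (ffree v).
Proof.
move=> nR; elim: v => [|i v IHv] /=; first by apply: noeth_zero; exact: nzero0.
exact: noeth_ses (ses_prod _ _) _ _.
Qed.

(** Each generator $x$ is replaced by the elements $e_ix$ for $i$ in a local unit of $x$; these are
    images of generators of the $Re_i$. *)
Lemma fin_gen_ffree N : unitary N -> fin_gen N ->
  exists (v : seq I) (p : nhom (ffree v) N), epi p.
Proof.
move=> /(unitaryP eW) uN [s sH].
have [w wH] : exists w : seq (I * N), forall S : submod N,
    (forall q, q \in w -> S (e q.1 |> q.2)) -> forall x, x \in s -> S x.
  elim: s {sH} => [|x s [w wH]]; first by exists [::].
  have [t _ tx] := uN x; exists ([seq (i, x) | i <- t] ++ w) => S wS y.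
  rewrite inE => /predU1P[->|ys]; last first.
    by apply: wH => // q qw; apply: wS; rewrite mem_cat qw orbT.
  rewrite -tx act_lunit; apply: sm_sum => i it.
  by apply: (wS (i, x)); rewrite mem_cat; apply/orP; left; apply/mapP; exists i.
exists (map fst w).
have [p pE] : exists p : nhom (ffree (map fst w)) N, forall q, q \in w ->
    exists z, p z = e q.1 |> q.2.
  elim: w {wH} => [|q w [p pE]] /=; first by exists (hzero _ _).
  exists (hadd (hcomp (rhom e q.1 q.2) (nfst _ _)) (hcomp p (nsnd _ _))) => q'.
  rewrite inE => /predU1P[->|/pE[z <-]].
    by exists (rgen eW q.1, 0); rewrite /= raddf0 addr0.
  by exists (0, z); rewrite /= -[RHS]add0r; congr (_ + _); exact: raddf0 (rhom _ _ _).
exists p => x.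
have [|y _ yE] := sH (img p (sm_top _)) _ x; last by exists y.
by move=> y; apply: wH => q /pE[z <-]; exists z.
Qed.

Lemma fin_gen_noeth N : (forall i, noeth (Rmul (e i))) -> unitary N -> fin_gen N -> noeth N.
Proof.
by move=> nR uN /(fin_gen_ffree uN)[v [p pe]]; apply: noeth_epi pe _; exact: noeth_ffree.
Qed.

End FiniteFree.
End Noetherian.

(** * Standard modules *)

Section WellOrder.
Variables (W : Type) (le : rel W).
Hypothesis wo : well_order le.

Let wo_min (A : W -> Prop) x : A x ->
  exists2 z, A z & (forall y, A y -> le z y) /\
    forall z', A z' -> (forall y, A y -> le z' y) -> z = z'.
Proof.
move=> Ax; pose A' : {pred W} := fun x => `[< A x >].
have [|z [[/asboolP Az zl] zu]] := wo (A := A'); first by exists x; exact/asboolP.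
exists z => //; split=> [y Ay|z' Az' z'l]; first exact/zl/asboolP.
by apply: zu; split=> [|y /asboolP]; [exact/asboolP|exact: z'l].
Qed.

Lemma wo_refl x : le x x.
Proof. by have [|z -> [zl _]] := @wo_min (eq^~ x) x; [|exact: zl]. Qed.

Lemma wo_total x y : le x y || le y x.
Proof.
have [|z Az [zl _]] := @wo_min (fun z => z = x \/ z = y) x; first by left.
by apply/orP; case: Az zl => -> zl; [left|right]; apply: zl; [right|left].
Qed.

Lemma wo_anti x y : le x y -> le y x -> x = y.
Proof.
move=> xy yx; have [|z Az [_ zu]] := @wo_min (fun z => z = x \/ z = y) x; first by left.
have <- : z = x by apply: zu; [left|move=> t [->|->] //; exact: wo_refl].
by apply: zu; [right|move=> t [->|->] //; exact: wo_refl].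
Qed.

Lemma wo_trans y x z : le x y -> le y z -> le x z.
Proof.
move=> xy yz.
have [|m Am [ml _]] := @wo_min (fun t => [\/ t = x, t = y | t = z]) x; first by constructor 1.
case: Am ml => -> ml; first by apply: ml; constructor 3.
  by rewrite (@wo_anti x y) //; apply: ml; constructor 1.
by rewrite -(@wo_anti y z) //; apply: ml; constructor 2.
Qed.

Lemma wo_lt_trans y x z : ~~ le y x -> ~~ le z y -> ~~ le z x.
Proof.
move=> yx; apply: contra => zx; apply: (wo_trans zx).
by have := wo_total x y; rewrite (negPf yx) orbF.
Qed.

Lemma wo_lt_le_trans y x z : ~~ le y x -> le y z -> ~~ le z x.
Proof. by move=> yx yz; apply: contra yx; exact: wo_trans yz. Qed.

End WellOrder.

Section Standard.
Variables (K : comPzRingType) (R : nualg K) (I : choiceType) (e : I -> R).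
Hypothesis eW : wei e.
Implicit Types (N X Y Z : numod R) (Q : set I).

(* The submodule generated by the e_t N with t in Q, in impredicative form *)
Definition espan Q N : submod N.
Proof.
refine (@SubMod K R N (fun x => forall S : submod N,
  (forall t y, Q t -> S (e t |> y)) -> S x) _ _ _).
- by move=> S _; exact: sm_0.
- by move=> x y Hx Hy S HS; apply: sm_B; [exact: Hx|exact: Hy].
- by move=> r x Hx S HS; apply: sm_act; exact: Hx.
Defined.

Lemma espan_e Q N t (x : N) : Q t -> espan Q N (e t |> x).
Proof. by move=> Qt S HS; exact: HS. Qed.

Lemma espan_fix Q N t (x : N) : Q t -> e t |> x = x -> espan Q N x.
Proof. by move=> Qt <-; exact: espan_e. Qed.

Lemma espan_hom Q Y Z (h : nhom Y Z) y : espan Q Y y -> espan Q Z (h y).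
Proof.
move=> /(_ (preimg h (espan Q Z))); apply=> t x Qt /=.
by rewrite nhom_act; exact: espan_e.
Qed.

Lemma espan_epi Q Y Z (p : nhom Y Z) : epi p ->
  forall z, espan Q Z z -> exists2 y, espan Q Y y & p y = z.
Proof.
move=> pe z /(_ (img p (espan Q Y))); apply=> t z' Qt.
have [y <-] := pe z'; exists (e t |> y); first exact: espan_e.
exact: nhom_act.
Qed.

Section Partition.
Variables (W : Type) (le : rel W) (A : W -> set I).

Definition below i : set I := [set t | exists2 j, ~~ le i j & A j t].

(** A morphism $Re_t\to N$ is determined by the image of the generator, which ranges over $e_tN$. So
    the images of the projectives below $i$ generate the same submodule as the $e_tN$. *)
Lemma trace_espan i N x : trace (Pbelow e le A i) N x <-> espan (below i) N x.
Proof.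
split=> [[s ->] S HS|].
  elim: s => [|[phi z] s IHs]; first by rewrite big_nil; exact: sm_0.
  rewrite big_cons; apply: sm_D => //= {s IHs}; apply: (dsum_ind (S := preimg phi S)) => -[j ij] w.
  apply: (dsum_ind (S := preimg (hcomp phi (dinj _ _)) S)) => -[t At] y.
  pose psi := hcomp (hcomp phi (dinj (fun j : {j | ~~ le i j} => Pbar e A (sval j)) (exist _ j ij)))
    (dinj (fun r : {r | A j r} => Rmul (e (sval r))) (exist _ t At)).
  change (S (psi y)); rewrite (rhom_gen eW psi y) rhomE -(e_rgen eW t) nhom_act.
  by apply/sm_act/HS; exists j.
move/(_ (trace (Pbelow e le A i) N)); apply=> t y [j ij At].
(* The single element $e_ty$ is reached by projecting the double direct sum onto its summand $Re_t$
   and then sending the generator to $e_ty$. *)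
pose phi := hcomp (hcomp (rhom e t y)
  (dprj (fun r : {r | A j r} => Rmul (e (sval r))) (exist _ t At)))
  (dprj (fun j : {j | ~~ le i j} => Pbar e A (sval j)) (exist _ j ij)).
exists [:: (phi, dinj (fun j : {j | ~~ le i j} => Pbar e A (sval j)) (exist _ j ij)
   (dinj (fun r : {r | A j r} => Rmul (e (sval r))) (exist _ t At) (rgen eW t)))].
by rewrite big_seq1 [phi]lock /= -lock !hcompE !dprj_inj rhomE.
Qed.

Lemma unitary_Delta i t : unitary (Delta e le A i t).
Proof. exact/unitary_qmod/(projective_Rmul eW t).1. Qed.

Lemma unitary_Delta_all N : Delta_all e le A N -> unitary N.
Proof. by move=> [i [t _ ->]]; exact: unitary_Delta. Qed.

Hypothesis wo : well_order le.

(** An index below $i$ is also below $k$, so $e_tRe_s$ already lies in the trace that is divided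
    out. *)
Lemma Delta_free i k s t (x : Delta e le A k s) : le i k -> below i t -> e t |> x = 0.
Proof.
move=> ik [j ij At]; have [y <-] := proj_surj x.
rewrite -nhom_act; apply/proj_eq0/trace_espan/espan_e.
by exists j => //; exact: wo_lt_le_trans ij ik.
Qed.

(* If the factor Delta_t(k) has k < i then it splits off Y modulo the trace: the
   lift of its generator to Y is unique up to the trace. *)
Lemma ses_espan i k t X Y (f : nhom X Y) (p : nhom Y (Delta e le A k t)) :
  ses f p -> A k t -> ~~ le i k ->
  exists (f' : nhom (smod (espan (below i) X)) (smod (espan (below i) Y)))
         (p' : nhom (smod (espan (below i) Y)) (Delta e le A k t)), ses f' p'.
Proof.
move=> E At ik; have [fm pe Ef] := E.
have ki s : below k s -> below i s.
  by move=> [j kj As]; exists j => //; exact: wo_lt_trans kj ik.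
have fS x : espan (below i) X x -> img f (espan (below i) X) (f x) by exists x.
(* The preimage of $e_sy$ in $X$ is again fixed by $e_s$, since [f] is injective; so it lies in the
   span inside $X$ and not merely in $X$. *)
have fT s y : below i s -> p (e s |> y) = 0 -> img f (espan (below i) X) (e s |> y).
  move=> Is /Ef[x xE]; exists x => //; apply: (espan_fix Is).
  by apply: (nmono_inj fm); rewrite nhom_act xE nm_actA (wei_idem eW).
have [y0 y0E] := pe (proj _ (rgen eW t)).
pose h := rhom e t y0.
have hE w : p (h w) = proj _ w by rewrite rhomE nhom_act y0E -nhom_act act_rgen.
(* The trace in $Re_t$ is spanned by elements $e_sv$ with $s$ below $k$, hence below $i$, and [p]
   kills their images under [h]; so [fT] applies. *)
have hT w : std_trace e le A k t w -> img f (espan (below i) X) (h w).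
  move=> /trace_espan/(_ (preimg h (img f (espan (below i) X)))); apply=> s v ks.
  change (img f (espan (below i) X) (h (e s |> v))); rewrite nhom_act; apply: fT; first exact: ki.
  by rewrite -nhom_act hE; apply/proj_eq0/trace_espan/espan_e.
have YE y : espan (below i) Y y -> exists w, img f (espan (below i) X) (y - h w).
  (* [D] is the sum of the image of [h] and of the span of $X$, written as a preimage of an image to
     obtain a submodule at once. *)
  pose D : submod Y := preimg (proj (img f (espan (below i) X)))
    (img (hcomp (proj (img f (espan (below i) X))) h) (sm_top _)).
  move=> /(_ D) H; have [|w _ wE] := H.
    move=> s v Is; have [w wE] := proj_surj (p v).
    exists (e s |> w) => //; apply/eqP; rewrite hcompE -subr_eq0 -raddfB; apply/eqP.
    rewrite nhom_act -nm_actB; apply/proj_eq0/fT => //.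
    by rewrite nhom_act raddfB hE wE subrr nm_actr0.
  exists w; apply/proj_eq0; rewrite raddfB -wE hcompE subrr //.
have fY (x : smod (espan (below i) X)) : espan (below i) Y (hcomp f (incl _) x).
  exact: (espan_hom f (inclP x)).
exists (corestr fY), (hcomp p (incl _)); split.
- move=> x /(congr1 (incl _)); rewrite corestrE raddf0 => /fm x0.
  by apply: incl_inj; rewrite raddf0.
(* As $k<i$, the index $t$ itself is below $i$, so the whole standard module is spanned by its
   generator and [p'] is onto. *)
- move=> z; have Zz : espan (below i) (Delta e le A k t) z.
    have [w <-] := proj_surj z; rewrite -(act_rgen eW w) nhom_act.
    apply/sm_act; rewrite -(e_rgen eW) nhom_act; apply: espan_e.
    by exists k.
  have [y Yy yE] := espan_epi pe Zz; have [v vE] := incl_surj Yy.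
  by exists v; rewrite hcompE vE.
move=> v; split=> [|[x <-]]; last by rewrite hcompE corestrE hcompE (ses_comp0 _ E).
rewrite hcompE => pv; have [w wE] := YE _ (inclP v).
have /hT hw : std_trace e le A k t w.
  apply/proj_eq0; rewrite -hE; have [x _ xE] := wE.
  have := ses_comp0 x E; rewrite xE raddfB pv sub0r => /eqP.
  by rewrite oppr_eq0 => /eqP.
have [x Xx xE] : img f (espan (below i) X) (incl _ v).
  by rewrite -[incl _ v](subrK (h w)); exact: sm_D.
have [x' x'E] := incl_surj Xx; exists x'.
by apply: incl_inj; rewrite corestrE hcompE x'E.
Qed.

(** Along the filtration, a factor of index at least $i$ leaves the span unchanged, by [Delta_free],
    while a factor of smaller index is added to it in full, by [ses_espan]. *)
Lemma filt_espan i N : filt (Delta_all e le A) N ->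
  filt (Delta_below e le A i) (smod (espan (below i) N)).
Proof.
elim=> {N} [N N0|X Y Z f p E _ IHX [k [t At ZE]]].
  by apply: filt_zero => x; apply: incl_inj; rewrite raddf0 (N0 (incl _ x)).
rewrite {}ZE in p E; have [ik|ik] := boolP (le i k); last first.
  have [f' [p' E']] := ses_espan E At ik.
  by apply: (filt_ext E' IHX); exists k => //; exists t.
have [fm pe Ef] := E.
have fY (x : smod (espan (below i) X)) : espan (below i) Y (hcomp f (incl _) x).
  exact: (espan_hom f (inclP x)).
apply: (filt_isom _ IHX); apply: (@isom_of _ _ _ _ (corestr fY)).
  move=> x /(congr1 (incl _)); rewrite corestrE raddf0 => /fm x0.
  by apply: incl_inj; rewrite raddf0.
move=> v; have [x Xx xE] : img f (espan (below i) X) (incl _ v).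
  have /(_ (img f (espan (below i) X))) := inclP v; apply=> s y Is.
  have /Ef[x xE] : p (e s |> y) = 0 by rewrite nhom_act (Delta_free _ ik).
  exists x => //; apply: (espan_fix Is); apply: (nmono_inj fm).
  by rewrite nhom_act xE nm_actA (wei_idem eW).
have [x' x'E] := incl_surj Xx; exists x'.
by apply: incl_inj; rewrite corestrE hcompE x'E.
Qed.

End Partition.

Lemma Pfin_Rmul t : Pfin (Rmul (e t)).
Proof.
split; first exact: (projective_Rmul eW t).1.
  exists [:: rgen eW t] => S sS x; rewrite -(act_rgen eW x).
  by apply/sm_act/sS; rewrite mem_head.
by apply/(pd_finP eW); exists 0%N; exact: projective_Rmul.
Qed.

Lemma std_stratified W (le : rel W) (A : W -> set I) :
  basic_wei e -> wo_partition le A ->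
  modclass_eq (Ff (Delta_all e le A)) (@Pfin K R) -> left_std_stratified e le A.
Proof.
move=> eB [wo Apart] E; split=> // i t At.
have /E/FfP[_ ft] := Pfin_Rmul t.
apply/FfP; split; first exact/(unitary_smod eW)/(projective_Rmul eW t).1.
apply: filt_isom (filt_espan wo i ft).
have sE (x : smod (espan (below le A i) (Rmul (e t)))) : std_trace e le A i t (incl _ x).
  exact/trace_espan/inclP.
apply: (@isom_of _ _ _ _ (corestr sE)) => [x|y].
  by move=> /(congr1 (incl _)); rewrite corestrE raddf0 => x0; apply: incl_inj; rewrite raddf0.
have /trace_espan/incl_surj[x xE] := inclP y.
by exists x; apply: incl_inj; rewrite corestrE.
Qed.

End Standard.

(** * Modules over the triangular algebra *)

Lemma wei_opp (K : comPzRingType) (R : nualg K) (I : choiceType) (e : I -> R) :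
  wei e -> @wei K (nuopp R) I e.
Proof. by move=> [idem orth l r]; split=> // i j ij; apply: orth => /esym. Qed.

Section TriangularModules.
Variables (K : comPzRingType) (U T : nualg K) (M : bimod U T).
Local Notation L := (triangular M).
Implicit Types (N : numod L) (Y : numod U) (X : numod T).

Definition inT (t : T) : L := (t, 0, 0).
Definition inM (m : M) : L := (0, m, 0).
Definition inU (u : U) : L := (0, 0, u).

Lemma bm_l0 (u : U) : bm_l u (0 : M) = 0.
Proof. exact: (@nm_actr0 _ _ (bm_left M)). Qed.

Lemma bm_0l (m : M) : bm_l (0 : U) m = 0.
Proof. exact: (@nm_act0r _ _ (bm_left M)). Qed.

(** The right action as a left action of the opposite algebra, so that the lemmas on left modules
    serve both sides. *)
Definition bm_right : numod (nuopp T).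
Proof.
refine (@NuMod K (nuopp T) M (fun t m => bm_r m t) _ _ _) => *.
- exact: bm_rA.
- exact: bm_rDr.
- exact: bm_rDl.
Defined.

Lemma bm_r0 (m : M) : bm_r m (0 : T) = 0.
Proof. exact: (@nm_act0r _ _ bm_right). Qed.

Lemma bm_0r (t : T) : bm_r (0 : M) t = 0.
Proof. exact: (@nm_actr0 _ _ bm_right). Qed.

Lemma triE (x : L) : x = inT x.1.1 + inM x.1.2 + inU x.2.
Proof. by case: x => [[t m] u]; congr (_, _, _) => /=; rewrite ?addr0 ?add0r. Qed.

Lemma tri_mulE (x y : L) :
  x ** y = (x.1.1 ** y.1.1, bm_r x.1.2 y.1.1 + bm_l x.2 y.1.2, x.2 ** y.2).
Proof. by case: x y => [[t m] u] [[t' m'] u']. Qed.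

Definition tri0E := (na_mul0l, na_mul0r, bm_l0, bm_0l, bm_r0, bm_0r, addr0, add0r).

Lemma mulTl t (x : L) : inT t ** x = inT (t ** x.1.1).
Proof. by rewrite tri_mulE /= !tri0E. Qed.

Lemma mulTU t u : inT t ** inU u = 0.
Proof. by rewrite mulTl /= !tri0E. Qed.

Lemma mulTM t m : inT t ** inM m = 0.
Proof. by rewrite mulTl /= !tri0E. Qed.

Lemma mulTT t t' : inT t ** inT t' = inT (t ** t').
Proof. exact: mulTl. Qed.

Lemma mulUU u u' : inU u ** inU u' = inU (u ** u').
Proof. by rewrite tri_mulE /= !tri0E. Qed.

Lemma mulMU m u : inM m ** inU u = 0.
Proof. by rewrite tri_mulE /= !tri0E. Qed.

Lemma inTD t t' : inT (t + t') = inT t + inT t'.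
Proof. by congr (_, _, _); rewrite addr0. Qed.

Lemma inUD u u' : inU (u + u') = inU u + inU u'.
Proof. by congr (_, _, _); rewrite addr0. Qed.

Definition inflU Y : numod L.
Proof.
by refine (@NuMod K L Y (fun x y => x.2 |> y) _ _ _) => [[? r] [? s] y|[? r] [? s] y|[? r] y z];
  rewrite ?nm_actA ?tri_mulE ?nm_actDl ?nm_actDr.
Defined.

Definition inflT X : numod L.
Proof.
by refine (@NuMod K L X (fun x y => x.1.1 |> y) _ _ _) =>
  [[[r ?] ?] [[s ?] ?] y|[[r ?] ?] [[s ?] ?] y|[[r ?] ?] y z];
  rewrite ?nm_actA ?tri_mulE ?nm_actDl ?nm_actDr.
Defined.

(** Restriction along [inU]. Neither [resU N] nor [resT N] is unitary in general; they serve to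
    compare spans over $U$ or $T$ with spans over $\Lambda$. *)
Definition resU N : numod U.
Proof.
by refine (@NuMod K U N (fun u y => inU u |> y) _ _ _) => [r s y|r s y|r y z];
  rewrite ?nm_actA ?mulUU ?inUD ?nm_actDl ?nm_actDr.
Defined.

Definition resT N : numod T.
Proof.
by refine (@NuMod K T N (fun u y => inT u |> y) _ _ _) => [r s y|r s y|r y z];
  rewrite ?nm_actA ?mulTT ?inTD ?nm_actDl ?nm_actDr.
Defined.

Definition toU N (x : N) : resU N := x.
Definition toT N (x : N) : resT N := x.

Lemma toU_act N u (x : N) : u |> toU x = toU (inU u |> x). Proof. by []. Qed.
Lemma toT_act N t (x : N) : t |> toT x = toT (inT t |> x). Proof. by []. Qed.

Lemma inflUE Y (x : L) (y : inflU Y) : x |> y = x.2 |> (y : Y). Proof. by []. Qed.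
Lemma inflTE X (x : L) (y : inflT X) : x |> y = x.1.1 |> (y : X). Proof. by []. Qed.

Definition inflUh Y Y' (h : nhom Y Y') : nhom (inflU Y) (inflU Y') :=
  @mkhom _ _ (inflU Y) (inflU Y') h (raddfB h) (fun x y => nhom_act h x.2 y).

Definition inflTh X X' (h : nhom X X') : nhom (inflT X) (inflT X') :=
  @mkhom _ _ (inflT X) (inflT X') h (raddfB h) (fun x y => nhom_act h x.1.1 y).

Definition uninflU Y Y' (h : nhom (inflU Y) (inflU Y')) : nhom Y Y' :=
  @mkhom _ _ Y Y' h (raddfB h) (fun u y => nhom_act h (inU u) y).

Definition uninflT X X' (h : nhom (inflT X) (inflT X')) : nhom X X' :=
  @mkhom _ _ X X' h (raddfB h) (fun u y => nhom_act h (inT u) y).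

Definition resUsub N (S : submod N) : submod (resU N) :=
  @SubMod _ _ (resU N) S (sm_0 S) (@sm_B _ _ _ S) (fun u => @sm_act _ _ _ S (inU u)).

Definition resTsub N (S : submod N) : submod (resT N) :=
  @SubMod _ _ (resT N) S (sm_0 S) (@sm_B _ _ _ S) (fun u => @sm_act _ _ _ S (inT u)).

Definition inflUsub Y (S : submod Y) : submod (inflU Y) :=
  @SubMod _ _ (inflU Y) S (sm_0 S) (@sm_B _ _ _ S) (fun x => @sm_act _ _ _ S x.2).

Definition inflTsub X (S : submod X) : submod (inflT X) :=
  @SubMod _ _ (inflT X) S (sm_0 S) (@sm_B _ _ _ S) (fun x => @sm_act _ _ _ S x.1.1).

Definition uninflUsub Y (S : submod (inflU Y)) : submod Y :=
  @SubMod _ _ Y S (sm_0 S) (@sm_B _ _ _ S) (fun u => @sm_act _ _ _ S (inU u)).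

Definition uninflTsub X (S : submod (inflT X)) : submod X :=
  @SubMod _ _ X S (sm_0 S) (@sm_B _ _ _ S) (fun u => @sm_act _ _ _ S (inT u)).

Lemma ses_inflU Y Y' Y2 (i : nhom Y Y') (p : nhom Y' Y2) :
  ses i p -> ses (inflUh i) (inflUh p).
Proof. by case. Qed.

Lemma ses_inflT X X' X2 (i : nhom X X') (p : nhom X' X2) :
  ses i p -> ses (inflTh i) (inflTh p).
Proof. by case. Qed.

Lemma fin_gen_inflU Y : fin_gen (inflU Y) <-> fin_gen Y.
Proof.
split=> -[s sH]; exists s => S sS.
  exact: (sH (inflUsub S)).
exact: (sH (uninflUsub S)).
Qed.

Lemma fin_gen_inflT X : fin_gen (inflT X) <-> fin_gen X.
Proof.
split=> -[s sH]; exists s => S sS.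
  exact: (sH (inflTsub S)).
exact: (sH (uninflTsub S)).
Qed.

Lemma isom_inflU Y Y' : isom (inflU Y) (inflU Y') <-> isom Y Y'.
Proof.
by split=> -[h hb]; [exists (uninflU h)|exists (inflUh h)].
Qed.

(** An annihilator on the left is a submodule here because $T\Lambda\subseteq T$, by [mulTl]. *)
Definition upart N : submod N.
Proof.
refine (@SubMod _ _ N (fun x => forall t, inT t |> x = 0) _ _ _).
- by move=> t; rewrite nm_actr0.
- by move=> x y Hx Hy t; rewrite nm_actB Hx Hy subrr.
- by move=> r x Hx t; rewrite nm_actA mulTl Hx.
Defined.

Lemma upart_inU N u (x : N) : upart N (inU u |> x).
Proof. by move=> t; rewrite nm_actA mulTU nm_act0r. Qed.

Lemma upart_inM N m (x : N) : upart N (inM m |> x).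
Proof. by move=> t; rewrite nm_actA mulTM nm_act0r. Qed.

(* A module over the triangular algebra is a U-module Y and a T-module X with a map
   M (x)_T X -> Y; FU and FT take the two components, inflU Y is (0, Y) and
   inflT X is (X, 0). *)
Definition FU N : numod U := resU (smod (upart N)).
Definition FT N : numod T := resT (qmod (upart N)).

Definition uval N (x : FU N) : N := incl (upart N) x.

Lemma uval0 N : uval (0 : FU N) = 0.
Proof. rewrite /uval /FU /resU; cbn [nm_sort]; exact: (raddf0 (incl (upart N))). Qed.

Lemma uvalB N (x y : FU N) : uval (x - y) = uval x - uval y.
Proof. rewrite /uval /FU /resU; cbn [nm_sort]; exact: (raddfB (incl (upart N))). Qed.

Lemma uval_act N u (x : FU N) : uval (u |> x) = inU u |> uval x.
Proof. exact: (nhom_act (incl (upart N)) (inU u) x). Qed.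

Lemma uval_inj N : injective (@uval N).
Proof. exact: (@incl_inj _ _ N (upart N)). Qed.

Lemma uvalP N (x : FU N) : upart N (uval x).
Proof. exact: (inclP (S := upart N)). Qed.

Lemma uval_surj N x : upart N x -> exists y : FU N, uval y = x.
Proof. exact: (@incl_surj _ _ N (upart N)). Qed.

Definition tproj N (x : N) : FT N := proj (upart N) x.

Lemma tproj0 N : tproj (0 : N) = 0.
Proof. rewrite /tproj /FT /resT; cbn [nm_sort]; exact: (raddf0 (proj (upart N))). Qed.

Lemma tprojB N (x y : N) : tproj (x - y) = tproj x - tproj y.
Proof. rewrite /tproj /FT /resT; cbn [nm_sort]; exact: (raddfB (proj (upart N))). Qed.

Lemma tprojD N (x y : N) : tproj (x + y) = tproj x + tproj y.
Proof. rewrite /tproj /FT /resT; cbn [nm_sort]; exact: (raddfD (proj (upart N))). Qed.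

Lemma tproj_act N t (x : N) : tproj (inT t |> x) = t |> tproj x.
Proof. exact: (nhom_act (proj (upart N)) (inT t) x). Qed.

Lemma tproj_surj N (y : FT N) : exists x, tproj x = y.
Proof. exact: (proj_surj (S := upart N)). Qed.

Lemma tproj_eq0 N (x : N) : tproj x = 0 <-> upart N x.
Proof. rewrite /tproj /FT /resT; cbn [nm_sort]; exact: (proj_eq0 (upart N)). Qed.

Lemma upart_hom N N' (h : nhom N N') x : upart N x -> upart N' (h x).
Proof. by move=> Hx t; rewrite -nhom_act Hx raddf0. Qed.

Lemma upart_mono N N' (h : nhom N N') x : mono h -> upart N' (h x) -> upart N x.
Proof. by move=> hm Hx t; apply: hm; rewrite nhom_act Hx. Qed.

Definition FUh0 N N' (h : nhom N N') : nhom (smod (upart N)) (smod (upart N')) :=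
  @corestr _ _ _ _ (upart N') (hcomp h (incl (upart N)))
    (fun x => upart_hom h (inclP (S := upart N) x)).

Definition FUh N N' (h : nhom N N') : nhom (FU N) (FU N') :=
  @mkhom _ _ (FU N) (FU N') (FUh0 h) (raddfB (FUh0 h)) (fun u y => nhom_act (FUh0 h) (inU u) y).

Lemma FUhE N N' (h : nhom N N') (x : FU N) : uval (FUh h x) = h (uval x).
Proof. by []. Qed.

(** The entries of $\Lambda$ in $M$ and $U$ send everything into [upart N], so only the entry in $T$
    acts on the quotient. *)
Definition tprojh N : nhom N (inflT (FT N)).
Proof.
refine (@mkhom _ _ N (inflT (FT N)) (@tproj N) (@tprojB N) _) => x y.
rewrite inflTE -tproj_act; apply: subr0_eq; rewrite -tprojB; apply/tproj_eq0.
rewrite {1}[x]triE !nm_actDl addrC !addrA addNr add0r.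
by apply: sm_D; [exact: upart_inM|exact: upart_inU].
Defined.

Lemma FT_lift N X (q : nhom N (inflT X)) : (forall x, upart N x -> q x = 0) ->
  exists k : nhom (FT N) X, forall x, k (tproj x) = q x.
Proof.
move=> q0; have [|x /tproj_eq0/q0//|k kE] := @epi_factor _ _ _ _ _ (tprojh N) q.
  exact: tproj_surj.
by exists (uninflT k).
Qed.

Fact FTh_subproof N N' (h : nhom N N') x : upart N x -> hcomp (tprojh N') h x = 0.
Proof. by move=> Hx; apply/tproj_eq0/upart_hom. Qed.

Definition FTh N N' (h : nhom N N') : nhom (FT N) (FT N') :=
  sval (cid (FT_lift (@FTh_subproof N N' h))).

Lemma FThE N N' (h : nhom N N') (x : N) : FTh h (tproj x) = tproj (h x).
Proof. by rewrite /FTh; case: cid. Qed.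

Lemma FU_isom N N' : isom N N' -> isom (FU N) (FU N').
Proof.
move=> /isomP[h [hm he]]; apply: (@isom_of _ _ _ _ (FUh h)) => [x x0|z].
  by apply: uval_inj; rewrite uval0; apply: hm; rewrite -FUhE x0 uval0.
have [x xE] := he (uval z).
have Hx : upart N x by apply: (upart_mono hm); rewrite xE; exact: uvalP.
by have [w wE] := uval_surj Hx; exists w; apply: uval_inj; rewrite FUhE wE.
Qed.

Lemma FT_isom N N' : isom N N' -> isom (FT N) (FT N').
Proof.
move=> /isomP[h [hm he]]; apply: (@isom_of _ _ _ _ (FTh h)) => [x|z].
  have [y <-] := tproj_surj x.
  by rewrite FThE => /tproj_eq0/(upart_mono hm)/tproj_eq0.
have [y <-] := tproj_surj z; have [x <-] := he y.
by exists (tproj x); rewrite FThE.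
Qed.

Lemma FT_ofP N X (q : nhom N (inflT X)) : epi q ->
  (forall y, q y = 0 <-> upart N y) -> isom (FT N) X.
Proof.
move=> qe qE; have [|k kE] := @FT_lift N X q; first by move=> y /qE.
apply: (@isom_of _ _ _ _ k) => [y|x].
  by have [z <-] := tproj_surj y; rewrite kE => /qE/tproj_eq0.
by have [y <-] := qe x; exists (tproj y).
Qed.

End TriangularModules.

Opaque FU FT toU toT.

(** * Idempotents of the triangular algebra and exactness of the two components *)

Section TriangularWei.
Variables (K : comPzRingType) (U T : nualg K) (M : bimod U T).
Variables (I J : choiceType) (e : I -> U) (f : J -> T).
Hypotheses (eW : wei e) (fW : wei f) (Mu : bi_unitary M).
Local Notation L := (triangular M).
Local Notation g := (tri_idem M e f).
Implicit Types (N : numod L) (Y : numod U) (X : numod T).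

Lemma isum_tri (s : seq I) (t : seq J) :
  isum g (map inl s ++ map inr t) = inU M (isum e s) + inT M (isum f t).
Proof.
rewrite /isum big_cat !big_map; congr (_ + _).
  elim: s => [|i s IHs]; first by rewrite !big_nil.
  by rewrite !big_cons inUD IHs.
elim: t => [|j t IHt]; first by rewrite !big_nil.
by rewrite !big_cons inTD IHt.
Qed.

Lemma uniq_tri (s : seq I) (t : seq J) : uniq s -> uniq t ->
  uniq (map inl s ++ map inr t : seq (I + J)).
Proof.
move=> us ut; rewrite cat_uniq !map_inj_uniq ?us ?ut //; try by move=> x y [].
by rewrite andbT; apply/hasPn => _ /mapP[j _ ->]; apply/mapP => -[].
Qed.

Lemma unitary_regmod (R : nualg K) (I' : choiceType) (e' : I' -> R) :
  wei e' -> unitary (regmod R).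
Proof. by move=> e'W; apply/(unitaryP e'W) => x; exact: wei_lunit. Qed.

(** A left local unit of a matrix needs one idempotent of $U$ fixing both entries $m$ and $u$. It
    comes from unitarity of the product module $M\times U$; on the right, $M\times T$ over the
    opposite algebra of $T$ is used. *)
Lemma wei_tri : wei g.
Proof.
have uM : unitary (bm_left M) by case: Mu.
have uM' : unitary (bm_right M).
  move=> m; have [s {1}->] := Mu.2 m; exists [seq (p.2, p.1) | p <- s].
  by rewrite big_map.
apply/weiP; split.
- by case=> [i|j]; rewrite /= ?tri0E ?(wei_idem eW) ?(wei_idem fW).
- move=> [i|j] [i'|j'] ij /=; rewrite !tri0E // ?(wei_orth eW) ?(wei_orth fW) //.
    by move=> E; apply: ij; rewrite E.
  by move=> E; apply: ij; rewrite E.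
- move=> [[t m] u].
  have /(unitaryP eW)/(_ (m, u))[s us [sm su]] :=
    unitary_ses (ses_prod (bm_left M) (regmod U)) uM (unitary_regmod eW).
  have [s' us' st] := wei_lunit fW t.
  exists (map inl s ++ map inr s'); first exact: uniq_tri.
  rewrite isum_tri na_mulDl !tri_mulE /= !tri0E.
  by congr (_, _, _); rewrite /= ?addr0 ?add0r.
move=> [[t m] u].
have fW' := wei_opp fW.
have /(unitaryP fW')/(_ (m, t))[s us [sm st]] :=
  unitary_ses (ses_prod (bm_right M) (regmod (nuopp T))) uM' (unitary_regmod fW').
have [s' us' su] := wei_runit eW u.
exists (map inl s' ++ map inr s); first exact: uniq_tri.
rewrite isum_tri na_mulDr !tri_mulE /= !tri0E.
by congr (_, _, _); rewrite /= ?addr0 ?add0r.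
Qed.

Lemma upart_lunit N x : unitary N -> upart N x ->
  exists s : seq I, inU M (isum e s) |> x = x.
Proof.
move=> uN Hx; have [s' us' {2}<-] := (unitaryP wei_tri N).1 uN x.
exists (pmap (fun k : I + J => if k is inl i then Some i else None) s').
rewrite act_lunit {us'}; elim: s' => [|[i|j] s' IHs] /=.
- by rewrite big_nil /isum big_nil; apply: nm_act0r.
- by rewrite big_cons -IHs /isum big_cons inUD nm_actDl.
- by rewrite big_cons -IHs -[g (inr j)]/(inT M (f j)) Hx add0r.
Qed.

(** A local unit of $x$ is a sum of the $g_r$ and therefore has no entry in $M$. *)
Lemma decomp N (x : N) : unitary N -> exists u t, x = inU M u |> x + inT M t |> x.
Proof.
move=> uN; have [s us {1}<-] := (unitaryP wei_tri N).1 uN x.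
exists (isum g s).2, (isum g s).1.1; rewrite -nm_actDl; congr (_ |> x).
rewrite /isum {us}; elim: s => [|[i|j] s IHs].
- by rewrite !big_nil; congr (_, _, _); rewrite /= addr0.
- rewrite !big_cons {}IHs; congr (_, _, _) => /=; rewrite ?addr0 ?add0r //.
- rewrite !big_cons {}IHs; congr (_, _, _) => /=; rewrite ?addr0 ?add0r //.
Qed.

(** Such an $x$ is fixed by an element of $U$, and $MU=0$ inside $\Lambda$. *)
Lemma upart_M0 N x m : unitary N -> upart N x -> inM m |> x = 0.
Proof.
by move=> uN /(upart_lunit uN)[s <-]; rewrite nm_actA mulMU nm_act0r.
Qed.

Lemma unitary_inflU Y : unitary Y <-> unitary (inflU M Y).
Proof.
split=> [/(unitaryP eW) uY|/(unitaryP wei_tri) uY y]; last first.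
  by have [s _ sy] := uY y; exists [:: ((isum g s).2, y)]; rewrite big_seq1.
apply/(unitaryP wei_tri) => y; have [s us sy] := uY y.
exists (map inl s ++ map inr [::]); first exact: uniq_tri.
by rewrite isum_tri /isum big_nil -{2}sy inflUE /= addr0.
Qed.

Lemma unitary_inflT X : unitary X <-> unitary (inflT M X).
Proof.
split=> [/(unitaryP fW) uY|/(unitaryP wei_tri) uY y]; last first.
  by have [s _ sy] := uY y; exists [:: ((isum g s).1.1, y)]; rewrite big_seq1.
apply/(unitaryP wei_tri) => y; have [s us sy] := uY y.
exists (map inl [::] ++ map inr s); first exact: uniq_tri.
by rewrite isum_tri /isum big_nil -{2}sy inflTE /= add0r.
Qed.

Lemma unitary_FU N : unitary N -> unitary (FU N).
Proof.
move=> uN x; have [s sx] := upart_lunit uN (uvalP x).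
by exists [:: (isum e s, x)]; rewrite big_seq1; apply: uval_inj; rewrite uval_act.
Qed.

Lemma unitary_FT N : unitary N -> unitary (FT N).
Proof.
move=> uN x; have [y <-] := tproj_surj x; have [u [t yE]] := decomp y uN.
exists [:: (t, tproj y)]; rewrite big_seq1 -tproj_act {1}yE tprojD.
by rewrite (tproj_eq0 _).2 ?add0r //; exact: upart_inU.
Qed.

Lemma upart_inflT X (x : inflT M X) : unitary X -> upart (inflT M X) x -> x = 0.
Proof.
by move=> /(unitaryP fW) uX Hx; have [s _ <-] := uX x; exact: Hx (isum f s).
Qed.

Lemma upart_inflU Y (y : inflU M Y) : upart (inflU M Y) y.
Proof. by move=> t; rewrite inflUE nm_act0r. Qed.

Lemma FU_inflU Y : isom (FU (inflU M Y)) Y.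
Proof.
pose h := @mkhom _ _ (FU (inflU M Y)) Y (@uval _ _ _ _ (inflU M Y))
  (@uvalB _ _ _ _ (inflU M Y)) (@uval_act _ _ _ _ (inflU M Y)).
apply: (@isom_of _ _ _ _ h) => [x x0|y]; last exact/uval_surj/upart_inflU.
by apply: uval_inj; rewrite uval0.
Qed.

Lemma FT_inflT X : unitary X -> isom (FT (inflT M X)) X.
Proof.
move=> uX; apply: (@FT_ofP _ _ _ _ _ _ (hid (inflT M X))) => [y|y]; first by exists y.
by split=> [/= ->|]; [exact: (sm_0 (upart (inflT M X)))|exact: upart_inflT].
Qed.

Lemma FT_inflU0 Y (x : FT (inflU M Y)) : x = 0.
Proof. by have [y <-] := tproj_surj x; apply/tproj_eq0/upart_inflU. Qed.

Lemma FU_inflT0 X (x : FU (inflT M X)) : unitary X -> x = 0.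
Proof.
by move=> uX; apply: uval_inj; rewrite uval0; apply: upart_inflT => //; exact: uvalP.
Qed.

Lemma ses_FU N N' N2 (i : nhom N N') (p : nhom N' N2) : unitary N' ->
  ses i p -> ses (FUh i) (FUh p).
Proof.
move=> uN' [im pe E]; split.
- move=> x x0; apply: uval_inj; rewrite uval0; apply: im.
  by rewrite -FUhE x0 uval0.
(* A preimage of an element killed by $T$ need not be killed by $T$; multiplying it by a local unit
   from $U$ repairs this without changing its image. *)
- move=> z; have [y yE] := pe (uval z).
  have uN2 := unitary_epi pe uN'.
  have [s sz] := upart_lunit uN2 (uvalP z).
  have [x xE] := uval_surj (upart_inU (isum e s) y).
  by exists x; apply: uval_inj; rewrite FUhE xE nhom_act yE.
move=> y; split=> [y0|[x <-]]; last first.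
  by apply: uval_inj; rewrite !FUhE uval0; apply/E; exists (uval x).
have /E[x xE] : p (uval y) = 0 by rewrite -FUhE y0 uval0.
have Hx : upart N x by apply: (upart_mono im); rewrite xE; exact: uvalP.
by have [w wE] := uval_surj Hx; exists w; apply: uval_inj; rewrite FUhE wE.
Qed.

Lemma ses_FT N N' N2 (i : nhom N N') (p : nhom N' N2) : unitary N' ->
  ses i p -> ses (FTh i) (FTh p).
Proof.
move=> uN' [im pe E]; split.
- move=> x; have [y <-] := tproj_surj x.
  by rewrite FThE => /tproj_eq0/(upart_mono im)/tproj_eq0.
- move=> z; have [y <-] := tproj_surj z; have [x <-] := pe y.
  by exists (tproj x); rewrite FThE.
move=> z; have [y <-] := tproj_surj z; split; last first.
  move=> [z' <-]; have [x <-] := tproj_surj z'.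
  by rewrite !FThE (_ : p (i x) = 0) ?tproj0 //; apply/E; exists x.
(* In $y=uy+ty$ the part $uy$ vanishes in the quotient, while $ty$ is killed by [p] and so comes
   from [N]. *)
rewrite FThE => /tproj_eq0 py; have [u [t yE]] := decomp y uN'.
have /E[x xE] : p (inT M t |> y) = 0 by rewrite nhom_act py.
exists (tproj x); rewrite FThE xE; apply: subr0_eq.
rewrite -tprojB; apply/tproj_eq0; rewrite -opprB; apply: sm_opp.
by rewrite {1}yE addrK; exact: upart_inU.
Qed.

Lemma upart_act N (x : L) (y : N) : unitary N -> upart N y -> x |> y = inU M x.2 |> y.
Proof.
by move=> uN Hy; rewrite {1}[x]triE !nm_actDl upart_M0 // Hy !add0r.
Qed.

Lemma ses_FU_FT N : unitary N -> exists (i : nhom (inflU M (FU N)) N)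
  (p : nhom N (inflT M (FT N))), ses i p.
Proof.
move=> uN.
have iZ (x : L) (y : inflU M (FU N)) : uval (x |> y) = x |> uval y.
  by rewrite inflUE uval_act [RHS]upart_act //; exact: uvalP.
exists (@mkhom _ _ (inflU M (FU N)) N (@uval _ _ _ _ N) (@uvalB _ _ _ _ N) iZ).
exists (tprojh N).
split=> [x x0|y|y]; first by apply: uval_inj; rewrite uval0.
  exact: tproj_surj.
by split=> [/tproj_eq0/uval_surj[x <-]|[x <-]]; [exists x|apply/tproj_eq0; exact: uvalP].
Qed.

(** Inflation from $U$ is left adjoint to the exact functor [FU], hence preserves projectives; as it
    is also full and keeps epimorphisms, it reflects them. *)
Lemma projective_inflU Y : projective Y <-> projective (inflU M Y).
Proof.
split=> [[uY pY]|[/unitary_inflU uY pY]].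
  split=> [|N N' uN uN' p h pe]; first exact/unitary_inflU.
  have hY (y : Y) : exists z : FU N', uval z = h y.
    by apply/uval_surj/upart_hom; exact: upart_inflU.
  have [k kE] := choice hY.
  have kB : zmod_morphism k.
    by move=> y z; apply: uval_inj; rewrite uvalB !kE; exact: (raddfB h).
  have kZ u (y : Y) : k (u |> y) = u |> k y.
    by apply: uval_inj; rewrite uval_act !kE; exact: (nhom_act h (inU M u)).
  have [_ FUe _] := ses_FU uN (ses_kernel pe).
  have [h' h'E] := pY _ _ (unitary_FU uN) (unitary_FU uN') (FUh p) (mkhom kB kZ) FUe.
  have iZ (x : L) (y : inflU M Y) : uval (h' (x |> y)) = x |> uval (h' y).
    by rewrite inflUE nhom_act uval_act [RHS]upart_act //; exact: uvalP.
  have iB (y z : Y) : uval (h' (y - z)) = uval (h' y) - uval (h' z).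
    by rewrite raddfB uvalB.
  exists (@mkhom _ _ (inflU M Y) N (fun y => uval (h' y)) iB iZ) => y.
  by rewrite -[LHS](FUhE p (h' y)) h'E; exact: kE.
split=> // Y1 Y2 /unitary_inflU uY1 /unitary_inflU uY2 p h pe.
have [k kE] := pY _ _ uY1 uY2 (inflUh M p) (inflUh M h) pe.
by exists (uninflU k).
Qed.

(** [FT] is left adjoint to the exact functor [inflT]: a morphism into a module on which only $T$
    acts kills [upart N]. *)
Lemma projective_FT N : projective N -> projective (FT N).
Proof.
move=> [uN pN]; split=> [|X X' uX uX' p h pe]; first exact: unitary_FT.
have [i [q [_ qe qE]]] := ses_FU_FT uN.
have [k kE] := pN _ _ ((unitary_inflT X).1 uX) ((unitary_inflT X').1 uX')
  (inflTh M p) (hcomp (inflTh M h) q) pe.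
have [|k' k'E] := @epi_factor _ _ _ _ _ q k qe.
  move=> x /qE[y <-]; apply: upart_inflT => //; apply: upart_hom; apply: upart_hom.
  exact: upart_inflU.
exists (uninflT k') => x; have [y <-] := qe x.
by rewrite -[LHS]/(p (k' (q y))) k'E; exact: kE.
Qed.

Lemma pdle_inflU n Y : pdle n Y -> pdle n (inflU M Y).
Proof.
elim: n Y => [|n IHn] Y; first by move/projective_inflU.
move=> [Z [P [i [p [/projective_inflU pP E /IHn pZ]]]]].
by exists (inflU M Z), (inflU M P), (inflUh M i), (inflUh M p); split=> //; exact: ses_inflU.
Qed.

(** A presentation of $Y$ inflates to a presentation over $\Lambda$, and by Schanuel the bound may
    be read from that one. *)
Lemma pdle_uninflU n Y : pdle n (inflU M Y) -> pdle n Y.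
Proof.
elim: n Y => [|n IHn] Y; first by move/projective_inflU.
move=> pY; have /unitary_inflU uY := pdle_unitary pY.
have [Z [P [i [p [pP uZ E]]]]] := ses_enough eW uY.
exists Z, P, i, p; split=> //; apply: IHn.
exact: (pdle_syzygy wei_tri (ses_inflU M E) ((projective_inflU P).1 pP)).
Qed.

Lemma pdle_FT n N : pdle n N -> pdle n (FT N).
Proof.
elim: n N => [|n IHn] N; first exact: projective_FT.
move=> [Z [P [i [p [pP E pZ]]]]].
exists (FT Z), (FT P), (FTh i), (FTh p); split; [exact: projective_FT| |exact: IHn].
by apply: ses_FT E; exact: pP.1.
Qed.

Lemma ses_Rmul_inr j : exists (i : nhom (inflU M (bm_Mf M (f j))) (Rmul (g (inr j))))
  (p : nhom (Rmul (g (inr j))) (inflT M (Rmul (f j)))), ses i p.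
Proof.
pose gW := wei_tri.
have lI (m : inflU M (bm_Mf M (f j))) :
    lideal (g (inr j)) (inM (incl (bm_Mf_sub M (f j)) m) : regmod L).
  have [n ->] := inclP (S := bm_Mf_sub M (f j)) m; exists (inM n).
  by rewrite tri_mulE /= !tri0E.
pose i (m : inflU M (bm_Mf M (f j))) : Rmul (g (inr j)) := sm_elt (lI m).
have iE m : rval (i m) = inM (incl (bm_Mf_sub M (f j)) m) by [].
have iB : zmod_morphism i.
  move=> m n; apply: rval_inj; rewrite [RHS]rvalB !iE.
  rewrite -[incl _ (m - n)]/(incl (bm_Mf_sub M (f j)) ((m : bm_Mf M (f j)) - (n : bm_Mf M (f j)))).
  rewrite raddfB; congr (_, _, _); by rewrite /= subr0.
have iZ (x : L) m : i (x |> m) = x |> i m.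
  apply: rval_inj; rewrite rval_act !iE inflUE nhom_act tri_mulE /= !tri0E //.
pose p := rhom g (inr j) (rgen fW j : inflT M (Rmul (f j))).
have pE y : p y = (rval y).1.1 |> rgen fW j by [].
exists (mkhom iB iZ), p; split.
- move=> m /(congr1 (@rval _ _ _ g (inr j))) /= m0.
  apply: (@incl_inj _ _ (bm_left M) (bm_Mf_sub M (f j))).
  by have := congr1 (fun x : L => x.1.2) m0.
- move=> x; exists (inT M (rval x) |> rgen gW (inr j)).
  by rewrite pE rval_act rval_gen mulTT (rvalE fW) act_rgen.
move=> y; have [r rE] := inclP (S := lideal (g (inr j))) y.
have {}rE : rval y = r ** g (inr j) := rE.
split=> [py|[m <-]]; last by rewrite pE iE; exact: nm_act0r.
have r0 : (rval y).1.1 = 0.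
  move: py => /(congr1 (@rval _ _ _ f j)); rewrite pE rval_act rval_gen rval0.
  by rewrite rE tri_mulE /= -na_mulA (wei_idem fW).
have [|m mE] := @incl_surj _ _ _ (bm_Mf_sub M (f j)) (rval y).1.2.
  by exists r.1.2; rewrite rE tri_mulE /= !tri0E.
exists m; apply: rval_inj; rewrite -[LHS]/(inM (incl (bm_Mf_sub M (f j)) m)) mE.
by rewrite [RHS]triE r0 rE tri_mulE /= !tri0E; congr (_, _, _); rewrite /= !tri0E.
Qed.

End TriangularWei.

(** * Standard modules over the triangular algebra *)

Section Joint.
Variables (I J V W : Type) (leV : rel V) (leW : rel W).

(** The minimum is the least left element if there is one, and otherwise the least right element. *)
Lemma joint_well_order : well_order leV -> well_order leW -> well_order (joint_le leV leW).
Proof.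
move=> woV woW A [x Ax].
have [[v Av]|noV] := pselect (exists v, inl v \in A).
  have [|z [[Az zl] zu]] := woV [pred v | inl v \in A]; first by exists v.
  exists (inl z); split; first by split=> // -[v'|w] // Av'; exact: zl.
  move=> [z'|w] [Az' z'l]; last by have := z'l _ Av.
  by congr inl; apply: zu; split=> // v' Av'; exact: (z'l (inl v')).
case: x Ax => [v Av|w Aw]; first by case: noV; exists v.
have [|z [[Az zl] zu]] := woW [pred w | inr w \in A]; first by exists w.
exists (inr z); split.
  by split=> // -[v|w'] Aw'; [case: noV; exists v|exact: zl].
move=> [v|z'] [Az' z'l]; first by case: noV; exists v.
by congr inr; apply: zu; split=> // w' Aw'; exact: (z'l (inr w')).
Qed.

Lemma joint_wo_partition (A : V -> set I) (B : W -> set J) :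
  wo_partition leV A -> wo_partition leW B ->
  wo_partition (joint_le leV leW) (joint_part A B).
Proof.
move=> [woV [coA trA neA]] [woW [coB trB neB]]; split; first exact: joint_well_order.
split.
- apply/seteqP; split=> // -[i|j] _.
    have [v _ Ai] : cover [set: V] A i by rewrite coA.
    by exists (inl v) => //; exists i.
  have [v _ Ai] : cover [set: W] B j by rewrite coB.
  by exists (inr v) => //; exists j.
- move=> [v|w] [v'|w'] _ _ [x [/= [i Ai <-] [i' Ai' E]]] //; case: E => E.
    by congr inl; apply: trA => //; exists i; split=> //; rewrite -E.
  by congr inr; apply: trB => //; exists i; split=> //; rewrite -E.
- move=> [v|w] _ /=.
    by have [i Ai] := neA v Logic.I; exists (inl i), i.
  by have [i Ai] := neB w Logic.I; exists (inr i), i.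
Qed.

End Joint.

Section TriangularStandard.
Variables (K : comPzRingType) (U T : nualg K) (M : bimod U T).
Variables (I J : choiceType) (e : I -> U) (f : J -> T).
Hypotheses (eW : wei e) (fW : wei f) (Mu : bi_unitary M).
Local Notation L := (triangular M).
Local Notation g := (tri_idem M e f).
Implicit Types (N : numod L) (Y : numod U) (X : numod T).
Let gW : wei g.
Proof. exact: wei_tri. Qed.

(** * Finite projective dimension over the triangular algebra *)

Section FiniteDimension.
Hypothesis M_pd : forall j, pd (bm_Mf M (f j)) <> None.
Hypothesis fN : forall j, noeth (Rmul (f j)).
Hypothesis gN : forall r, noeth (Rmul (g r)).

(** By [ses_Rmul_inr] each summand costs at most one more than $\mathrm{pd}(Mf_j)$; the maximum
    exists because [v] is a finite list. *)
Lemma pdle_inflT_ffree v : exists m, pdle m (inflT M (ffree f v)).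
Proof.
elim: v => [|j v [m pv]] /=.
  by exists 0%N; apply: projective_zero; exact: (@nzero0 _ T).
have [i [p E]] := ses_Rmul_inr eW fW Mu j.
have /(pd_finP eW)[k pk] := @M_pd j.
have pj : pdle k.+1 (inflT M (Rmul (f j))).
  apply: (pdle_quo E (pdle_inflU eW fW Mu pk)).
  by apply: (pdle_proj gW); exact: projective_Rmul.
exists (maxn k.+1 m); apply: (pdle_ses (ses_inflT M (ses_prod _ _))).
  exact: (pdle_leq gW (leq_maxl _ _) pj).
exact: (pdle_leq gW (leq_maxr _ _) pv).
Qed.

(** For [n = 0] the module is a retract of a finite free one. Otherwise the dimension of the
    inflated module exceeds by at most one the larger of those of the inflated syzygy and cover;
    noetherianity keeps the syzygy finitely generated. *)
Lemma pdle_inflT n X : fin_gen X -> pdle n X -> exists m, pdle m (inflT M X).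
Proof.
elim: n X => [|n IHn] X fX pX; have uX := pdle_unitary pX;
  have [v [p pe]] := fin_gen_ffree fW uX fX; have [m pm] := pdle_inflT_ffree v.
  have [s ps] := projective_split pX (projective_ffree fW v).1 pe.
  exists m; apply: (@pdle_retract _ _ _ _ gW _ _ _ (inflTh M s) (inflTh M p)) pm.
  exact: ps.
have E := ses_kernel pe.
have [|k pk] := IHn _ _ (pdle_syzygy fW E (projective_ffree fW v) pX).
  by apply/noeth_fin_gen/noeth_ffree.
exists (maxn k m).+1; apply: (pdle_quo (ses_inflT M E)).
  exact: (pdle_leq gW (leq_maxl _ _) pk).
by apply: (pdle_leq gW _ pm); rewrite ltnW // ltnS leq_maxr.
Qed.

Lemma Pfin_inflU Y : Pfin (inflU M Y) <-> Pfin Y.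
Proof.
split=> -[u fg p]; split.
- exact/(unitary_inflU eW fW Mu).
- exact/(fin_gen_inflU M Y).
- by move/(pd_finP gW): p => [n /(pdle_uninflU eW fW Mu) pn]; apply/(pd_finP eW); exists n.
- exact/(unitary_inflU eW fW Mu).
- exact/(fin_gen_inflU M Y).
- by move/(pd_finP eW): p => [n /(pdle_inflU eW fW Mu) pn]; apply/(pd_finP gW); exists n.
Qed.

Lemma Pfin_inflT X : Pfin (inflT M X) <-> Pfin X.
Proof.
split=> -[u fg p]; split.
- exact/(unitary_inflT eW fW Mu).
- exact/(fin_gen_inflT M X).
- move/(pd_finP gW): p => [n /(pdle_FT eW fW Mu) pn]; apply/(pd_finP fW); exists n.
  apply: (pdle_isom fW _ pn); apply/isom_sym/(FT_inflT M fW).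
  exact/(unitary_inflT eW fW Mu).
- exact/(unitary_inflT eW fW Mu).
- exact/(fin_gen_inflT M X).
- by move/(pd_finP fW): p => [n /(pdle_inflT fg) pn]; apply/(pd_finP gW).
Qed.

(** The component over $T$ is controlled by [FT] and [pdle_inflT]; that over $U$ then follows from
    the short exact sequence, through noetherianity for finite generation and [pdle_sub] for the
    dimension. *)
Lemma Pfin_tri N : unitary N -> (Pfin N <-> Pfin (FU N) /\ Pfin (FT N)).
Proof.
move=> uN; have [i [p E]] := ses_FU_FT eW fW Mu uN; have [im pe _] := E.
rewrite -Pfin_inflU -Pfin_inflT; split=> [[_ fgN /(pd_finP gW)[n pN]]|].
  have fgT := fin_gen_epi pe fgN.
  have [m pm] := pdle_inflT ((fin_gen_inflT M _).1 fgT) (pdle_FT eW fW Mu pN).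
  split; split=> //.
  - exact/(unitary_inflU eW fW Mu)/(unitary_FU eW fW Mu).
  - have [|h hE] := @mono_factor _ _ _ _ _ i (incl (img i (sm_top _))) im.
      by move=> w; have [x _ <-] := inclP w; exists x.
    apply: (fin_gen_epi (p := h) _ (noeth_fin_gen _ (fin_gen_noeth gW gN uN fgN))) => y.
    have [|w wE] := @incl_surj _ _ _ (img i (sm_top _)) (i y); first by exists y.
    by exists w; apply: (nmono_inj im); rewrite hE.
  - apply/(pd_finP gW); exists (maxn n m); apply: (pdle_sub gW E).
      exact: (pdle_leq gW (leq_maxl _ _) pN).
    by apply: (pdle_leq gW _ pm); rewrite ltnW // ltnS leq_maxr.
  - exact/(unitary_inflT eW fW Mu)/(unitary_FT eW fW Mu).
  - by apply/(pd_finP gW); exists m.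
move=> [[_ fgU /(pd_finP gW)[n pU]] [_ fgT /(pd_finP gW)[m pT]]]; split=> //.
  exact: fin_gen_ses E fgU fgT.
apply/(pd_finP gW); exists (maxn n m); apply: (pdle_ses E).
  exact: (pdle_leq gW (leq_maxl _ _) pU).
exact: (pdle_leq gW (leq_maxr _ _) pT).
Qed.

End FiniteDimension.

(** * Comparison of standard modules and of filtrations *)

Section StandardModules.
Variables (V W : Type) (leV : rel V) (leW : rel W) (A : V -> set I) (B : W -> set J).
Hypotheses (wA : wo_partition leV A) (wB : wo_partition leW B).
Local Notation leC := (joint_le leV leW).
Local Notation C := (joint_part A B).

Lemma inl_part i : exists v, A v i.
Proof.
have [_ [coA _ _]] := wA.
have [v _ Ai] : cover [set: V] A i by rewrite coA.
by exists v.
Qed.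

Lemma upart_espan (Q : set (I + J)) N x : unitary N -> (forall i, Q (inl i)) ->
  upart N x -> espan g Q N x.
Proof.
move=> uN QI Hx; have [s <-] := upart_lunit eW fW Mu uN Hx.
rewrite -[isum e s]/(\sum_(i <- s) e i) (_ : inU M _ = \sum_(i <- s) g (inl i)).
  by rewrite nm_act_suml; apply: sm_sum => i _; exact: espan_e.
elim: s => [|i s IHs]; first by rewrite !big_nil.
by rewrite !big_cons inUD IHs.
Qed.

Lemma espan_toU (Q : set I) (Q' : set (I + J)) N (x : N) : (forall i, Q i -> Q' (inl i)) ->
  espan e Q (resU N) (toU x) -> espan g Q' N x.
Proof.
move=> QQ' /(_ (resUsub (espan g Q' N))); apply=> i y Qi.
exact: (@espan_e _ _ _ g Q' N (inl i) y (QQ' i Qi)).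
Qed.

Lemma espan_toT (Q : set J) (Q' : set (I + J)) N (x : N) : (forall j, Q j -> Q' (inr j)) ->
  espan f Q (resT N) (toT x) -> espan g Q' N x.
Proof.
move=> QQ' /(_ (resTsub (espan g Q' N))); apply=> j y Qj.
exact: (@espan_e _ _ _ g Q' N (inr j) y (QQ' j Qj)).
Qed.

(** Only left indices lie below a left one, so the trace over $\Lambda$ is the trace over $U$. One
    inclusion carries spans along $Ue_i\to\Lambda g_i$; the other holds because the smaller
    idempotents act by zero on the standard module. *)
Lemma Delta_inl v i : A v i ->
  isom (Delta g leC C (inl v) (inl i)) (inflU M (Delta e leV A v i)).
Proof.
move=> Ai; pose q := rhom g (inl i) (proj _ (rgen eW i) : inflU M (Delta e leV A v i)).
have qE y : q y = proj (std_trace e leV A v i) ((rval y).2 |> rgen eW i).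
  exact: esym (nhom_act (proj (std_trace e leV A v i)) _ _).
apply: (@isom_quo _ _ _ _ q) => [x|y].
  have [w <-] := proj_surj x; exists (inU M (rval w) |> rgen gW (inl i)).
  by rewrite qE rval_act rval_gen mulUU (rvalE eW) act_rgen.
have stA := trace_espan eW leV A v (N := Rmul (e i)).
have stC := trace_espan gW leC C (inl v) (N := Rmul (g (inl i))).
rewrite qE (proj_eq0 (std_trace e leV A v i)); split=> [/stA|/stC].
  have yE : y = inU M (rval ((rval y).2 |> rgen eW i)) |> rgen gW (inl i).
    apply: rval_inj; rewrite rval_act rval_gen rval_act rval_gen -[LHS](rvalE gW).
    rewrite !tri_mulE /= !tri0E; congr (_, _, _).
    by rewrite -[RHS]na_mulA (wei_idem eW).
  move=> /(espan_hom (rhom e i (toU (rgen gW (inl i))))).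
  rewrite rhomE toU_act -yE => H; apply/stC; apply: (espan_toU _ H) => t [v' vv' At].
  by exists (inl v') => //; exists t.
move=> /(_ (kernel q)) H.
apply/(proj_eq0 (std_trace e leV A v i)); rewrite -qE; apply: H => t x [[v'|w'] //= vv' [t' At <-]].
apply: etrans (nhom_act q _ _) _; rewrite inflUE; apply: (@Delta_free _ _ _ e eW _ _ _ wA.1 v).
  exact: wo_refl wA.1 v.
by exists v'.
Qed.

(** Every left index lies below a right one, so the trace contains all of the part killed by $T$;
    what remains of $\Lambda g_j$ is $Tf_j$ with its own trace. *)
Lemma Delta_inr w j : B w j ->
  isom (Delta g leC C (inr w) (inr j)) (inflT M (Delta f leW B w j)).
Proof.
move=> Bj; pose q := rhom g (inr j) (proj _ (rgen fW j) : inflT M (Delta f leW B w j)).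
have qE y : q y = proj (std_trace f leW B w j) ((rval y).1.1 |> rgen fW j).
  exact: esym (nhom_act (proj (std_trace f leW B w j)) _ _).
apply: (@isom_quo _ _ _ _ q) => [x|y].
  have [z <-] := proj_surj x; exists (inT M (rval z) |> rgen gW (inr j)).
  by rewrite qE rval_act rval_gen mulTT (rvalE fW) act_rgen.
have stB := trace_espan fW leW B w (N := Rmul (f j)).
have stC := trace_espan gW leC C (inr w) (N := Rmul (g (inr j))).
have uP : unitary (Rmul (g (inr j))) := (projective_Rmul gW (inr j)).1.
have belowI i : below leC C (inr w) (inl i).
  by have [v Ai] := inl_part i; exists (inl v) => //; exists i.
rewrite qE (proj_eq0 (std_trace f leW B w j)); split=> [/stB|/stC].
  move=> /(espan_hom (rhom f j (toT (rgen gW (inr j))))); rewrite rhomE toT_act.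
  (* [z] keeps only the entry of [y] in $T$; the rest [y - z] is killed by $T$ and lies in the span
     by [upart_espan]. *)
  set z := inT M _ |> _ => H; apply/stC; rewrite -[y](subrK z); apply: sm_D; last first.
    by apply: (espan_toT _ H) => t [w' ww' Bt]; exists (inr w') => //; exists t.
  apply: upart_espan => // t; apply: rval_inj; rewrite rval_act mulTl rval0 rvalB.
  rewrite /z !rval_act !rval_gen mulTT /= -[rval y](rvalE gW) tri_mulE /=.
  by rewrite -!na_mulA !(wei_idem fW) subrr na_mul0r.
move=> /(_ (kernel q)) H.
apply/(proj_eq0 (std_trace f leW B w j)); rewrite -qE; apply: H => t x [[v'|w'] /= ww' [t' Bt <-]].
  by apply: etrans (nhom_act q _ _) _; rewrite inflTE nm_act0r.
apply: etrans (nhom_act q _ _) _; rewrite inflTE; apply: (@Delta_free _ _ _ f fW _ _ _ wB.1 w).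
  exact: wo_refl wB.1 w.
by exists w'.
Qed.

Lemma filt_inflU Y : filt (Delta_all e leV A) Y -> filt (Delta_all g leC C) (inflU M Y).
Proof.
elim=> {Y} [Y Y0|X Y Z i p E _ fX [v [t At ZE]]]; first exact: filt_zero.
rewrite {Z}ZE in p E.
apply: (filt_ses (ses_inflU M E) fX); apply: (filt_isom (Delta_inl At)); apply: filt_gen.
by exists (inl v), (inl t) => //; exists t.
Qed.

Lemma filt_inflT X : filt (Delta_all f leW B) X -> filt (Delta_all g leC C) (inflT M X).
Proof.
elim=> {X} [X X0|X Y Z i p E _ fX [v [t At ZE]]]; first exact: filt_zero.
rewrite {Z}ZE in p E.
apply: (filt_ses (ses_inflT M E) fX); apply: (filt_isom (Delta_inr At)); apply: filt_gen.
by exists (inr v), (inr t) => //; exists t.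
Qed.

Lemma filt_FU_FT N : filt (Delta_all g leC C) N ->
  filt (Delta_all e leV A) (FU N) /\ filt (Delta_all f leW B) (FT N).
Proof.
elim=> {N} [N N0|X Y Z i p E fX [IHU IHT] ThZ].
  split; apply: filt_zero => x; first by apply: uval_inj; rewrite uval0; exact: N0.
  by have [y <-] := tproj_surj x; rewrite (N0 y) tproj0.
have uD := @unitary_Delta_all _ _ _ _ gW _ leC C.
have uY : unitary Y := unitary_ses E (filt_unitary uD fX) (uD _ ThZ).
suff [fU fT] : filt (Delta_all e leV A) (FU Z) /\ filt (Delta_all f leW B) (FT Z).
  split; first exact: filt_ses (ses_FU eW fW Mu uY E) IHU fU.
  exact: filt_ses (ses_FT eW fW Mu uY E) IHT fT.
move: ThZ => [[v|w] [_ [t At <-] ->]].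
  have iso := Delta_inl At; split.
    apply: (filt_isom (X := Delta e leV A v t)); last by apply: filt_gen; exists v, t.
    by apply/isom_sym/(isom_trans (FU_isom iso))/FU_inflU.
  apply: filt_zero => x; have [h [hm _]] := isomP (FT_isom iso).
  by apply: hm; exact: FT_inflU0.
have iso := Delta_inr At; split.
  apply: filt_zero => x; have [h [hm _]] := isomP (FU_isom iso).
  by apply: hm; apply: (FU_inflT0 fW); exact: unitary_Delta.
apply: (filt_isom (X := Delta f leW B w t)); last by apply: filt_gen; exists w, t.
by apply/isom_sym/(isom_trans (FT_isom iso))/(FT_inflT M fW); exact: unitary_Delta.
Qed.

Lemma filt_inflUP Y : filt (Delta_all g leC C) (inflU M Y) <-> filt (Delta_all e leV A) Y.
Proof.
split; last exact: filt_inflU.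
by move=> /filt_FU_FT[fU _]; apply: filt_isom fU; exact: FU_inflU.
Qed.

Lemma filt_inflTP X : unitary X ->
  (filt (Delta_all g leC C) (inflT M X) <-> filt (Delta_all f leW B) X).
Proof.
move=> uX; split; last exact: filt_inflT.
by move=> /filt_FU_FT[_ fT]; apply: filt_isom fT; exact: (FT_inflT M fW uX).
Qed.

Lemma filt_tri N : unitary N -> (filt (Delta_all g leC C) N <->
  filt (Delta_all e leV A) (FU N) /\ filt (Delta_all f leW B) (FT N)).
Proof.
move=> uN; split; first exact: filt_FU_FT.
have [i [p E]] := ses_FU_FT eW fW Mu uN.
by move=> [/filt_inflU fU /filt_inflT fT]; exact: filt_ses E fU fT.
Qed.

Hypothesis M_pd : forall j, pd (bm_Mf M (f j)) <> None.
Hypothesis fN : forall j, noeth (Rmul (f j)).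
Hypothesis gN : forall r, noeth (Rmul (g r)).

(** One direction tests the equality on the modules $(0,Y)$ and $(X,0)$; the other holds because
    membership of a unitary $N$ in either class is decided by its two components. *)
Lemma Ff_Pfin_tri :
  modclass_eq (Ff (Delta_all g leC C)) (@Pfin K L) <->
  modclass_eq (Ff (Delta_all e leV A)) (@Pfin K U) /\
  modclass_eq (Ff (Delta_all f leW B)) (@Pfin K T).
Proof.
split=> [Ea|[Eb Ec] N].
  split=> [Y|X]; rewrite FfP.
    rewrite -Pfin_inflU -Ea FfP filt_inflUP.
    by split=> -[u fl]; split=> //; exact/(unitary_inflU eW fW Mu).
  rewrite -(Pfin_inflT M_pd fN) -Ea FfP.
  split=> [[u fl]|[/(unitary_inflT eW fW Mu) u fl]]; split=> //.
  - exact/(unitary_inflT eW fW Mu).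
  - exact/(filt_inflTP u).
  - exact/(filt_inflTP u).
split=> [/FfP[uN /(filt_tri uN)[fU fT]]|PN].
  apply/(Pfin_tri M_pd fN gN uN); split.
    by apply/Eb/FfP; split=> //; exact: (unitary_FU eW fW Mu).
  by apply/Ec/FfP; split=> //; exact: (unitary_FT eW fW Mu).
have uN : unitary N by case: PN.
have /(Pfin_tri M_pd fN gN uN)[/Eb/FfP[_ fU] /Ec/FfP[_ fT]] := PN.
by apply/FfP; split=> //; apply/filt_tri.
Qed.

End StandardModules.
End TriangularStandard.

(** * The triangular algebra is basic and locally bounded *)

Section LocallyBounded.
Variables (K : comPzRingType) (R : nualg K) (I : choiceType) (e : I -> R).

(** Finite length of the $e_jRe_i$ is symmetric in the two sides, so the right-hand condition is
    [endofinite_Rmul] over the opposite algebra. *)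
Lemma locally_bounded_basic : basic_wei e -> support_finite e -> locally_bounded e.
Proof.
move=> [_ eL eP _] eS; split=> //; split=> [i|i]; first exact: endofinite_Rmul.
apply: (@endofinite_Rmul K (nuopp R) I e) => i' j.
rewrite [X in finite_length _ X](_ : _ = [set x | exists r, x = e i' ** r ** e j]) //.
by apply/seteqP; split=> _ [r ->]; exists r; 
  [exact: (@na_mulA K R)|exact: esym (@na_mulA K R _ _ _)].
Qed.

End LocallyBounded.

(** * Basicness of the triangular algebra *)

Section TriangularBasic.
Variables (K : comPzRingType) (U T : nualg K) (M : bimod U T).
Variables (I J : choiceType) (e : I -> U) (f : J -> T).
Hypotheses (eB : basic_wei e) (fB : basic_wei f) (Mu : bi_unitary M).
Hypothesis M_length : forall i j, finite_length (@Ksubmod K M)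
  [set m : M | exists n : M, m = bm_l (e i) (bm_r n (f j))].
Hypothesis gS : support_finite (tri_idem M e f).
Local Notation L := (triangular M).
Local Notation g := (tri_idem M e f).
Let eW : wei e. Proof. by case: eB. Qed.
Let fW : wei f. Proof. by case: fB. Qed.
Let gW : wei g. Proof. exact: wei_tri. Qed.

Fact inU_linear : linear (inU M : U -> L).
Proof. by move=> a u v; congr (_, _, _); rewrite /= ?scaler0 ?addr0. Qed.

Fact inT_linear : linear (inT M : T -> L).
Proof. by move=> a u v; congr (_, _, _); rewrite /= ?scaler0 ?addr0. Qed.

Fact inM_linear : linear (@inM _ _ _ M : M -> L).
Proof. by move=> a u v; congr (_, _, _); rewrite /= ?scaler0 ?addr0. Qed.

Definition inUl : {linear U -> L} :=
  HB.pack (inU M : U -> L) (GRing.isLinear.Build K U L _ _ inU_linear).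
Definition inTl : {linear T -> L} :=
  HB.pack (inT M : T -> L) (GRing.isLinear.Build K T L _ _ inT_linear).
Definition inMl : {linear M -> L} :=
  HB.pack (@inM _ _ _ M : M -> L) (GRing.isLinear.Build K M L _ _ inM_linear).

(** Each $g_s\Lambda g_r$ sits in a single matrix entry: a corner of $U$, of $M$ or of $T$, or zero
    for the upper right entry. *)
Lemma tri_length r s : finite_length (@Ksubmod K L)
  [set x : L | exists y, x = g s ** y ** g r].
Proof.
case: r s => [i|j] [i'|j'].
- have [_ /(_ i i')/(finite_length_image (h := inUl) _) H _ _] := eB.
  rewrite [X in finite_length _ X](_ : _ = inUl @` [set x | exists r, x = e i' ** r ** e i]).
    by apply: H => x y [].
  apply/seteqP; split=> [_ [y ->]|_ [_ [r ->] <-]].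
    exists (e i' ** y.2 ** e i); first by exists y.2.
    by rewrite !tri_mulE /= !tri0E.
  by exists (inU M r); rewrite !tri_mulE /= !tri0E.
- rewrite [X in finite_length _ X](_ : _ = [set 0]); first exact: finite_length0.
  apply/seteqP; split=> [_ [y ->]|_ ->]; first by rewrite mulTl mulTU.
  by exists 0; rewrite na_mul0r na_mul0l.
- have H := finite_length_image (h := inMl) _ (M_length i' j).
  rewrite [X in finite_length _ X](_ : _ =
    inMl @` [set m | exists n, m = bm_l (e i') (bm_r n (f j))]).
    by apply: H => x y [].
  apply/seteqP; split=> [_ [y ->]|_ [_ [n ->] <-]].
    exists (bm_l (e i') (bm_r y.1.2 (f j))); first by exists y.1.2.
    by rewrite !tri_mulE /= !tri0E bm_lrA.
  by exists (inM n); rewrite !tri_mulE /= !tri0E bm_lrA.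
- have [_ /(_ j j')/(finite_length_image (h := inTl) _) H _ _] := fB.
  rewrite [X in finite_length _ X](_ : _ = inTl @` [set x | exists r, x = f j' ** r ** f j]).
    by apply: H => x y [].
  apply/seteqP; split=> [_ [y ->]|_ [_ [r ->] <-]].
    exists (f j' ** y.1.1 ** f j); first by exists y.1.1.
    by rewrite !tri_mulE /= !tri0E.
  by exists (inT M r); rewrite !tri_mulE /= !tri0E.
Qed.

(** Nonzero corners of $U$ stay nonzero in $\Lambda$, so each support set embeds in the preimage
    under [inl] of a finite one. *)
Lemma support_finite_inl : support_finite e.
Proof.
have [_ gS1 gS2] := gS; have [_ _ eP _] := eB.
have inl_inj (D : set I) : {in D &, injective (@inl I J)} by move=> x y _ _ [].
split=> // i.
  have := gS1 (inl i) => /(finite_preimage (inl_inj _)).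
  apply: sub_finite_set => k [r rE]; exists (inU M r) => E; apply: rE.
  exact: (congr1 (fun x : L => x.2) E).
have := gS2 (inl i) => /(finite_preimage (inl_inj _)).
apply: sub_finite_set => k [r rE]; exists (inU M r) => E; apply: rE.
  exact: (congr1 (fun x : L => x.2) E).
Qed.

Lemma support_finite_inr : support_finite f.
Proof.
have [_ gS1 gS2] := gS; have [_ _ fP _] := fB.
have inr_inj (D : set J) : {in D &, injective (@inr I J)} by move=> x y _ _ [].
split=> // i.
  have := gS1 (inr i) => /(finite_preimage (inr_inj _)).
  apply: sub_finite_set => k [r rE]; exists (inT M r) => E; apply: rE.
  exact: (congr1 (fun x : L => x.1.1) E).
have := gS2 (inr i) => /(finite_preimage (inr_inj _)).
apply: sub_finite_set => k [r rE]; exists (inT M r) => E; apply: rE.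
  exact: (congr1 (fun x : L => x.1.1) E).
Qed.

Lemma Rmul_inl i : isom (Rmul (g (inl i))) (inflU M (Rmul (e i))).
Proof.
pose q := rhom g (inl i) (rgen eW i : inflU M (Rmul (e i))).
have qE y : q y = (rval y).2 |> rgen eW i by [].
apply: (@isom_of _ _ _ _ q) => [y|x].
  move=> /(congr1 (@rval _ _ _ e i)); rewrite qE rval_act rval_gen [RHS]rval0 => y0.
  apply: rval_inj; rewrite rval0 -(rvalE gW) tri_mulE /= !tri0E y0 //.
exists (inU M (rval x) |> rgen gW (inl i)).
by rewrite qE rval_act rval_gen mulUU (rvalE eW) act_rgen.
Qed.

Lemma FT_Rmul_inr j : isom (FT (Rmul (g (inr j)))) (Rmul (f j)).
Proof.
have [i [p [im pe E]]] := ses_Rmul_inr eW fW Mu j.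
apply: (FT_ofP pe) => y; split=> [/E[x <-]|Hy].
  by apply: upart_hom; exact: upart_inflU.
apply: (upart_inflT fW); last exact: upart_hom.
exact: (projective_Rmul fW j).1.
Qed.

(** [FT] kills $\Lambda g_i$ but sends $\Lambda g_j$ to $Tf_j$, which is nonzero since $f_j$ is
    primitive. *)
Lemma Rmul_inl_inr i j : ~ isom (Rmul (g (inl i))) (Rmul (g (inr j))).
Proof.
move=> iso.
have [k [km ke]] := isomP (isom_trans (isom_sym (FT_Rmul_inr j))
  (isom_trans (FT_isom (isom_sym iso)) (FT_isom (Rmul_inl i)))).
have [_ _ /(_ j)[_ fj0 _] _] := fB; apply: fj0; rewrite -(rval_gen fW j).
by rewrite (km (rgen fW j)) ?rval0 //; exact: FT_inflU0.
Qed.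

Lemma basic_wei_tri : basic_wei g.
Proof.
(* Primitivity of the $g_r$ is part of [support_finite]. *)
have [gP _ _] := gS; have [_ _ _ eI] := eB; have [_ _ _ fI] := fB.
split=> //.
- move=> r s; exact: tri_length.
move=> [i|j] [i'|j'] gr iso.
- apply: (eI i i') => [ee|]; first by apply: gr => /=; rewrite ee.
  apply/(isom_inflU M); apply: isom_trans (isom_trans (isom_sym (Rmul_inl i)) iso) (Rmul_inl i').
- exact: Rmul_inl_inr iso.
- exact: Rmul_inl_inr (isom_sym iso).
apply: (fI j j') => [ff|]; first by apply: gr => /=; rewrite ff.
exact: isom_trans (isom_sym (FT_Rmul_inr j)) (isom_trans (FT_isom iso) (FT_Rmul_inr j')).
Qed.

End TriangularBasic.

Theorem theoremC (K : comPzRingType) (U T : nualg K) (I J : choiceType)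
    (e : I -> U) (f : J -> T) (M : bimod U T)
    (alpha beta : Type) (le_alpha : rel alpha) (le_beta : rel beta)
    (A : alpha -> set I) (B : beta -> set J)
    (I_nonempty : inhabited I) (J_nonempty : inhabited J)
    (U_basic : basic_wei e) (T_basic : basic_wei f)
    (M_unitary : bi_unitary M)
    (M_length : forall i j, finite_length (@Ksubmod K M)
       [set m : M | exists n : M, m = bm_l (e i) (bm_r n (f j))])
    (M_pd : forall j, pd (bm_Mf M (f j)) <> None)
    (Lambda_supp : support_finite (tri_idem M e f))
    (A_partition : wo_partition le_alpha A)
    (B_partition : wo_partition le_beta B) :
  let Lambda := triangular M in
  let g : I + J -> Lambda := tri_idem M e f in
  let le_gamma := joint_le le_alpha le_beta in
  let C := joint_part A B in
  let cond_a := modclass_eq (Ff (Delta_all g le_gamma C)) (@Pfin K Lambda) in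
  let cond_b := modclass_eq (Ff (Delta_all e le_alpha A)) (@Pfin K U) /\
                modclass_eq (Ff (Delta_all f le_beta B)) (@Pfin K T) in
  (cond_a <-> cond_b) /\
  (cond_a \/ cond_b ->
    [/\ locally_bounded g, locally_bounded e & locally_bounded f] /\
    [/\ left_std_stratified g le_gamma C,
        left_std_stratified e le_alpha A
      & left_std_stratified f le_beta B] /\
    [/\ fin_dim Lambda = pd_class (Delta_all g le_gamma C),
        fin_dim T = pd_class (Delta_all f le_beta B)
      & fin_dim U = pd_class (Delta_all e le_alpha A)]).
Proof.
move=> Lambda g le_gamma C cond_a cond_b.
have [eW eL _ _] := U_basic; have [fW fL _ _] := T_basic.
have gB : basic_wei g by exact: basic_wei_tri.
have [gW gL _ _] := gB.
have eS := support_finite_inl U_basic Lambda_supp.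
have fS := support_finite_inr T_basic Lambda_supp.
have fN : forall j, noeth (Rmul (f j)).
  by have [_ fS1 _] := fS; exact: noeth_Rmul.
have gN : forall r, noeth (Rmul (g r)).
  by have [_ gS1 _] := Lambda_supp; exact: noeth_Rmul.
have ab : cond_a <-> cond_b by exact: Ff_Pfin_tri.
split=> // abor; have ca : cond_a by case: abor => // /ab.
have [cU cT] := ab.1 ca.
have C_partition : wo_partition le_gamma C by exact: joint_wo_partition.
split; first by split; exact: locally_bounded_basic.
split; first by split; apply: std_stratified.
split.
- by apply: (fin_dim_filt gW) ca; exact: unitary_Delta_all.
- by apply: (fin_dim_filt fW) cT; exact: unitary_Delta_all.
- by apply: (fin_dim_filt eW) cU; exact: unitary_Delta_all.
Qed.
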